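(* Let $\Phi_1(x)$, $x\ge 0$, be an $m_2\times m_1$ matrix function which is boundedly differentiable on each finite interval $[0,l]$ and satisfies $\Phi_1(0)=0$. For each $0<l<\infty$ let the operator $S_l\in B\big(L^2_{m_2}(0,l)\big)$ be given by $$(S_lf)(x)=\big(I_{m_2}-\Phi_1(0)\Phi_1(0)^*\big)f(x)-\int_0^l s(x,t)f(t)\,dt,$$ $$s(x,t)=\int_0^{\min(x,t)}\Phi_1'(x-\zeta)\Phi_1'(t-\zeta)^*\,d\zeta+\begin{cases}\Phi_1'(x-t)\Phi_1(0)^*, & x>t,\\ \Phi_1(0)\Phi_1'(t-x)^*, & t>x,\end{cases}$$ and suppose that $S_l$ is boundedly invertible for all $0<l<\infty$. Then the operators $S_l^{-1}$ admit factorizations $$S_l^{-1}=E_{\Phi,l}^*E_{\Phi,l},\qquad (E_{\Phi,l}f)(x)=f(x)+\int_0^x E_\Phi(x,t)f(t)\,dt,\qquad E_{\Phi,l}\in B\big(L^2_{m_2}(0,l)\big),$$ where $E_\Phi(x,t)$ is continuous with respect to $x,t$ and does not depend on $l$. Furthermore, all the factorizations of this form with continuous $E_\Phi(x,t)$ are unique.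
   Context: $m_1,m_2$ are positive integers; $I_{m_2}$ is the $m_2\times m_2$ identity matrix; matrices and scalars are complex. $L^2_{m_2}(0,l)$ is the Hilbert space of square-integrable $\mathbb{C}^{m_2}$-valued functions on $(0,l)$, and $B(\mathbf H)$ denotes the bounded linear operators on $\mathbf H$. ''Boundedly differentiable'' means differentiable with bounded derivative. ''Boundedly invertible'' means having an inverse in $B\big(L^2_{m_2}(0,l)\big)$. The kernel $E_\Phi(x,t)$ is an $m_2\times m_2$ matrix function considered for $0\le t\le x$ (with $x\le l$ in the factorization of $S_l^{-1}$). The star denotes the adjoint operator (or conjugate transpose of a matrix). *)

(* Defs.v *)
From HB Require Import structures.
From mathcomp Require Import all_boot all_order all_algebra.
From mathcomp Require Import all_classical all_reals all_analysis.
From mathcomp Require Import complex.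
Set Implicit Arguments.
Unset Strict Implicit.
Unset Printing Implicit Defensive.
Import Order.TTheory GRing.Theory Num.Theory.
Import numFieldNormedType.Exports.
Local Open Scope sesquilinear_scope.
Local Open Scope classical_set_scope.
Local Open Scope ring_scope.
Local Open Scope complex_scope.

(* The analysis of complex matrix functions is carried out entrywise, on real
   and imaginary parts.  The conjugate transpose is the library's [A ^t*]. *)

Section MatrixFunctions.
Context {R : realType}.
Local Notation C := R[i].
Local Notation Re := (@complex.Re R).
Local Notation Im := (@complex.Im R).
Local Notation mu := (@lebesgue_measure R).

Definition cintegral (D : set R) (f : R -> C) : C :=
  (\int[mu]_(x in D) Re (f x)) +i* (\int[mu]_(x in D) Im (f x)).

Definition mxintegral m n (D : set R) (F : R -> 'M[C]_(m, n)) : 'M[C]_(m, n) :=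
  \matrix_(i, j) cintegral D (fun x => F x i j).

(* Increments [h] approach 0 with [h <> 0] and [0 <= x + h]: the derivative is
   two-sided for [x > 0] and one-sided at [x = 0]. *)
Definition halfline_incr (x : R) : set_system R :=
  within [set h | 0 <= x + h] 0^'.

Definition halfline_derivable (g : R -> R) (x : R) :=
  cvg ((fun h => h^-1 * (g (x + h) - g x)) @ halfline_incr x).

Definition halfline_derive (g : R -> R) (x : R) : R :=
  lim ((fun h => h^-1 * (g (x + h) - g x)) @ halfline_incr x).

Definition mxderivable m n (F : R -> 'M[C]_(m, n)) (x : R) :=
  forall i j, halfline_derivable (fun y => Re (F y i j)) x /\
              halfline_derivable (fun y => Im (F y i j)) x.

Definition mxderive m n (F : R -> 'M[C]_(m, n)) (x : R) : 'M[C]_(m, n) :=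
  \matrix_(i, j) (halfline_derive (fun y => Re (F y i j)) x +i*
                  halfline_derive (fun y => Im (F y i j)) x).

(* At the endpoint [l] the derivative is the two-sided one; this makes no
   difference for a function on the half-line when all [l] are considered. *)
Definition boundedly_differentiable m n (F : R -> 'M[C]_(m, n)) (l : R) :=
  (forall x : R, 0 <= x <= l -> mxderivable F x) /\
  exists M : R, forall x : R, 0 <= x <= l ->
    forall i j, `|mxderive F x i j| <= M%:C.

Definition mxkernel_continuous m n (D : set (R * R))
    (K : R -> R -> 'M[C]_(m, n)) :=
  forall i j,
    {within D, continuous (fun p : R * R => Re (K p.1 p.2 i j))} /\
    {within D, continuous (fun p : R * R => Im (K p.1 p.2 i j))}.

End MatrixFunctions.

(* Elements of L^2_m(0,l) are represented by functions on R; only their values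
   on ]0,l[ matter, and equality is equality almost everywhere on ]0,l[.
   An operator is represented by a map on representatives; a linear bounded
   such map is compatible with equality almost everywhere. *)
Section L2.
Context {R : realType} {m : nat}.
Local Notation C := R[i].
Local Notation Re := (@complex.Re R).
Local Notation Im := (@complex.Im R).
Local Notation mu := (@lebesgue_measure R).
Local Notation vfun := (R -> 'cV[C]_m).
Implicit Types (l : R) (f g : vfun) (S T : vfun -> vfun).

Definition L2fun l : set vfun := [set f : vfun | forall i,
  [/\ measurable_fun `]0, l[ (fun x => Re (f x i 0)),
      measurable_fun `]0, l[ (fun x => Im (f x i 0)) &
      mu.-integrable `]0, l[
        (fun x => (Re (f x i 0) ^+ 2 + Im (f x i 0) ^+ 2)%:E)]].

Definition L2eq l f g := f = g %[ae mu in `]0, l[%classic].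

Definition L2inner l f g : C :=
  cintegral `]0, l[ (fun x => \sum_i f x i 0 * (g x i 0)^*).

Definition L2norm l f : R := Num.sqrt (Re (L2inner l f f)).

Definition bounded_operator l T :=
  [/\ forall f, L2fun l f -> L2fun l (T f),
      forall (a : C) f g, L2fun l f -> L2fun l g ->
        L2eq l (T (fun x => a *: f x + g x)) (fun x => a *: T f x + T g x) &
      exists M : R, forall f, L2fun l f -> L2norm l (T f) <= M * L2norm l f].

Definition L2op_eq l S T := forall f, L2fun l f -> L2eq l (S f) (T f).

Definition is_inverse l S T :=
  [/\ bounded_operator l T, L2op_eq l (S \o T) id & L2op_eq l (T \o S) id].

Definition boundedly_invertible l S := exists T, is_inverse l S T.

Definition is_adjoint l S T :=
  bounded_operator l T /\
  forall f g, L2fun l f -> L2fun l g ->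
    L2inner l (S f) g = L2inner l f (T g).

End L2.

Section Factorization.
Context {R : realType} {m1 m2 : nat}.
Local Notation C := R[i].
Local Notation vfun := (R -> 'cV[C]_m2).
Implicit Types (l x t : R) (f : vfun) (S : vfun -> vfun).
Implicit Types (Phi : R -> 'M[C]_(m2, m1)) (E : R -> R -> 'M[C]_m2).

(* The value on the diagonal [x = t] of the case distinction is irrelevant. *)
Definition s_kernel Phi x t : 'M[C]_m2 :=
  mxintegral `[0, Num.min x t]
    (fun z => mxderive Phi (x - z) *m (mxderive Phi (t - z)) ^t*) +
  (if t < x then mxderive Phi (x - t) *m (Phi 0) ^t*
   else if x < t then Phi 0 *m (mxderive Phi (t - x)) ^t*
   else 0).

Definition S_op Phi l f : vfun := fun x =>
  (1%:M - Phi 0 *m (Phi 0) ^t*) *m f x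
  - mxintegral `]0, l[ (fun t => s_kernel Phi x t *m f t).

Definition E_op E f : vfun := fun x =>
  f x + mxintegral `]0, x[ (fun t => E x t *m f t).

Definition factorizes_inverse l S E :=
  bounded_operator l (E_op E) /\
  exists Sinv Estar, [/\ is_inverse l S Sinv, is_adjoint l (E_op E) Estar &
    L2op_eq l Sinv (Estar \o E_op E)].

End Factorization.

(* Main.v *)
Require Import Defs.
From HB Require Import structures.
From mathcomp Require Import all_boot all_order all_algebra.
From mathcomp Require Import all_classical all_reals all_analysis.
From mathcomp Require Import complex measurable_realfun.
From mathcomp Require Import ring lra.
Import Order.TTheory GRing.Theory Num.Theory.
Import numFieldNormedType.Exports.
Set Implicit Arguments.
Unset Strict Implicit.
Unset Printing Implicit Defensive.
Local Open Scope sesquilinear_scope.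
Local Open Scope classical_set_scope.
Local Open Scope ring_scope.
Local Open Scope complex_scope.

(* The factor is read off the resolvents of the truncated operators: for each x
   the function E(x, .) is the unique solution on [0, x] of
   E(x, t) = s(x, t) + int_0^x E(x, u) s(u, t) du, which exists because S_x is
   invertible and does not depend on l.  The solution operators are bounded in
   sup norm locally uniformly in x, so E is jointly continuous; the kernel s
   itself is continuous because translation is continuous in L^1.  The equation
   says that E S - 1 has an upper triangular kernel, so E S E^* - 1 is both upper
   triangular and Hermitian, hence zero; since a Volterra operator 1 + K with
   bounded kernel is injective, S E^* E = 1 follows.

   For uniqueness let E be any factor.  If f vanishes beyond a then so does
   E S f, because E^* E S f = f and E^* is upper triangular and injective.  For
   two factors, with difference kernel G, this gives
   int_0^a G(a, u) (S f)(u) du = 0 by letting x decrease to a, and S_a is onto. *)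

(** * Norms and integrals of complex matrix functions *)

(** For fixed x the integral stops at x, so the adjoint of E(x, .) solves an equation for [S_x]
    alone, whatever l is. The obstacle is regularity in x: invertibility is assumed for each l
    separately, in L^2, with no control of the norm of the inverse as l varies. Two properties
    repair this. Since s is bounded, it maps L^1, hence L^2, into bounded functions, which turns the
    L^2 bound on one inverse into a sup bound; and moving the end point from x0 to x changes the
    integral operator by O(|x - x0|) in sup norm, so that bound persists near x0. A second
    difficulty is that the derivative of [Phi1] is merely bounded and measurable, so continuity of s
    has to come from its convolution structure. Finally, operators act on representatives: the
    integral equation, read at every point, selects the continuous one. *)

Section MatrixNorm.
Context {R : realType}.
Local Notation C := R[i].
Local Notation Re := (@complex.Re R).
Local Notation Im := (@complex.Im R).

(** The norm of [R[i]] takes values in [R[i]]; this equivalent one is real, bounds the real and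
    imaginary parts separately and is submultiplicative, which suits integrals taken on the two
    parts. *)
Definition cnorm1 (z : C) : R := `|Re z| + `|Im z|.

Lemma cnorm1_ge0 z : 0 <= cnorm1 z.
Proof. by rewrite addr_ge0. Qed.

Lemma cnorm1D z w : cnorm1 (z + w) <= cnorm1 z + cnorm1 w.
Proof.
case: z w => a b [c d]; rewrite /cnorm1 /=.
by rewrite addrACA lerD// ler_normD.
Qed.

Lemma cnorm1M z w : cnorm1 (z * w) <= cnorm1 z * cnorm1 w.
Proof.
case: z w => a b [c d]; rewrite /cnorm1 /=.
rewrite (le_trans (lerD (ler_normB _ _) (ler_normD _ _)))// !normrM.
by rewrite le_eqVlt; apply/orP; left; apply/eqP; ring.
Qed.

Lemma cnorm1_conj z : cnorm1 z^* = cnorm1 z.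
Proof. by case: z => a b; rewrite /cnorm1 /= normrN. Qed.

Lemma cnorm1_0 : cnorm1 0 = 0.
Proof. by rewrite /cnorm1 /= normr0 addr0. Qed.

Lemma cnorm1_eq0 z : cnorm1 z = 0 -> z = 0.
Proof.
case: z => a b /eqP; rewrite /cnorm1 /= paddr_eq0// !normr_eq0.
by move=> /andP[/eqP-> /eqP->].
Qed.

(** The sum over all entries is submultiplicative, invariant under conjugate transposition and
    available for every shape, rows and columns included; constants depending on the size are
    harmless here. *)
Definition mxnorm m n (A : 'M[C]_(m, n)) : R := \sum_i \sum_j cnorm1 (A i j).

Lemma mxnorm_ge0 m n (A : 'M[C]_(m, n)) : 0 <= mxnorm A.
Proof. by apply: sumr_ge0 => i _; apply: sumr_ge0 => j _; exact: cnorm1_ge0. Qed.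

Lemma mxnorm0 m n : mxnorm (0 : 'M[C]_(m, n)) = 0.
Proof. by apply: big1 => i _; apply: big1 => j _; rewrite mxE cnorm1_0. Qed.

Lemma cnorm1_le_mxnorm m n (A : 'M[C]_(m, n)) i j : cnorm1 (A i j) <= mxnorm A.
Proof.
rewrite /mxnorm (bigD1 i)//= (bigD1 j)//= -addrA lerDl addr_ge0//.
  by apply: sumr_ge0 => ? _; exact: cnorm1_ge0.
by apply: sumr_ge0 => ? _; apply: sumr_ge0 => ? _; exact: cnorm1_ge0.
Qed.

Lemma mxnorm_eq0 m n (A : 'M[C]_(m, n)) : mxnorm A = 0 -> A = 0.
Proof.
move=> A0; apply/matrixP => i j; rewrite mxE; apply: cnorm1_eq0.
by apply/eqP; rewrite eq_le cnorm1_ge0 andbT -A0 cnorm1_le_mxnorm.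
Qed.

Lemma mxnormD m n (A B : 'M[C]_(m, n)) : mxnorm (A + B) <= mxnorm A + mxnorm B.
Proof.
rewrite /mxnorm -big_split; apply: ler_sum => i _ /=.
by rewrite -big_split; apply: ler_sum => j _ /=; rewrite mxE cnorm1D.
Qed.

Lemma mxnormN m n (A : 'M[C]_(m, n)) : mxnorm (- A) = mxnorm A.
Proof.
apply: eq_bigr => i _; apply: eq_bigr => j _; rewrite mxE.
by case: (A i j) => a b; rewrite /cnorm1 /= !normrN.
Qed.

Lemma mxnormB m n (A B : 'M[C]_(m, n)) : mxnorm (A - B) <= mxnorm A + mxnorm B.
Proof. by rewrite (le_trans (mxnormD _ _))// mxnormN. Qed.

Lemma cnorm1_sum (I : Type) (s : seq I) (F : I -> C) :
  cnorm1 (\sum_(i <- s) F i) <= \sum_(i <- s) cnorm1 (F i).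
Proof.
elim/big_rec2: _ => [|i y z _ zy]; first by rewrite cnorm1_0.
by rewrite (le_trans (cnorm1D _ _))// lerD2l.
Qed.

Lemma mxnormM m n p (A : 'M[C]_(m, n)) (B : 'M[C]_(n, p)) :
  mxnorm (A *m B) <= mxnorm A * mxnorm B.
Proof.
rewrite /mxnorm mulr_suml; apply: ler_sum => i _.
rewrite (@le_trans _ _ (\sum_j \sum_k cnorm1 (A i k) * cnorm1 (B k j)))//.
  apply: ler_sum => j _; rewrite mxE (le_trans (cnorm1_sum _ _))//.
  by apply: ler_sum => k _; exact: cnorm1M.
rewrite exchange_big mulr_suml; apply: ler_sum => k _ /=.
rewrite -mulr_sumr; apply: ler_wpM2l; first exact: cnorm1_ge0.
rewrite [leRHS](bigD1 k)//= lerDl.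
by apply: sumr_ge0 => ? _; apply: sumr_ge0 => ? _; exact: cnorm1_ge0.
Qed.

Lemma mxnorm_adj m n (A : 'M[C]_(m, n)) : mxnorm (A ^t*) = mxnorm A.
Proof.
rewrite /mxnorm exchange_big; apply: eq_bigr => i _; apply: eq_bigr => j _ /=.
by rewrite !mxE cnorm1_conj.
Qed.

End MatrixNorm.

(** * Integrals of complex-valued functions *)

Section ComplexIntegral.
Context {R : realType}.
Local Notation C := R[i].
Local Notation Re := (@complex.Re R).
Local Notation Im := (@complex.Im R).
Local Notation mu := (@lebesgue_measure R).
Local Notation TR := (measurableTypeR R).
Implicit Types (D : set TR).

Lemma integrableD_EFin D (f g : TR -> R) : measurable D ->
  mu.-integrable D (EFin \o f) -> mu.-integrable D (EFin \o g) ->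
  mu.-integrable D (EFin \o (fun x => f x + g x)).
Proof. by move=> mD fi gi; exact: (integrableD mD fi gi). Qed.

Lemma integrableZl_EFin D (k : R) (f : TR -> R) : measurable D ->
  mu.-integrable D (EFin \o f) -> mu.-integrable D (EFin \o (fun x => k * f x)).
Proof. by move=> mD fi; exact: (integrableZl mD k fi). Qed.

Lemma le_integrable_EFin D (f h : TR -> R) : measurable D ->
  measurable_fun D f -> mu.-integrable D (EFin \o h) ->
  (forall x, D x -> `|f x| <= h x) -> mu.-integrable D (EFin \o f).
Proof.
move=> mD mf ih fh; apply: (@le_integrable _ _ _ mu _ mD _ (EFin \o h)) => //.
  exact/measurable_EFinP.
by move=> x Dx /=; rewrite lee_fin (le_trans (fh x Dx))// ler_norm.
Qed.

Definition cmeasurable d (T : measurableType d) (D : set T) (f : T -> C) :=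
  measurable_fun D (fun x => Re (f x)) /\ measurable_fun D (fun x => Im (f x)).

Definition cintegrable D (f : TR -> C) :=
  mu.-integrable D (EFin \o (fun x => Re (f x))) /\
  mu.-integrable D (EFin \o (fun x => Im (f x))).

Lemma cmeasurable_cst d (T : measurableType d) (D : set T) (c : C) :
  cmeasurable D (fun=> c).
Proof. by split; exact: measurable_cst. Qed.

Lemma cmeasurableD d (T : measurableType d) (D : set T) (f g : T -> C) :
  cmeasurable D f -> cmeasurable D g -> cmeasurable D (fun x => f x + g x).
Proof.
move=> [f1 f2] [g1 g2]; split.
  apply: eq_measurable_fun (measurable_funD f1 g1) => x _ /=.
  by case: (f x) (g x) => a b [].
apply: eq_measurable_fun (measurable_funD f2 g2) => x _ /=.
by case: (f x) (g x) => a b [].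
Qed.

Lemma cmeasurableM d (T : measurableType d) (D : set T) (f g : T -> C) :
  cmeasurable D f -> cmeasurable D g -> cmeasurable D (fun x => f x * g x).
Proof.
move=> [f1 f2] [g1 g2]; split.
  apply: eq_measurable_fun (measurable_funB (measurable_funM f1 g1)
    (measurable_funM f2 g2)) => x _ /=.
  by case: (f x) (g x) => a b [].
apply: eq_measurable_fun (measurable_funD (measurable_funM f1 g2)
  (measurable_funM f2 g1)) => x _ /=.
by case: (f x) (g x) => a b [].
Qed.

Lemma cmeasurable_conj d (T : measurableType d) (D : set T) (f : T -> C) :
  cmeasurable D f -> cmeasurable D (fun x => (f x)^*).
Proof.
move=> [f1 f2]; split.
  by apply: eq_measurable_fun f1 => x _ /=; case: (f x).
by apply: eq_measurable_fun (measurable_funN f2) => x _ /=; case: (f x).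
Qed.

Lemma cmeasurable_sum d (T : measurableType d) (D : set T) (I : Type)
    (s : seq I) (f : I -> T -> C) : (forall i, cmeasurable D (f i)) ->
  cmeasurable D (fun x => \sum_(i <- s) f i x).
Proof.
move=> mf; elim: s => [|i s ih].
  by under eq_fun do rewrite big_nil; exact: cmeasurable_cst.
by under eq_fun do rewrite big_cons; exact: cmeasurableD.
Qed.

Lemma cmeasurable_comp d d' (T : measurableType d) (T' : measurableType d')
    (D : set T) (D' : set T') (h : T -> T') (f : T' -> C) :
  measurable D' -> h @` D `<=` D' -> cmeasurable D' f -> measurable_fun D h ->
  cmeasurable D (f \o h).
Proof.
by move=> mD' hD [f1 f2] mh; split; [exact: measurable_comp f1 mh|
  exact: measurable_comp f2 mh].
Qed.

Lemma cmeasurable_cnorm1 d (T : measurableType d) (D : set T) (f : T -> C) :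
  cmeasurable D f -> measurable_fun D (fun x => cnorm1 (f x)).
Proof.
by move=> [f1 f2]; apply: measurable_funD; exact: measurableT_comp.
Qed.

Lemma cintegrable_measurable D f : cintegrable D f -> cmeasurable D f.
Proof.
by move=> [/measurable_int/measurable_EFinP f1 /measurable_int/measurable_EFinP f2].
Qed.

Lemma le_cintegrable D (f : TR -> C) (h : TR -> R) : measurable D ->
  cmeasurable D f -> mu.-integrable D (EFin \o h) ->
  (forall x, D x -> cnorm1 (f x) <= h x) -> cintegrable D f.
Proof.
move=> mD [f1 f2] ih fh; split; apply: (le_integrable_EFin mD _ ih) => // x Dx.
  by rewrite (le_trans _ (fh x Dx))// lerDl.
by rewrite (le_trans _ (fh x Dx))// lerDr.
Qed.

Lemma cintegrable_cnorm1 D f : measurable D -> cintegrable D f ->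
  mu.-integrable D (EFin \o (fun x => cnorm1 (f x))).
Proof.
by move=> mD [f1 f2]; apply: integrableD_EFin => //; exact: integrable_norm.
Qed.

Lemma cintegrableD D f g : measurable D -> cintegrable D f -> cintegrable D g ->
  cintegrable D (fun x => f x + g x).
Proof.
move=> mD fi gi; apply: (le_cintegrable mD _ (integrableD_EFin mD
   (cintegrable_cnorm1 mD fi) (cintegrable_cnorm1 mD gi))) => //.
  by apply: cmeasurableD; exact: cintegrable_measurable.
by move=> x _; exact: cnorm1D.
Qed.

Lemma cintegrableZl D (c : C) f : measurable D -> cintegrable D f ->
  cintegrable D (fun x => c * f x).
Proof.
move=> mD fi.
apply: (@le_cintegrable _ _ (fun x => cnorm1 c * cnorm1 (f x))) => //.
- by apply: cmeasurableM; [exact: cmeasurable_cst|exact: cintegrable_measurable].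
- by apply: integrableZl_EFin => //; exact: cintegrable_cnorm1.
- by move=> x _; exact: cnorm1M.
Qed.

Lemma cintegralD D f g : measurable D -> cintegrable D f -> cintegrable D g ->
  cintegral D (fun x => f x + g x) = cintegral D f + cintegral D g.
Proof.
move=> mD [f1 f2] [g1 g2]; rewrite /cintegral.
transitivity ((\int[mu]_(x in D) (Re (f x) + Re (g x))) +i*
              (\int[mu]_(x in D) (Im (f x) + Im (g x)))).
  by congr (_ +i* _); apply: eq_Rintegral => x _; case: (f x) (g x) => a b [].
by rewrite !RintegralD.
Qed.

Lemma cintegralZl D (c : C) f : measurable D -> cintegrable D f ->
  cintegral D (fun x => c * f x) = c * cintegral D f.
Proof.
case: c => a b mD [f1 f2]; rewrite /cintegral.
transitivity ((\int[mu]_(x in D) (a * Re (f x) - b * Im (f x))) +i*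
              (\int[mu]_(x in D) (a * Im (f x) + b * Re (f x)))).
  by congr (_ +i* _); apply: eq_Rintegral => x _; case: (f x).
by rewrite RintegralB ?RintegralD ?RintegralZl//; exact: integrableZl_EFin.
Qed.

Lemma cintegral_sum D (I : Type) (s : seq I) (f : I -> TR -> C) :
  measurable D -> (forall i, cintegrable D (f i)) ->
  cintegrable D (fun x => \sum_(i <- s) f i x) /\
  cintegral D (fun x => \sum_(i <- s) f i x) = \sum_(i <- s) cintegral D (f i).
Proof.
move=> mD fi; elim: s => [|i s [ih1 ih2]].
  under eq_fun do rewrite big_nil; split.
    by split; exact: integrable0.
  by rewrite big_nil /cintegral !Rintegral_cst//= !mul0r.
split.
  under eq_fun do rewrite big_cons; exact: cintegrableD.
rewrite big_cons -ih2 -cintegralD//.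
by congr cintegral; apply/funext => x; rewrite big_cons.
Qed.

Lemma cintegral_conj D f : measurable D -> cintegrable D f ->
  cintegral D (fun x => (f x)^*) = (cintegral D f)^*.
Proof.
move=> mD [f1 f2]; rewrite /cintegral /=; congr (_ +i* _).
  by apply: eq_Rintegral => x _; case: (f x).
rewrite -mulN1r -RintegralZl//.
by apply: eq_Rintegral => x _; case: (f x) => a b /=; rewrite mulN1r.
Qed.

Lemma eq_cintegral D f g : (forall x, D x -> f x = g x) ->
  cintegral D f = cintegral D g.
Proof.
by move=> fg; congr (_ +i* _); apply: eq_Rintegral => x /set_mem Dx; rewrite fg.
Qed.

Lemma cnorm1_cintegral D f : measurable D -> cintegrable D f ->
  cnorm1 (cintegral D f) <= \int[mu]_(x in D) cnorm1 (f x).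
Proof.
move=> mD [f1 f2]; rewrite /cnorm1 RintegralD//; last 2 first.
- exact: integrable_norm.
- exact: integrable_norm.
by rewrite lerD// le_normr_Rintegral.
Qed.

End ComplexIntegral.

Section Adjoint.
Context {R : realType}.
Local Notation C := R[i].

Lemma adjmxM m n p (A : 'M[C]_(m, n)) (B : 'M[C]_(n, p)) :
  (A *m B) ^t* = B ^t* *m A ^t*.
Proof. by rewrite trmx_mul map_mxM. Qed.

Lemma adjmxD m n (A B : 'M[C]_(m, n)) : (A + B) ^t* = A ^t* + B ^t*.
Proof. by rewrite linearD /= map_mxD. Qed.

Lemma adjmxN m n (A : 'M[C]_(m, n)) : (- A) ^t* = - A ^t*.
Proof. by rewrite linearN /= map_mxN. Qed.

Lemma adjmxB m n (A B : 'M[C]_(m, n)) : (A - B) ^t* = A ^t* - B ^t*.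
Proof. by rewrite adjmxD adjmxN. Qed.

Lemma mxB_entry m n (A B : 'M[C]_(m, n)) i j : (A - B) i j = A i j - B i j.
Proof. by rewrite !mxE. Qed.

Lemma adjmx0 m n : (0 : 'M[C]_(m, n)) ^t* = 0.
Proof. by rewrite trmx0 map_mx0. Qed.

End Adjoint.

(** * Entrywise measurability and integration of matrix functions *)

Section MatrixIntegral.
Context {R : realType}.
Local Notation C := R[i].
Local Notation mu := (@lebesgue_measure R).
Local Notation TR := (measurableTypeR R).
Implicit Types (D : set TR).

Lemma Rintegral_sum D (I : Type) (s : seq I) (f : I -> TR -> R) :
  measurable D -> (forall i, mu.-integrable D (EFin \o f i)) ->
  mu.-integrable D (EFin \o (fun x => \sum_(i <- s) f i x)) /\
  \int[mu]_(x in D) (\sum_(i <- s) f i x) = \sum_(i <- s) \int[mu]_(x in D) f i x.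
Proof.
move=> mD fi; elim: s => [|i s [ih1 ih2]].
  rewrite (_ : (fun _ => _) = fun=> 0); last by apply/funext => x; rewrite big_nil.
  by rewrite big_nil Rintegral_cst//= mul0r; split => //; exact: integrable0.
rewrite (_ : (fun _ => _) = fun x => f i x + \sum_(i <- s) f i x); last first.
  by apply/funext => x; rewrite big_cons.
by rewrite big_cons -ih2 RintegralD//; split => //; exact: integrableD_EFin.
Qed.

Definition mxmeasurable d (T : measurableType d) (D : set T) m n
    (F : T -> 'M[C]_(m, n)) := forall i j, cmeasurable D (fun x => F x i j).

Definition mxintegrable D m n (F : R -> 'M[C]_(m, n)) :=
  forall i j, cintegrable D (fun x => F x i j).

Section Measurable.
Context d (T : measurableType d) (D : set T).

Lemma mxmeasurable_cst m n (A : 'M[C]_(m, n)) : mxmeasurable D (fun=> A).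
Proof. by move=> i j; exact: cmeasurable_cst. Qed.

Lemma eq_mxmeasurable m n (F G : T -> 'M[C]_(m, n)) :
  (forall x, D x -> F x = G x) -> mxmeasurable D F -> mxmeasurable D G.
Proof.
move=> FG mF i j; have [m1 m2] := mF i j.
by split; [apply: eq_measurable_fun m1|apply: eq_measurable_fun m2] => x /set_mem Dx;
  rewrite FG.
Qed.

Lemma mxmeasurableD m n (F G : T -> 'M[C]_(m, n)) :
  mxmeasurable D F -> mxmeasurable D G -> mxmeasurable D (fun x => F x + G x).
Proof. by move=> mF mG i j; under eq_fun do rewrite mxE; exact: cmeasurableD. Qed.

Lemma mxmeasurableM m n p (F : T -> 'M[C]_(m, n)) (G : T -> 'M[C]_(n, p)) :
  mxmeasurable D F -> mxmeasurable D G -> mxmeasurable D (fun x => F x *m G x).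
Proof.
move=> mF mG i j; under eq_fun do rewrite mxE.
by apply: cmeasurable_sum => k; exact: cmeasurableM.
Qed.

Lemma mxmeasurableN m n (F : T -> 'M[C]_(m, n)) :
  mxmeasurable D F -> mxmeasurable D (fun x => - F x).
Proof.
move=> mF i j; under eq_fun do rewrite mxE -mulN1r.
by apply: cmeasurableM => //; exact: cmeasurable_cst.
Qed.

Lemma mxmeasurable_adj m n (F : T -> 'M[C]_(m, n)) :
  mxmeasurable D F -> mxmeasurable D (fun x => (F x) ^t*).
Proof. by move=> mF i j; under eq_fun do rewrite !mxE; exact: cmeasurable_conj. Qed.

Lemma mxmeasurable_mxnorm m n (F : T -> 'M[C]_(m, n)) :
  mxmeasurable D F -> measurable_fun D (fun x => mxnorm (F x)).
Proof.
move=> mF; apply: measurable_sum => i; apply: measurable_sum => j.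
exact: cmeasurable_cnorm1.
Qed.

Lemma mxmeasurable_if m n (b : T -> bool) (F G : T -> 'M[C]_(m, n)) :
  measurable D -> measurable_fun D b -> mxmeasurable D F -> mxmeasurable D G ->
  mxmeasurable D (fun x => if b x then F x else G x).
Proof.
move=> mD mb mF mG i j; have [F1 F2] := mF i j; have [G1 G2] := mG i j.
split.
  apply: (@eq_measurable_fun _ _ _ _ _
    (fun x => if b x then complex.Re (F x i j) else complex.Re (G x i j))).
    by move=> x _; case: ifP.
  apply: measurable_fun_if => //.
    by apply: measurable_funS F1 => //; exact: subIsetl.
  by apply: measurable_funS G1 => //; exact: subIsetl.
apply: (@eq_measurable_fun _ _ _ _ _
  (fun x => if b x then complex.Im (F x i j) else complex.Im (G x i j))).
  by move=> x _; case: ifP.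
apply: measurable_fun_if => //.
  by apply: measurable_funS F2 => //; exact: subIsetl.
by apply: measurable_funS G2 => //; exact: subIsetl.
Qed.

End Measurable.

Lemma mxmeasurable_comp d d' (T : measurableType d) (T' : measurableType d')
    (D : set T) (D' : set T') (h : T -> T') m n (F : T' -> 'M[C]_(m, n)) :
  measurable D' -> h @` D `<=` D' -> mxmeasurable D' F -> measurable_fun D h ->
  mxmeasurable D (F \o h).
Proof. by move=> mD' hD mF mh i j; apply: (cmeasurable_comp mD' hD (mF i j)). Qed.

Lemma mxmeasurableS d (T : measurableType d) (D E : set T) m n
    (F : T -> 'M[C]_(m, n)) : measurable D -> E `<=` D ->
  mxmeasurable D F -> mxmeasurable E F.
Proof.
move=> mD ED mF i j; have [? ?] := mF i j.
by split; apply: (measurable_funS mD ED).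
Qed.

Lemma mxintegrable_measurable D m n (F : TR -> 'M[C]_(m, n)) :
  mxintegrable D F -> mxmeasurable D F.
Proof. by move=> iF i j; exact: cintegrable_measurable. Qed.

Lemma le_mxintegrable D m n (F : TR -> 'M[C]_(m, n)) (h : TR -> R) :
  measurable D -> mxmeasurable D F -> mu.-integrable D (EFin \o h) ->
  (forall x, D x -> mxnorm (F x) <= h x) -> mxintegrable D F.
Proof.
move=> mD mF ih Fh i j; apply: (le_cintegrable mD (mF i j) ih) => x Dx.
by rewrite (le_trans (cnorm1_le_mxnorm _ _ _))// Fh.
Qed.

Lemma mxintegrable_mxnorm D m n (F : TR -> 'M[C]_(m, n)) :
  measurable D -> mxintegrable D F ->
  mu.-integrable D (EFin \o (fun x => mxnorm (F x))).
Proof.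
move=> mD iF; rewrite /mxnorm.
by do 2 (apply: (Rintegral_sum _ _ _).1 => // ?); exact: cintegrable_cnorm1.
Qed.

Lemma mxintegrableD D m n (F G : TR -> 'M[C]_(m, n)) : measurable D ->
  mxintegrable D F -> mxintegrable D G -> mxintegrable D (fun x => F x + G x).
Proof.
by move=> mD iF iG i j; under eq_fun do rewrite mxE; exact: cintegrableD.
Qed.

Lemma mxintegrableMl D m n p (A : 'M[C]_(m, n)) (F : TR -> 'M[C]_(n, p)) :
  measurable D -> mxintegrable D F -> mxintegrable D (fun x => A *m F x).
Proof.
move=> mD iF i j; under eq_fun do rewrite mxE.
by apply: (cintegral_sum _ _ _).1 => // k; exact: cintegrableZl.
Qed.

Lemma mxintegrableS D E m n (F : TR -> 'M[C]_(m, n)) : measurable D ->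
  measurable E -> E `<=` D -> mxintegrable D F -> mxintegrable E F.
Proof.
move=> mD mE ED iF i j; have [? ?] := iF i j.
by split; apply: (integrableS mD mE ED).
Qed.

Lemma eq_mxintegral D m n (F G : TR -> 'M[C]_(m, n)) :
  (forall x, D x -> F x = G x) -> mxintegral D F = mxintegral D G.
Proof.
by move=> FG; apply/matrixP => i j; rewrite !mxE; apply: eq_cintegral => x /FG ->.
Qed.

Lemma mxintegralD D m n (F G : TR -> 'M[C]_(m, n)) : measurable D ->
  mxintegrable D F -> mxintegrable D G ->
  mxintegral D (fun x => F x + G x) = mxintegral D F + mxintegral D G.
Proof.
move=> mD iF iG; apply/matrixP => i j; rewrite !mxE -cintegralD//.
by congr cintegral; apply/funext => x; rewrite mxE.
Qed.

Lemma mxintegralMl D m n p (A : 'M[C]_(m, n)) (F : TR -> 'M[C]_(n, p)) :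
  measurable D -> mxintegrable D F ->
  mxintegral D (fun x => A *m F x) = A *m mxintegral D F.
Proof.
move=> mD iF; apply/matrixP => i j; rewrite !mxE.
rewrite (eq_cintegral (g := fun x => \sum_k A i k * F x k j)); last first.
  by move=> x _; rewrite mxE.
rewrite (cintegral_sum _ _ _).2//; last by move=> k; exact: cintegrableZl.
by apply: eq_bigr => k _; rewrite mxE cintegralZl.
Qed.

Lemma mxintegralN D m n (F : TR -> 'M[C]_(m, n)) : measurable D ->
  mxintegrable D F -> mxintegral D (fun x => - F x) = - mxintegral D F.
Proof.
move=> mD iF; rewrite (eq_mxintegral (G := fun x => (- 1%:M) *m F x)).
  by rewrite mxintegralMl// mulNmx mul1mx.
by move=> x _; rewrite mulNmx mul1mx.
Qed.

Lemma mxintegrableN D m n (F : TR -> 'M[C]_(m, n)) : measurable D ->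
  mxintegrable D F -> mxintegrable D (fun x => - F x).
Proof.
move=> mD iF; rewrite (_ : (fun _ => _) = fun x => (- 1%:M) *m F x).
  exact: mxintegrableMl.
by apply/funext => x; rewrite mulNmx mul1mx.
Qed.

Lemma mxintegralB D m n (F G : TR -> 'M[C]_(m, n)) : measurable D ->
  mxintegrable D F -> mxintegrable D G ->
  mxintegral D (fun x => F x - G x) = mxintegral D F - mxintegral D G.
Proof.
move=> mD iF iG; rewrite mxintegralD//; last exact: mxintegrableN.
by rewrite mxintegralN.
Qed.

Lemma mxintegral_adj D m n (F : TR -> 'M[C]_(m, n)) : measurable D ->
  mxintegrable D F -> mxintegral D (fun x => (F x) ^t*) = (mxintegral D F) ^t*.
Proof.
move=> mD iF; apply/matrixP => i j; rewrite !mxE.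
transitivity (cintegral D (fun x => (F x j i)^*)).
  by apply: eq_cintegral => x _; rewrite !mxE.
by rewrite cintegral_conj.
Qed.

Lemma mxintegrable_adj D m n (F : TR -> 'M[C]_(m, n)) : measurable D ->
  mxintegrable D F -> mxintegrable D (fun x => (F x) ^t*).
Proof.
move=> mD iF; apply: le_mxintegrable (mxintegrable_mxnorm mD iF) _ => //.
  by apply: mxmeasurable_adj; exact: mxintegrable_measurable.
by move=> x _; rewrite mxnorm_adj.
Qed.

(** Right multiplication is left multiplication seen through the conjugate transpose. *)
Lemma mxintegralMr D m n p (F : TR -> 'M[C]_(m, n)) (A : 'M[C]_(n, p)) :
  measurable D -> mxintegrable D F ->
  mxintegral D (fun x => F x *m A) = mxintegral D F *m A.
Proof.
move=> mD iF; rewrite -[RHS]trmxCK adjmxM -mxintegral_adj//.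
rewrite -mxintegralMl; [|by []|exact: mxintegrable_adj].
rewrite -mxintegral_adj//; last by apply: mxintegrableMl => //; exact: mxintegrable_adj.
by apply: eq_mxintegral => x _; rewrite adjmxM !trmxCK.
Qed.

Lemma mxintegral0 D m n : measurable D ->
  mxintegral D (fun=> 0 : 'M[C]_(m, n)) = 0.
Proof.
move=> mD; apply/matrixP => i j; rewrite !mxE /cintegral.
have int0 : \int[mu]_(x in D) (0 : R) = 0 by rewrite Rintegral_cst// mul0r.
by congr (_ +i* _); rewrite -[RHS]int0; apply: eq_Rintegral => x _; rewrite ?mxE.
Qed.

(** Integrals over subintervals become integrals over one fixed domain of an integrand cut off by a
    boolean test. This is what lets Volterra integrals be treated as [Op] with a triangular
    kernel. *)
Lemma mxintegral_mkcond D E m n (F : TR -> 'M[C]_(m, n)) (b : TR -> bool) :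
  E `<=` D -> (forall x, D x -> b x <-> E x) ->
  mxintegral E F = mxintegral D (fun x => if b x then F x else 0).
Proof.
move=> ED bE; apply/matrixP => i j; rewrite !mxE /cintegral.
have key (g : 'M[C]_(m, n) -> R) : g 0 = 0 ->
    \int[mu]_(x in E) g (F x) = \int[mu]_(x in D) g (if b x then F x else 0).
  move=> g0; rewrite Rintegral_mkcond [RHS]Rintegral_mkcond.
  apply: eq_Rintegral => x _; rewrite !patchE.
  case: ifPn => [/set_mem Ex|nEx].
    have Dx := ED _ Ex; have bx : b x by apply/bE.
    by rewrite mem_set// bx.
  case: ifPn => // /set_mem Dx; case: ifPn => // bx.
  by move: nEx; rewrite mem_set//; apply/bE.
congr (_ +i* _).
  by apply: (key (fun A => complex.Re (A i j))); rewrite mxE.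
by apply: (key (fun A => complex.Im (A i j))); rewrite mxE.
Qed.

Lemma mxnorm_mxintegral D m n (F : TR -> 'M[C]_(m, n)) : measurable D ->
  mxintegrable D F -> mxnorm (mxintegral D F) <= \int[mu]_(x in D) mxnorm (F x).
Proof.
move=> mD iF.
have ic i j := cintegrable_cnorm1 mD (iF i j).
rewrite /mxnorm (Rintegral_sum _ _ _).2//; last by move=> i; apply: (Rintegral_sum _ _ _).1.
apply: ler_sum => i _; rewrite (Rintegral_sum _ _ _).2//.
by apply: ler_sum => j _; rewrite mxE cnorm1_cintegral.
Qed.

Lemma le_mxnorm_mxintegral D m n (F : TR -> 'M[C]_(m, n)) (h : TR -> R) :
  measurable D -> mxmeasurable D F -> mu.-integrable D (EFin \o h) ->
  (forall x, D x -> mxnorm (F x) <= h x) ->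
  mxnorm (mxintegral D F) <= \int[mu]_(x in D) h x.
Proof.
move=> mD mF ih Fh; have iF := le_mxintegrable mD mF ih Fh.
rewrite (le_trans (mxnorm_mxintegral mD iF))// le_Rintegral//.
exact: mxintegrable_mxnorm.
Qed.

Lemma ae_eq_mxintegral D m n (F G : TR -> 'M[C]_(m, n)) :
  measurable D -> mxmeasurable D F -> mxmeasurable D G ->
  F = G %[ae mu in D] -> mxintegral D F = mxintegral D G.
Proof.
move=> mD mF mG FG; apply/matrixP => i j; rewrite !mxE /cintegral.
have [F1 F2] := mF i j; have [G1 G2] := mG i j.
congr (_ +i* _); congr fine; apply: ae_eq_integral => //; try exact/measurable_EFinP.
  by apply: filterS FG => x FG Dx; rewrite FG.
by apply: filterS FG => x FG Dx; rewrite FG.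
Qed.

End MatrixIntegral.

(** * Fubini's theorem for matrix functions *)

Section Fubini.
Context {R : realType}.
Local Notation C := R[i].
Local Notation mu := (@lebesgue_measure R).
Local Notation TR := (measurableTypeR R).
Implicit Types (D : set TR).

(** Domination by a product [h x * k y] of integrable functions is what bounded kernels acting on
    integrable functions provide. The measure spaces are arbitrary because the parameter may be a
    point of the plane, as for composed kernels. *)
Lemma Rintegral_fubini d1 d2 (T1 : measurableType d1) (T2 : measurableType d2)
    (m1 : {sigma_finite_measure set T1 -> \bar R})
    (m2 : {sigma_finite_measure set T2 -> \bar R})
    (Da : set T1) (Db : set T2) (F : T1 * T2 -> R) (h : T1 -> R) (k : T2 -> R) :
  measurable Da -> measurable Db -> measurable_fun (Da `*` Db) F ->
  m1.-integrable Da (EFin \o h) -> m2.-integrable Db (EFin \o k) ->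
  (forall x y, Da x -> Db y -> `|F (x, y)| <= h x * k y) ->
  measurable_fun Da (fun x => \int[m2]_(y in Db) F (x, y)) /\
  \int[m1]_(x in Da) \int[m2]_(y in Db) F (x, y) =
  \int[m2]_(y in Db) \int[m1]_(x in Da) F (x, y).
Proof.
move=> mDa mDb mF ih ik Fhk.
have mDab : measurable (Da `*` Db) by exact: measurableX.
(* Extension by zero moves the integrals over [Da] and [Db] to the whole spaces, where Tonelli gives
   integrability and Fubini applies. *)
pose f := EFin \o (F \_ (Da `*` Db)).
have mf : measurable_fun setT f.
  by apply/measurable_EFinP; apply/(measurable_restrictT _ _).1.
have patchF x y : (F \_ (Da `*` Db)) (x, y) =
    ((fun x => ((fun y => F (x, y)) \_ Db) y) \_ Da) x.
  rewrite !patchE; case: ifPn => [/set_mem[/= Dx Dy]|nD].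
    by rewrite !mem_set.
  case: ifPn => // /set_mem Dx; case: ifPn => // /set_mem Dy.
  by move: nD; rewrite mem_set.
have iF : ((m1 \x m2)%E).-integrable setT f.
  apply/(integrable12ltyP _ _ mf).
  have ih' : m1.-integrable setT (EFin \o (fun x => `|(h \_ Da) x|)).
    apply: integrable_norm; rewrite -restrict_EFin.
    by apply/(integrable_restrict _ _ _ _).1; rewrite ?setTI.
  have ik' : m2.-integrable setT (EFin \o (fun x => `|(k \_ Db) x|)).
    apply: integrable_norm; rewrite -restrict_EFin.
    by apply/(integrable_restrict _ _ _ _).1; rewrite ?setTI.
  have c_fin := integrable_fin_num measurableT ik'.
  set c := (\int[m2]_x _)%E in c_fin.
  apply: (@le_lt_trans _ _ (\int[m1]_x (`|(h \_ Da) x|%:E * c))%E).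
    apply: ge0_le_integral => //.
    - by move=> x _; apply: integral_ge0.
    - apply: (measurable_fun_fubini_tonelli_F (abse \o f)) => //=.
      exact: measurableT_comp.
    - rewrite -(fineK c_fin); apply: emeasurable_funM => //.
      by move/measurable_int : ih'.
    - move=> x _; rewrite -ge0_integralZl//.
      + apply: ge0_le_integral => //.
        * apply: measurableT_comp => //.
          exact: (measurableT_comp mf (pair1_measurable x)).
        * apply: emeasurable_funM => //; by move/measurable_int : ik'.
        * move=> y _ /=; rewrite lee_fin patchF patchE.
          case: ifPn => [/set_mem Dx|_]; last by rewrite normr0 mulr_ge0.
          rewrite [in leLHS]patchE; case: ifPn => [/set_mem Dy|_]; last by rewrite normr0 mulr_ge0.
          by rewrite -normrM !patchE !mem_set// (le_trans (Fhk x y Dx Dy))// ler_norm.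
      + by move/measurable_int : ik'.
      + by move=> y _; rewrite lee_fin.
  rewrite -(fineK c_fin).
  apply: integrable_lty => //.
  apply: eq_integrable (integrableZr measurableT (fine c) ih') => //.
have inner x : Da x -> (\int[m2]_y f (x, y))%E = (\int[m2]_(y in Db) F (x, y))%:E.
  move=> Dx; rewrite fineK.
    rewrite integral_mkcond; apply: eq_integral => y _.
    by rewrite /f /= patchF !patchE mem_set//; case: ifP.
  have iFx : m2.-integrable Db (EFin \o (fun y => F (x, y))).
    apply: (@le_integrable _ _ _ m2 _ mDb _ (EFin \o (fun y => h x * k y))) => /=.
    - apply/measurable_EFinP; apply: (measurable_comp (F := Da `*` Db)) mF _ => //.
        by move=> _ [y Dy <-].
      by apply: measurable_funTS; exact: pair1_measurable.
    - by move=> y Dy; rewrite lee_fin (le_trans (Fhk x y Dx Dy))// ler_norm.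
    - exact: (integrableZl mDb (h x) ik).
  exact: (integrable_fin_num mDb iFx).
have inner' y : Db y -> (\int[m1]_x f (x, y))%E = (\int[m1]_(x in Da) F (x, y))%:E.
  move=> Dy; rewrite fineK.
    rewrite integral_mkcond; apply: eq_integral => x _.
    by rewrite /f /= patchF !patchE (mem_set Dy); case: ifP.
  have iFy : m1.-integrable Da (EFin \o (fun x => F (x, y))).
    apply: (@le_integrable _ _ _ m1 _ mDa _ (EFin \o (fun x => k y * h x))) => /=.
    - apply/measurable_EFinP; apply: (measurable_comp (F := Da `*` Db)) mF _ => //.
        by move=> _ [x Dx <-].
      by apply: measurable_funTS; exact: pair2_measurable.
    - by move=> x Dx; rewrite lee_fin mulrC (le_trans (Fhk x y Dx Dy))// ler_norm.
    - exact: (integrableZl mDa (k y) ih).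
  exact: (integrable_fin_num mDa iFy).
split.
  apply/measurable_EFinP.
  apply: (eq_measurable_fun (fubini_F m2 f)).
    by move=> x /set_mem Dx; rewrite /fubini_F inner.
  by apply: measurable_funTS; exact: (measurable_fubini_F iF).
congr fine; rewrite integral_mkcond [RHS]integral_mkcond.
transitivity (\int[m1]_x \int[m2]_y f (x, y))%E.
  apply: eq_integral => x _; rewrite patchE; case: ifPn => [/set_mem Dx|nx].
    by rewrite inner.
  apply/esym/integral0_eq => y _.
  by rewrite /f /= patchF patchE (negbTE nx).
rewrite (Fubini iF); apply: eq_integral => y _.
rewrite patchE; case: ifPn => [/set_mem Dy|ny]; first by rewrite inner'.
apply: integral0_eq => x _.
by rewrite /f /= patchF !patchE (negbTE ny); case: ifP.
Qed.

Lemma cintegral_congr (Da Db : set TR) (f g : TR -> C) :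
  \int[mu]_(x in Da) complex.Re (f x) = \int[mu]_(x in Db) complex.Re (g x) ->
  \int[mu]_(x in Da) complex.Im (f x) = \int[mu]_(x in Db) complex.Im (g x) ->
  cintegral Da f = cintegral Db g.
Proof. by rewrite /cintegral => -> ->. Qed.

Lemma mxintegral_fubini (Da Db : set TR) m n (F : TR -> TR -> 'M[C]_(m, n))
    (h k : TR -> R) :
  measurable Da -> measurable Db ->
  mxmeasurable (Da `*` Db) (fun p => F p.1 p.2) ->
  mu.-integrable Da (EFin \o h) -> mu.-integrable Db (EFin \o k) ->
  (forall x y, Da x -> Db y -> mxnorm (F x y) <= h x * k y) ->
  mxintegral Da (fun x => mxintegral Db (F x)) =
  mxintegral Db (fun y => mxintegral Da (F^~ y)).
Proof.
move=> mDa mDb mF ih ik Fhk; apply/matrixP => i j.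
have [F1 F2] := mF i j.
rewrite [LHS]mxE [RHS]mxE; apply: cintegral_congr.
  transitivity (\int[mu]_(x in Da) \int[mu]_(y in Db) complex.Re (F x y i j)).
    by apply: eq_Rintegral => x _; rewrite mxE.
  rewrite (Rintegral_fubini mDa mDb F1 ih ik _).2 => [|x y Dx Dy].
    by apply: eq_Rintegral => x _; rewrite mxE.
  rewrite (le_trans _ (Fhk x y Dx Dy))// (le_trans _ (cnorm1_le_mxnorm _ i j))//.
  by rewrite lerDl.
transitivity (\int[mu]_(x in Da) \int[mu]_(y in Db) complex.Im (F x y i j)).
  by apply: eq_Rintegral => x _; rewrite mxE.
rewrite (Rintegral_fubini mDa mDb F2 ih ik _).2 => [|x y Dx Dy].
  by apply: eq_Rintegral => x _; rewrite mxE.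
rewrite (le_trans _ (Fhk x y Dx Dy))// (le_trans _ (cnorm1_le_mxnorm _ i j))//.
by rewrite lerDr.
Qed.

Lemma mxmeasurable_mxintegral d1 (T1 : measurableType d1)
    (m1 : {sigma_finite_measure set T1 -> \bar R}) (Da : set T1) (Db : set TR)
    m n (F : T1 -> TR -> 'M[C]_(m, n)) (h : T1 -> R) (k : TR -> R) :
  measurable Da -> measurable Db ->
  mxmeasurable (Da `*` Db) (fun p => F p.1 p.2) ->
  m1.-integrable Da (EFin \o h) -> mu.-integrable Db (EFin \o k) ->
  (forall x y, Da x -> Db y -> mxnorm (F x y) <= h x * k y) ->
  mxmeasurable Da (fun x => mxintegral Db (F x)).
Proof.
move=> mDa mDb mF ih ik Fhk i j; under eq_fun do rewrite mxE.
have [F1 F2] := mF i j; split.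
  apply: (Rintegral_fubini mDa mDb F1 ih ik _).1 => x y Dx Dy.
  rewrite (le_trans _ (Fhk x y Dx Dy))// (le_trans _ (cnorm1_le_mxnorm _ i j))//.
  by rewrite lerDl.
apply: (Rintegral_fubini mDa mDb F2 ih ik _).1 => x y Dx Dy.
rewrite (le_trans _ (Fhk x y Dx Dy))// (le_trans _ (cnorm1_le_mxnorm _ i j))//.
by rewrite lerDr.
Qed.

End Fubini.

(** * Integral operators with bounded measurable kernels *)

Section Kernels.
Context {R : realType}.
Local Notation C := R[i].
Local Notation mu := (@lebesgue_measure R).
Local Notation TR := (measurableTypeR R).

Lemma integrable_cst_fin d (T : measurableType d) (nu : {measure set T -> \bar R})
    (D : set T) (c : R) : measurable D -> (nu D < +oo)%E ->
  nu.-integrable D (EFin \o (fun=> c)).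
Proof.
move=> mD fD; apply/integrableP; split; first exact/measurable_EFinP.
by rewrite (integral_cst _ mD `|c|%:E) lte_mul_pinfty.
Qed.

(** [TR * TR] carries the product sigma-algebra, so an open set has to be exhibited as a countable
    union of measurable rectangles, here squares with rational centres. *)
Lemma continuous_measurable_fun2 (f : R * R -> R) :
  continuous f -> measurable_fun [set: TR * TR] f.
Proof.
move=> cf; apply: (measurability _ (RGenOInfty.measurableE R)) => //.
move=> /= _ [_ [a ->] <-]; rewrite setTI.
pose box (q : rat * rat * nat) : set (TR * TR) :=
  `](ratr q.1.1 - q.2.+1%:R^-1 : R), (ratr q.1.1 + q.2.+1%:R^-1)[%classic `*`
  `](ratr q.1.2 - q.2.+1%:R^-1 : R), (ratr q.1.2 + q.2.+1%:R^-1)[%classic.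
pose U : set (TR * TR) := f @^-1` `]a, +oo[.
rewrite (_ : _ @^-1` _ = \bigcup_q (if `[< box q `<=` U >] then box q else set0)).
  apply: (countable_bigcupT_measurable (countableP _)) => q; case: ifPn => // _.
  by apply: measurableX; exact: measurable_itv.
apply/seteqP; split => [[x y] Uxy|p [q _]]; last by case: ifPn => // /asboolP qU /qU.
have /nbhs_ballP[e /= e0 eU] : nbhs (x, y) U.
  apply: (cf (x, y)); apply: open_nbhs_nbhs; split; last exact: Uxy.
  exact: rray_open.
(* The square has half-width 1/(N+1) and its centre is that close to the point, so 2/(N+1) < e keeps
   it inside the ball. *)
have [N Ne] : exists N : nat, N.+1%:R^-1 < e / 2.
  have e20 : 0 < e / 2 by rewrite divr_gt0.
  have [N _ HN] := near_infty_natSinv_lt (PosNum e20).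
  by exists N; exact: (HN N (leqnn N)).
have near_rat (z : R) : exists q : rat, `|z - ratr q| < N.+1%:R^-1.
  have zN : z - N.+1%:R^-1 < z by rewrite ltrBlDr ltrDl invr_gt0.
  have [q] := rat_in_itvoo zN.
  rewrite in_itv/= => /andP[q1 q2]; exists q.
  by rewrite gtr0_norm ?subr_gt0// ltrBlDr -ltrBlDl.
have [q1 q1x] := near_rat x; have [q2 q2y] := near_rat y.
exists ((q1, q2), N) => //; rewrite ifT.
  by split; rewrite /= ?in_itv/= -ltr_distl.
apply/asboolP => -[u v] /= [uq vq].
have {}uq : (ratr q1 - N.+1%:R^-1 : R) < u < ratr q1 + N.+1%:R^-1.
  exact: uq.
have {}vq : (ratr q2 - N.+1%:R^-1 : R) < v < ratr q2 + N.+1%:R^-1.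
  exact: vq.
rewrite -ltr_distl in uq; rewrite -ltr_distl in vq.
apply: eU; split => /=; rewrite /ball/=.
  rewrite (le_lt_trans (ler_distD (ratr q1) _ _))// (splitr e).
  by rewrite ltrD// ?(lt_trans q1x)// distrC (lt_trans uq).
rewrite (le_lt_trans (ler_distD (ratr q2) _ _))// (splitr e).
by rewrite ltrD// ?(lt_trans q2y)// distrC (lt_trans vq).
Qed.

Variable D : set TR.
Hypothesis mD : measurable D.
Hypothesis fD : (mu D < +oo)%E.

Lemma integrable_cst c : mu.-integrable D (EFin \o (fun=> c : R)).
Proof. exact: integrable_cst_fin. Qed.

(** Bounded measurable kernels on a set of finite measure are stable under sums, adjoints and
    composition, and map integrable functions to bounded ones; triangular kernels that jump at the
    diagonal are included. *)
Definition bker m n (K : TR -> TR -> 'M[C]_(m, n)) :=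
  mxmeasurable (D `*` D) (fun p => K p.1 p.2) /\
  exists2 c, 0 <= c & forall x t, D x -> D t -> mxnorm (K x t) <= c.

(** The function may have any number of columns: composing kernels is then [Op] applied to the
    sections of the second kernel, and [Op_comp] also yields associativity of [kmul]. *)
Definition Op m n p (K : TR -> TR -> 'M[C]_(m, n)) (f : TR -> 'M[C]_(n, p)) :=
  fun x => mxintegral D (fun t => K x t *m f t).

Definition kmul m n p (K : TR -> TR -> 'M[C]_(m, n)) (L : TR -> TR -> 'M[C]_(n, p)) :=
  fun x t => Op K (L^~ t) x.

Definition kadj m n (K : TR -> TR -> 'M[C]_(m, n)) := fun x t => (K t x) ^t*.

Lemma bkerD m n (K L : TR -> TR -> 'M[C]_(m, n)) : bker K -> bker L ->
  bker (fun x t => K x t + L x t).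
Proof.
move=> [mK [c c0 Kc]] [mL [b b0 Lb]]; split; first exact: mxmeasurableD.
exists (c + b); rewrite ?addr_ge0// => x t Dx Dt.
by rewrite (le_trans (mxnormD _ _))// lerD ?Kc ?Lb.
Qed.

Lemma bkerN m n (K : TR -> TR -> 'M[C]_(m, n)) : bker K -> bker (fun x t => - K x t).
Proof.
move=> [mK [c c0 Kc]]; split; first exact: mxmeasurableN.
by exists c => // x t Dx Dt; rewrite mxnormN Kc.
Qed.

Lemma bker_adj m n (K : TR -> TR -> 'M[C]_(m, n)) : bker K -> bker (kadj K).
Proof.
move=> [mK [c c0 Kc]]; split; last first.
  by exists c => // x t Dx Dt; rewrite /kadj mxnorm_adj Kc.
apply: mxmeasurable_adj.
apply: (mxmeasurable_comp (h := fun p : TR * TR => (p.2, p.1)) _ _ mK) => //.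
- exact: measurableX.
- by move=> _ [[x y] [/= ? ?] <-].
- apply: measurable_funTS; apply/measurable_fun_pairP.
  by split; [exact: measurable_snd|exact: measurable_fst].
Qed.

Lemma bker_section m n (K : TR -> TR -> 'M[C]_(m, n)) x : bker K -> D x ->
  mxmeasurable D (K x).
Proof.
move=> [mK _] Dx.
apply: (mxmeasurable_comp (h := pair x) _ _ mK) => //.
- exact: measurableX.
- by move=> _ [y Dy <-].
- by apply: measurable_funTS; exact: pair1_measurable.
Qed.

Lemma bker_sectionr m n (K : TR -> TR -> 'M[C]_(m, n)) t : bker K -> D t ->
  mxintegrable D (K^~ t).
Proof.
move=> [mK [c c0 Kc]] Dt.
apply: (le_mxintegrable mD _ (integrable_cst c)) => [|x Dx]; last exact: Kc.
apply: (mxmeasurable_comp (h := pair^~ t) _ _ mK) => //.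
- exact: measurableX.
- by move=> _ [y Dy <-].
- by apply: measurable_funTS; exact: pair2_measurable.
Qed.

Lemma Op_integrand m n p (K : TR -> TR -> 'M[C]_(m, n)) (f : TR -> 'M[C]_(n, p)) x :
  bker K -> mxintegrable D f -> D x -> mxintegrable D (fun t => K x t *m f t).
Proof.
move=> bK iF Dx; have [_ [c c0 Kc]] := bK.
apply: (le_mxintegrable mD _ (integrableZl_EFin c mD (mxintegrable_mxnorm mD iF))).
  apply: mxmeasurableM; first exact: bker_section.
  exact: mxintegrable_measurable.
move=> t Dt; rewrite (le_trans (mxnormM _ _))// ler_wpM2r ?mxnorm_ge0//.
exact: Kc.
Qed.

Lemma Op_bound m n p (K : TR -> TR -> 'M[C]_(m, n)) (f : TR -> 'M[C]_(n, p)) c x :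
  bker K -> (forall x t, D x -> D t -> mxnorm (K x t) <= c) ->
  mxintegrable D f -> D x ->
  mxnorm (Op K f x) <= c * \int[mu]_(t in D) mxnorm (f t).
Proof.
move=> bK Kc iF Dx.
have ic := mxintegrable_mxnorm mD iF.
rewrite -RintegralZl//; apply: le_mxnorm_mxintegral => //.
- exact/mxintegrable_measurable/Op_integrand.
- exact: integrableZl_EFin.
- move=> t Dt; rewrite (le_trans (mxnormM _ _))// ler_wpM2r ?mxnorm_ge0//.
  exact: Kc.
Qed.

Lemma mxmeasurable_Op m n p (K : TR -> TR -> 'M[C]_(m, n)) (f : TR -> 'M[C]_(n, p)) :
  bker K -> mxintegrable D f -> mxmeasurable D (Op K f).
Proof.
move=> [mK [c c0 Kc]] iF.
apply: (mxmeasurable_mxintegral (m1 := mu) (F := fun x t => K x t *m f t) mD mD _ (integrable_cst c)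
  (mxintegrable_mxnorm mD iF)) => [|x t Dx Dt].
  apply: mxmeasurableM => //.
  apply: (mxmeasurable_comp (h := snd) _ _ (mxintegrable_measurable iF)) => //.
    by move=> _ [[? ?] [/= ? ?] <-].
  by apply: measurable_funTS; exact: measurable_snd.
by rewrite (le_trans (mxnormM _ _))// ler_wpM2r ?mxnorm_ge0// Kc.
Qed.

Lemma mxintegrable_Op m n p (K : TR -> TR -> 'M[C]_(m, n)) (f : TR -> 'M[C]_(n, p)) :
  bker K -> mxintegrable D f -> mxintegrable D (Op K f).
Proof.
move=> bK iF; have [_ [c c0 Kc]] := bK.
apply: (le_mxintegrable mD _ (integrable_cst (c * \int[mu]_(t in D) mxnorm (f t)))).
  exact: mxmeasurable_Op.
by move=> x Dx; exact: Op_bound.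
Qed.

Lemma OpDr m n p (K : TR -> TR -> 'M[C]_(m, n)) (f g : TR -> 'M[C]_(n, p)) x :
  bker K -> mxintegrable D f -> mxintegrable D g -> D x ->
  Op K (fun t => f t + g t) x = Op K f x + Op K g x.
Proof.
move=> bK iF iG Dx; rewrite -mxintegralD//; try exact: Op_integrand.
by apply: eq_mxintegral => t _; rewrite mulmxDr.
Qed.

Lemma OpNr m n p (K : TR -> TR -> 'M[C]_(m, n)) (f : TR -> 'M[C]_(n, p)) x :
  bker K -> mxintegrable D f -> D x ->
  Op K (fun t => - f t) x = - Op K f x.
Proof.
move=> bK iF Dx; rewrite -mxintegralN//; try exact: Op_integrand.
by apply: eq_mxintegral => t _; rewrite mulmxN.
Qed.

Lemma OpDl m n p (K L : TR -> TR -> 'M[C]_(m, n)) (f : TR -> 'M[C]_(n, p)) x :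
  bker K -> bker L -> mxintegrable D f -> D x ->
  Op (fun x t => K x t + L x t) f x = Op K f x + Op L f x.
Proof.
move=> bK bL iF Dx; rewrite -mxintegralD//; try exact: Op_integrand.
by apply: eq_mxintegral => t _; rewrite mulmxDl.
Qed.

Lemma OpNl m n p (K : TR -> TR -> 'M[C]_(m, n)) (f : TR -> 'M[C]_(n, p)) x :
  bker K -> mxintegrable D f -> D x ->
  Op (fun x t => - K x t) f x = - Op K f x.
Proof.
move=> bK iF Dx; rewrite -mxintegralN//; try exact: Op_integrand.
by apply: eq_mxintegral => t _; rewrite mulNmx.
Qed.

Lemma bker_comp m n p (K : TR -> TR -> 'M[C]_(m, n)) (L : TR -> TR -> 'M[C]_(n, p)) :
  bker K -> bker L -> bker (kmul K L).
Proof.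
move=> bK bL; have [mK [c c0 Kc]] := bK; have [mL [b b0 Lb]] := bL.
split; last first.
  exists (c * \int[mu]_(t in D) b); first by rewrite mulr_ge0// Rintegral_ge0.
  move=> x t Dx Dt; rewrite (le_trans (Op_bound bK Kc _ Dx))//.
    exact: bker_sectionr.
  rewrite ler_wpM2l// le_Rintegral//.
  - by apply: mxintegrable_mxnorm => //; exact: bker_sectionr.
  - exact: integrable_cst.
  - by move=> u Du; exact: Lb.
(* For measurability the measure on the parameter space is immaterial, and a
   Dirac mass has the required sigma-finite instance. *)
have key := @mxmeasurable_mxintegral R _ _
  (@dirac _ (TR * TR)%type (0%R, 0%R) R) (D `*` D) D _ _
  (fun p u => K p.1 u *m L u p.2) (fun=> c) (fun=> b).
apply: key => //.
- exact: measurableX.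
- apply: mxmeasurableM.
    apply: (mxmeasurable_comp (h := fun q : (TR * TR) * TR => (q.1.1, q.2)) _ _ mK).
    + exact: measurableX.
    + by move=> _ [[[x t] u] [[/= ? ?] ?] <-].
    + apply: measurable_funTS; apply/measurable_fun_pairP; split.
        exact: (measurableT_comp measurable_fst measurable_fst).
      exact: measurable_snd.
  apply: (mxmeasurable_comp (h := fun q : (TR * TR) * TR => (q.2, q.1.2)) _ _ mL).
  + exact: measurableX.
  + by move=> _ [[[x t] u] [[/= ? ?] ?] <-].
  + apply: measurable_funTS; apply/measurable_fun_pairP; split.
      exact: measurable_snd.
    exact: (measurableT_comp measurable_snd measurable_fst).
- by apply: integrable_cst_fin; [exact: measurableX|exact: ltry].
- exact: integrable_cst.
- move=> [x t] u [/= Dx Dt] Du; rewrite (le_trans (mxnormM _ _))//.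
  by rewrite ler_pM ?mxnorm_ge0// ?Kc ?Lb.
Qed.

Lemma Op_comp m n p q (K : TR -> TR -> 'M[C]_(m, n)) (L : TR -> TR -> 'M[C]_(n, p))
    (f : TR -> 'M[C]_(p, q)) x :
  bker K -> bker L -> mxintegrable D f -> D x ->
  Op K (Op L f) x = Op (kmul K L) f x.
Proof.
move=> bK bL iF Dx; have [mK [c c0 Kc]] := bK; have [mL [b b0 Lb]] := bL.
have iF' := mxintegrable_mxnorm mD iF.
transitivity (mxintegral D (fun u => mxintegral D (fun t => K x u *m (L u t *m f t)))).
  by apply: eq_mxintegral => u Du; rewrite mxintegralMl//; exact: Op_integrand.
rewrite (mxintegral_fubini mD mD _ (integrable_cst c) (integrableZl_EFin b mD iF')).
- apply: eq_mxintegral => t Dt; rewrite /kmul /Op -mxintegralMr//.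
    by apply: eq_mxintegral => u Du; rewrite mulmxA.
  by apply: Op_integrand => //; exact: bker_sectionr.
- apply: mxmeasurableM.
    apply: (mxmeasurable_comp (h := fst) _ _ (bker_section bK Dx)) => //.
      by move=> _ [[? ?] [/= ? ?] <-].
    by apply: measurable_funTS; exact: measurable_fst.
  apply: mxmeasurableM => //.
  apply: (mxmeasurable_comp (h := snd) _ _ (mxintegrable_measurable iF)) => //.
    by move=> _ [[? ?] [/= ? ?] <-].
  by apply: measurable_funTS; exact: measurable_snd.
- move=> u t Du Dt; rewrite (le_trans (mxnormM _ _))// ler_pM ?mxnorm_ge0 ?Kc//.
  by rewrite (le_trans (mxnormM _ _))// ler_wpM2r ?mxnorm_ge0// Lb.
Qed.

Lemma Op_adjoint m n p q (K : TR -> TR -> 'M[C]_(m, n)) (f : TR -> 'M[C]_(n, p))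
    (g : TR -> 'M[C]_(m, q)) :
  bker K -> mxintegrable D f -> mxintegrable D g ->
  mxintegral D (fun x => (g x) ^t* *m Op K f x) =
  mxintegral D (fun t => (Op (kadj K) g t) ^t* *m f t).
Proof.
move=> bK iF iG; have [mK [c c0 Kc]] := bK.
have iF' := mxintegrable_mxnorm mD iF; have iG' := mxintegrable_mxnorm mD iG.
transitivity (mxintegral D (fun x => mxintegral D (fun t => (g x) ^t* *m (K x t *m f t)))).
  by apply: eq_mxintegral => u Du; rewrite mxintegralMl//; exact: Op_integrand.
rewrite (mxintegral_fubini mD mD _ iG' (integrableZl_EFin c mD iF')).
- apply: eq_mxintegral => t Dt; rewrite /Op.
  have iKg : mxintegrable D (fun x => kadj K t x *m g x).
    by apply: Op_integrand => //; exact: bker_adj.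
  rewrite -mxintegral_adj// -mxintegralMr//; last exact: mxintegrable_adj.
  by apply: eq_mxintegral => u Du; rewrite adjmxM /kadj trmxCK mulmxA.
- apply: mxmeasurableM.
    apply: mxmeasurable_adj.
    apply: (mxmeasurable_comp (h := fst) _ _ (mxintegrable_measurable iG)) => //.
      by move=> _ [[? ?] [/= ? ?] <-].
    by apply: measurable_funTS; exact: measurable_fst.
  apply: mxmeasurableM => //.
  apply: (mxmeasurable_comp (h := snd) _ _ (mxintegrable_measurable iF)) => //.
    by move=> _ [[? ?] [/= ? ?] <-].
  by apply: measurable_funTS; exact: measurable_snd.
- move=> u t Du Dt; rewrite (le_trans (mxnormM _ _))//.
  rewrite mxnorm_adj ler_wpM2l ?mxnorm_ge0//.
  by rewrite (le_trans (mxnormM _ _))// ler_wpM2r ?mxnorm_ge0// Kc.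
Qed.

(** The adjoint kernels are prescribed only pointwise on D, so that the Hermitian [s] can serve as
    its own adjoint and composed kernels can be fed in again. *)
Lemma adj_kmul m n p (K : TR -> TR -> 'M[C]_(m, n)) (L : TR -> TR -> 'M[C]_(n, p))
    K' L' x t : bker K -> bker L ->
  (forall x t, D x -> D t -> (K t x) ^t* = K' x t) ->
  (forall x t, D x -> D t -> (L t x) ^t* = L' x t) ->
  D x -> D t -> (kmul K L t x) ^t* = kmul L' K' x t.
Proof.
move=> bK bL KK' LL' Dx Dt; rewrite /kmul /Op -mxintegral_adj//.
  by apply: eq_mxintegral => u Du; rewrite adjmxM KK'// LL'.
by apply: Op_integrand => //; exact: bker_sectionr.
Qed.

End Kernels.

(** * Algebraic factorization of kernels *)

Section TriangularFactorization.
Context {R : realType}.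
Local Notation C := R[i].
Local Notation mu := (@lebesgue_measure R).
Local Notation TR := (measurableTypeR R).
Variables (D : set TR) (n : nat) (s e es : TR -> TR -> 'M[C]_n).
Hypothesis mD : measurable D.
Hypothesis fD : (mu D < +oo)%E.
Hypothesis bs : bker D s.
Hypothesis be : bker D e.
Hypothesis bes : bker D es.
Hypothesis s_herm : forall x t, D x -> D t -> (s t x) ^t* = s x t.
Hypothesis e_adj : forall x t, D x -> D t -> (e t x) ^t* = es x t.
Hypothesis e_lower : forall x t : R, x <= t -> e x t = 0.
Hypothesis e_eq : forall x t : R, D x -> D t -> t < x ->
  e x t = s x t + kmul D e s x t.

(* W is the kernel of E S E^* - 1.  It is upper triangular by the equation for e
   and Hermitian, hence it vanishes off the diagonal. *)
Let U x t := (e x t + - s x t) + - kmul D e s x t.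
Let W x t := (es x t + U x t) + kmul D U es x t.

Let bU : bker D U.
Proof.
apply: bkerD; last by apply: bkerN; exact: bker_comp.
by apply: bkerD => //; exact: bkerN.
Qed.

Let bW : bker D W.
Proof. by apply: bkerD; [exact: bkerD|exact: bker_comp]. Qed.

(** The adjoint exchanges [es] with [e] and [e s] with [s es], and fixes [s], [e es] and [e s es].
    Stated for seven abstract matrices, the Hermitian symmetry of [W] becomes a rearrangement of one
    sum. *)
Let adj_combination (M1 M2 M3 M4 M5 M6 M7 N1 N2 N3 N4 N5 N6 N7 : 'M[C]_n) :
  M1 ^t* = N1 -> M2 ^t* = N2 -> M3 ^t* = N3 -> M4 ^t* = N4 -> M5 ^t* = N5 ->
  M6 ^t* = N6 -> M7 ^t* = N7 ->
  (M1 + (M2 - M3 - M4) + (M5 - M6 - M7)) ^t* =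
  N2 + (N1 - N3 - N6) + (N5 - N4 - N7).
Proof.
move=> <- <- <- <- <- <- <-.
by rewrite !(adjmxD, adjmxN) !addrA [RHS](ACl (2*1*3*6*5*4*7)).
Qed.

Let es_adj x t : D x -> D t -> (es t x) ^t* = e x t.
Proof. by move=> Dx Dt; rewrite -(e_adj Dt Dx) trmxCK. Qed.

Let U_upper x t : D x -> D t -> t < x -> U x t = 0.
Proof. by move=> Dx Dt tx; rewrite /U (e_eq Dx Dt tx) -addrA -opprD subrr. Qed.

Let W_upper x t : D x -> D t -> t < x -> W x t = 0.
Proof.
move=> Dx Dt tx; rewrite /W U_upper// -(e_adj Dx Dt) e_lower ?(ltW tx)// adjmx0 !add0r.
rewrite /kmul /Op (eq_mxintegral (G := fun=> 0)) ?mxintegral0// => u Du.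
have [ux|xu] := ltP u x; first by rewrite U_upper// mul0mx.
by rewrite -(e_adj Du Dt) e_lower ?adjmx0 ?mulmx0// (le_trans (ltW tx)).
Qed.

Let U_comp x t : D x -> D t -> kmul D U es x t =
  (kmul D e es x t - kmul D s es x t) - kmul D (kmul D e s) es x t.
Proof.
move=> Dx Dt; have iet := bker_sectionr mD fD bes Dt.
have bes' : bker D (kmul D e s) by exact: bker_comp.
rewrite /kmul OpDl//; [|by apply: bkerD => //; exact: bkerN|exact: bkerN].
by rewrite OpNl// OpDl//; [rewrite OpNl|exact: bkerN].
Qed.

Let W_eq x t : D x -> D t -> W x t =
  (es x t + ((e x t - s x t) - kmul D e s x t)) +
  ((kmul D e es x t - kmul D s es x t) - kmul D (kmul D e s) es x t).
Proof. by move=> Dx Dt; rewrite /W (U_comp Dx Dt). Qed.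

Let W_herm x t : D x -> D t -> (W t x) ^t* = W x t.
Proof.
move=> Dx Dt; rewrite (W_eq Dx Dt) (W_eq Dt Dx).
have bes' : bker D (kmul D e s) by exact: bker_comp.
have h_em x' t' : D x' -> D t' -> (kmul D e s t' x') ^t* = kmul D s es x' t'.
  exact: adj_kmul.
have h_ee : (kmul D e es t x) ^t* = kmul D e es x t by exact: adj_kmul.
have h_se : (kmul D s es t x) ^t* = kmul D e s x t by exact: adj_kmul.
have h_ese : (kmul D (kmul D e s) es t x) ^t* = kmul D (kmul D e s) es x t.
  rewrite (adj_kmul mD fD bes' bes h_em es_adj Dx Dt).
  exact: (Op_comp mD fD be bs (bker_sectionr mD fD bes Dt) Dx).
exact: (adj_combination (es_adj Dx Dt) (e_adj Dx Dt) (s_herm Dx Dt)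
  (h_em _ _ Dx Dt) h_ee h_se h_ese).
Qed.

Let W_offdiag x t : D x -> D t -> x != t -> W x t = 0.
Proof.
move=> Dx Dt; rewrite neq_lt => /orP[xt|tx]; last exact: W_upper.
by rewrite -W_herm// W_upper// adjmx0.
Qed.

(** The conclusion is [E S E^* f = f], with [g = E^* f] and [h = S g], at every point of D: the left
    side expands to f plus the operator with kernel [W] applied to f. *)
Lemma triangular_factorization p (f : TR -> 'M[C]_(n, p)) x :
  mxintegrable D f -> D x ->
  let g t := f t + Op D es f t in let h t := g t - Op D s g t in
  h x + Op D e h x = f x.
Proof.
move=> iF Dx g h.
have iesf : mxintegrable D (Op D es f) by exact: mxintegrable_Op.
have ig : mxintegrable D g by exact: mxintegrableD.
have isg : mxintegrable D (Op D s g) by exact: mxintegrable_Op.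
have bes' : bker D (kmul D e s) by exact: bker_comp.
have bUes : bker D (kmul D U es) by exact: bker_comp.
have eh : Op D e h x = Op D e g x - Op D (kmul D e s) g x.
  rewrite (OpDr mD be ig (mxintegrableN mD isg) Dx) (OpNr mD be isg Dx).
  by rewrite (Op_comp mD fD be bs ig Dx).
have Ug : Op D U g x = Op D e g x - Op D s g x - Op D (kmul D e s) g x.
  rewrite (OpDl mD (bkerD be (bkerN bs)) (bkerN bes') ig Dx).
  rewrite (OpDl mD be (bkerN bs) ig Dx) (OpNl mD bs ig Dx).
  by rewrite (OpNl mD bes' ig Dx).
have Wf : Op D W f x = Op D es f x + Op D U g x.
  rewrite (OpDl mD (bkerD bes bU) bUes iF Dx) (OpDl mD bes bU iF Dx).
  by rewrite (OpDr mD bU iF iesf Dx) (Op_comp mD fD bU bes iF Dx) addrA.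
transitivity (f x + Op D W f x).
  by rewrite eh Wf Ug /h /g !addrA [LHS](ACl (1*2*4*3*5)).
rewrite /Op (ae_eq_mxintegral (G := fun=> 0) mD).
- by rewrite mxintegral0// addr0.
- exact/mxintegrable_measurable/Op_integrand.
- exact: mxmeasurable_cst.
(* Only the diagonal escapes [W_offdiag]; for fixed [x] it is the single point [t = x], a null
   set. *)
- exists [set x]; split => //; first exact: lebesgue_measure_set1.
  move=> t /= tD; apply: contrapT => /eqP tx; apply: tD => Dt.
  by rewrite W_offdiag ?mul0mx// eq_sym.
Qed.

End TriangularFactorization.

(** * Gronwall's lemma for integrable functions *)

Section Gronwall.
Context {R : realType}.
Local Notation C := R[i].
Local Notation mu := (@lebesgue_measure R).
Local Notation TR := (measurableTypeR R).

Lemma itvooP (a b : R) (x : TR) : (`]a, b[%classic : set TR) x <-> a < x < b.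
Proof. by rewrite -[(_ < _ < _)]/(x \in `]a, b[ : bool). Qed.

Lemma itvccP (a b : R) (x : TR) : (`[a, b]%classic : set TR) x <-> a <= x <= b.
Proof. by rewrite -[(_ <= _ <= _)]/(x \in `[a, b] : bool). Qed.

(** On the increment from [B k] to [B k.+1] the function is almost everywhere at most c times its
    integral I over [B k.+1], so the increment contributes at most I/2. If [B k] contributes
    nothing, then I <= I/2 and I = 0. An arbitrary chain covers growth in either direction, and no
    continuity of [phi] is involved. *)
Lemma gronwall_chain (D : set TR) (B : nat -> set TR) (N : nat) (phi : TR -> R) (c : R) :
  (forall k, measurable (B k)) -> (forall k, (k <= N)%N -> B k `<=` D) ->
  measurable D -> mu.-integrable D (EFin \o phi) -> (forall x, D x -> 0 <= phi x) ->
  B 0%N = set0 -> (forall k, B k `<=` B k.+1) -> 0 <= c ->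
  (forall k, (mu (B k.+1 `\` B k) < +oo)%E /\
     c * fine (mu (B k.+1 `\` B k)) <= 2^-1) ->
  (forall k, (k <= N)%N -> {ae mu, forall x, B k x -> phi x <= c * \int[mu]_(t in B k) phi t}) ->
  \int[mu]_(x in B N) phi x = 0.
Proof.
move=> mB BD mD iphi phi0 B0 BS c0 Bfin Bphi.
suff H k : (k <= N)%N -> \int[mu]_(x in B k) phi x = 0 by exact: H.
elim: k => [_|k ih kN]; first by rewrite B0 Rintegral_set0.
have iB : mu.-integrable (B k.+1) (EFin \o phi) by apply: integrableS iphi => //; exact: BD.
have mdiff : measurable (B k.+1 `\` B k) by exact: measurableD.
have sdiff : B k.+1 `\` B k `<=` B k.+1 by exact: subDsetl.
have idiff : mu.-integrable (B k.+1 `\` B k) (EFin \o phi).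
  by apply: integrableS iB.
have [muf muc] := Bfin k.
set I := \int[mu]_(x in B k.+1) phi x.
have I0 : 0 <= I by apply: Rintegral_ge0 => x Bx; apply: phi0; exact: (BD _ kN).
have split : I = \int[mu]_(x in B k) phi x + \int[mu]_(x in B k.+1 `\` B k) phi x.
  rewrite -Rintegral_setU//.
  - by rewrite setDUK.
  - by rewrite setDUK.
  - by apply/disj_set2P; rewrite setDIK.
have le1 : \int[mu]_(x in B k.+1 `\` B k) phi x <= 2^-1 * I.
  rewrite (@le_trans _ _ (\int[mu]_(x in B k.+1 `\` B k) (c * I)))//.
    rewrite /Rintegral fine_le//.
    - exact: integrable_fin_num idiff.
    - apply: (integrable_fin_num mdiff (integrable_cst mdiff muf _)).
    - apply: ae_ge0_le_integral => //.
      + by move=> x [Bx _]; rewrite lee_fin; apply: phi0; exact: (BD _ kN).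
      + by move/measurable_int : idiff.
      + by move=> x _; rewrite lee_fin mulr_ge0.
      + by have := Bphi _ kN; apply: filterS => x Hx [Bx _]; rewrite lee_fin; exact: Hx.
  rewrite Rintegral_cst// mulrAC ler_wpM2r//.
move: le1; rewrite split (ih (ltnW kN)) add0r.
set J := Rintegral _ _ _ => le1.
have J0 : 0 <= J by apply: Rintegral_ge0 => x [Bx _]; apply: phi0; exact: (BD _ kN).
apply/eqP; rewrite eq_le J0 andbT; lra.
Qed.

Lemma archi_step (c d : R) : 0 <= c -> 0 < d ->
  exists2 N : nat, (0 < N)%N & c * (d / N%:R) <= 2^-1.
Proof.
move=> c0 d0; exists (Num.truncn (2 * c * d)).+1 => //.
have := truncnS_gt (2 * c * d); set N := (Num.truncn _).+1 => HN.
have N0 : 0 < N%:R :> R by rewrite ltr0n.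
rewrite mulrA ler_pdivrMr//; lra.
Qed.

Lemma le_Rintegral_subset (A B : set TR) (phi : TR -> R) :
  measurable A -> measurable B -> A `<=` B -> mu.-integrable B (EFin \o phi) ->
  (forall x, B x -> 0 <= phi x) ->
  \int[mu]_(x in A) phi x <= \int[mu]_(x in B) phi x.
Proof.
move=> mA mB AB iB phi0; rewrite /Rintegral fine_le//.
- by apply: integrable_fin_num => //; exact: integrableS iB.
- exact: integrable_fin_num.
- apply: ge0_subset_integral => //.
  by move/measurable_int : iB.
Qed.

Lemma gronwall_forward (a b c : R) (phi : TR -> R) :
  0 <= c -> a < b -> mu.-integrable `]a, b[ (EFin \o phi) ->
  (forall x : TR, `]a, b[%classic x -> 0 <= phi x) ->
  {ae mu, forall x : TR, `]a, b[%classic x -> phi x <= c * \int[mu]_(t in `]a, x[) phi t} ->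
  \int[mu]_(x in `]a, b[) phi x = 0.
Proof.
move=> c0 ab iphi phi0 Hphi.
have d0 : 0 < b - a by rewrite subr_gt0.
have [N N0 HN] := archi_step c0 d0.
set d := (b - a) / N%:R in HN.
have dge0 : 0 <= d by rewrite divr_ge0// ltW.
pose B k : set TR := `]a, a + d * k%:R[%classic.
have bE : b = a + d * N%:R by rewrite /d divfK ?subrKC// pnatr_eq0 -lt0n.
have mB k : measurable (B k) by exact: measurable_itv.
have BS k : B k `<=` B k.+1.
  move=> x /itvooP/andP[ax xk]; apply/itvooP; rewrite ax (lt_le_trans xk)//.
  by rewrite lerD2l ler_wpM2l// ler_nat.
have BD k : (k <= N)%N -> B k `<=` `]a, b[%classic.
  move=> kN x /itvooP/andP[ax xk]; apply/itvooP; rewrite ax (lt_le_trans xk)//.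
  by rewrite bE lerD2l ler_wpM2l// ler_nat.
have diff k : B k.+1 `\` B k `<=` `[a + d * k%:R, a + d * k.+1%:R].
  move=> x [/itvooP/andP[ax xk] nx]; apply/itvccP; rewrite (ltW xk) andbT leNgt.
  by apply/negP => xk'; apply: nx; apply/itvooP; rewrite ax.
have mdiff k : (mu (B k.+1 `\` B k) <= d%:E)%E.
  apply: (@le_trans _ _ (mu `[a + d * k%:R, a + d * k.+1%:R])).
    apply: (le_measure mu _ _ (@diff k)); rewrite inE; first exact: measurableD.
    exact: measurable_itv.
  rewrite lebesgue_measure_itv/=; case: ifPn => _; last by rewrite lee_fin.
  rewrite -EFinD lee_fin opprD addrACA subrr add0r -mulrBr -natrB//.
  by rewrite subSnn mulr1.
rewrite (_ : `]a, b[%classic = B N); last by rewrite /B -bE.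
apply: (@gronwall_chain `]a, b[%classic B N phi c) => //.
- by rewrite /B mulr0 addr0 set_itvoo0.
- move=> k; split; first by rewrite (le_lt_trans (mdiff k))// ltry.
  rewrite (le_trans _ HN)// ler_wpM2l// -lee_fin fineK//.
  by rewrite ge0_fin_numE// (le_lt_trans (mdiff k))// ltry.
- move=> k kN; have := Hphi; apply: filterS => x Hx Bx.
  have Dx := BD _ kN _ Bx.
  have iBk : mu.-integrable (B k) (EFin \o phi).
    by apply: integrableS iphi => //; exact: BD.
  have sub : `]a, x[ `<=` B k.
    move=> y /itvooP/andP[ay yx]; apply/itvooP; rewrite ay (lt_trans yx)//.
    by move/itvooP : Bx => /andP[].
  rewrite (le_trans (Hx Dx))// ler_wpM2l//.
  apply: le_Rintegral_subset => //.
  by move=> y By; apply: phi0; exact: (BD _ kN).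
Qed.

Lemma gronwall_backward (a b c : R) (phi : TR -> R) :
  0 <= c -> a < b -> mu.-integrable `]a, b[ (EFin \o phi) ->
  (forall x : TR, `]a, b[%classic x -> 0 <= phi x) ->
  {ae mu, forall x : TR, `]a, b[%classic x -> phi x <= c * \int[mu]_(t in `]x, b[) phi t} ->
  \int[mu]_(x in `]a, b[) phi x = 0.
Proof.
move=> c0 ab iphi phi0 Hphi.
have d0 : 0 < b - a by rewrite subr_gt0.
have [N N0 HN] := archi_step c0 d0.
set d := (b - a) / N%:R in HN.
have dge0 : 0 <= d by rewrite divr_ge0// ltW.
pose B k : set TR := `]b - d * k%:R, b[%classic.
have dN : d * N%:R = b - a by rewrite /d divfK// pnatr_eq0 -lt0n.
have aE : a = b - d * N%:R by rewrite dN subKr.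
have mB k : measurable (B k) by exact: measurable_itv.
have BS k : B k `<=` B k.+1.
  move=> x /itvooP/andP[xk xb]; apply/itvooP; rewrite xb andbT (le_lt_trans _ xk)//.
  by rewrite lerD2l lerN2 ler_wpM2l// ler_nat.
have BD k : (k <= N)%N -> B k `<=` `]a, b[%classic.
  move=> kN x /itvooP/andP[xk xb]; apply/itvooP; rewrite xb andbT (le_lt_trans _ xk)//.
  by rewrite aE lerD2l lerN2 ler_wpM2l// ler_nat.
have diff k : B k.+1 `\` B k `<=` `[b - d * k.+1%:R, b - d * k%:R].
  move=> x [/itvooP/andP[xk xb] nx]; apply/itvccP; rewrite (ltW xk)/= leNgt.
  by apply/negP => xk'; apply: nx; apply/itvooP; rewrite xk'.
have mdiff k : (mu (B k.+1 `\` B k) <= d%:E)%E.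
  apply: (@le_trans _ _ (mu `[b - d * k.+1%:R, b - d * k%:R])).
    apply: (le_measure mu _ _ (@diff k)); rewrite inE; first exact: measurableD.
    exact: measurable_itv.
  rewrite lebesgue_measure_itv/=; case: ifPn => _; last by rewrite lee_fin.
  by rewrite -EFinD lee_fin -natr1; lra.
rewrite (_ : `]a, b[%classic = B N); last by rewrite /B -aE.
apply: (@gronwall_chain `]a, b[%classic B N phi c) => //.
- by rewrite /B mulr0 subr0 set_itvoo0.
- move=> k; split; first by rewrite (le_lt_trans (mdiff k))// ltry.
  rewrite (le_trans _ HN)// ler_wpM2l// -lee_fin fineK//.
  by rewrite ge0_fin_numE// (le_lt_trans (mdiff k))// ltry.
- move=> k kN; have := Hphi; apply: filterS => x Hx Bx.
  have Dx := BD _ kN _ Bx.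
  have iBk : mu.-integrable (B k) (EFin \o phi).
    by apply: integrableS iphi => //; exact: BD.
  have sub : `]x, b[ `<=` B k.
    move=> y /itvooP/andP[xy yb]; apply/itvooP; rewrite yb andbT (lt_trans _ xy)//.
    by move/itvooP : Bx => /andP[].
  rewrite (le_trans (Hx Dx))// ler_wpM2l//.
  apply: le_Rintegral_subset => //.
  by move=> y By; apply: phi0; exact: (BD _ kN).
Qed.

Lemma Rintegral_mxnorm_eq0 (D : set TR) m n (f : TR -> 'M[C]_(m, n)) :
  measurable D -> mxintegrable D f -> \int[mu]_(x in D) mxnorm (f x) = 0 ->
  {ae mu, forall x : TR, D x -> f x = 0}.
Proof.
move=> mD iF I0.
have im := mxintegrable_mxnorm mD iF.
have/(ae_eq_integral_abs mu mD) : (\int[mu]_(x in D) `|(mxnorm (f x))%:E| = 0)%E.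
  rewrite -[RHS]/((0 : R)%:E) -I0 /Rintegral fineK; last exact: (integrable_fin_num mD im).
  by apply: eq_integral => x _; rewrite gee0_abs// lee_fin mxnorm_ge0.
move=> H; have {}H := H (measurable_int _ im).
by apply: filterS H => x H Dx; apply: mxnorm_eq0; have [] := H Dx.
Qed.

End Gronwall.

(** * Square-integrable vector functions *)

Section SquareIntegrable.
Context {R : realType} {m : nat}.
Local Notation C := R[i].
Local Notation Re := (@complex.Re R).
Local Notation Im := (@complex.Im R).
Local Notation mu := (@lebesgue_measure R).
Local Notation TR := (measurableTypeR R).
Implicit Types (l : R) (f g : R -> 'cV[C]_m).

Definition sqn (v : 'cV[C]_m) : R := \sum_i (Re (v i 0) ^+ 2 + Im (v i 0) ^+ 2).

Lemma sqn_ge0 v : 0 <= sqn v.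
Proof. by apply: sumr_ge0 => i _; rewrite addr_ge0// sqr_ge0. Qed.

Lemma sqnD u v : sqn (u + v) <= 2 * sqn u + 2 * sqn v.
Proof.
rewrite /sqn !mulr_sumr -big_split /=; apply: ler_sum => i _; rewrite mxE.
case: (u i 0) (v i 0) => a b [c d] /=.
by have := sqr_ge0 (a - c); have := sqr_ge0 (b - d); rewrite !expr2; lra.
Qed.

Lemma sqnZ (a : C) v : sqn (a *: v) = (Re a ^+ 2 + Im a ^+ 2) * sqn v.
Proof.
rewrite /sqn mulr_sumr; apply: eq_bigr => i _; rewrite mxE.
by case: a (v i 0) => a b [c d] /=; ring.
Qed.

Lemma sqn_le_mxnorm v : sqn v <= mxnorm v ^+ 2.
Proof.
rewrite /sqn (@le_trans _ _ (\sum_i cnorm1 (v i 0) * mxnorm v))//; last first.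
  rewrite -mulr_suml expr2 ler_wpM2r ?mxnorm_ge0// /mxnorm.
  by apply: ler_sum => i _; rewrite big_ord1.
apply: ler_sum => i _.
apply: (@le_trans _ _ (cnorm1 (v i 0) ^+ 2)); last first.
  by rewrite expr2 ler_wpM2l ?cnorm1_ge0// cnorm1_le_mxnorm.
rewrite /cnorm1 sqrrD !real_normK ?num_real// addrAC lerDl.
by rewrite mulrn_wge0// mulr_ge0.
Qed.

(** The norm is a sum of 2m absolute values, each at most the square root of [sqn v]; this is the
    origin of the factor [(m * 2)%:R] in later bounds. *)
Lemma mxnorm_le_sqn v : mxnorm v ^+ 2 <= (m * 2)%:R ^+ 2 * sqn v.
Proof.
have s0 := sqn_ge0 v.
rewrite -[X in _ * X](sqr_sqrtr s0) -exprMn ler_sqr ?nnegrE ?mxnorm_ge0 ?mulr_ge0//.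
rewrite /mxnorm natrM mulrAC -mulrA mulr_natl -[X in _ *+ X]card_ord -sumr_const.
apply: ler_sum => i _; rewrite big_ord1 mulr_natr mulr2n /cnorm1 lerD//.
  rewrite -ler_sqr ?nnegrE ?sqrtr_ge0// sqr_sqrtr// real_normK ?num_real//.
  rewrite /sqn (bigD1 i)//= -addrA lerDl addr_ge0 ?sqr_ge0//.
  by apply: sumr_ge0 => j _; rewrite addr_ge0 ?sqr_ge0.
rewrite -ler_sqr ?nnegrE ?sqrtr_ge0// sqr_sqrtr// real_normK ?num_real//.
rewrite /sqn (bigD1 i)//= -addrA addrCA lerDl addr_ge0 ?sqr_ge0//.
by apply: sumr_ge0 => j _; rewrite addr_ge0 ?sqr_ge0.
Qed.

Definition Il l : set TR := `]0, l[%classic.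

Lemma measurable_Il l : measurable (Il l).
Proof. exact: measurable_itv. Qed.

Lemma mu_Il l : 0 < l -> mu (Il l) = l%:E.
Proof. by move=> l0; rewrite /Il lebesgue_measure_itv/= lte_fin l0 -EFinD subr0. Qed.

Lemma mu_Il_fin l : (mu (Il l) < +oo)%E.
Proof. by rewrite /Il lebesgue_measure_itv/=; case: ifP => _; exact: ltry. Qed.

Hint Resolve measurable_Il mu_Il_fin : core.

Lemma Rintegral_cst_Il l (c : R) : 0 < l -> \int[mu]_(x in Il l) c = c * l.
Proof.
by move=> l0; rewrite Rintegral_cst//; congr (_ * _); rewrite [X in fine X](mu_Il l0).
Qed.

Lemma L2eqP l f g : L2eq l f g <-> {ae mu, forall x : TR, Il l x -> f x = g x}.
Proof. by []. Qed.

Lemma L2fun_measurable l f : L2fun l f -> mxmeasurable (Il l) f.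
Proof. by move=> Lf i j; rewrite ord1; have [] := Lf i. Qed.

Lemma L2fun_sqn l f : L2fun l f -> mu.-integrable (Il l) (EFin \o (fun x => sqn (f x))).
Proof.
move=> Lf; apply: (Rintegral_sum _ _ _).1 => // i.
by have [_ _] := Lf i.
Qed.

Lemma L2funP l f : mxmeasurable (Il l) f ->
  mu.-integrable (Il l) (EFin \o (fun x => sqn (f x))) -> L2fun l f.
Proof.
move=> mf isq i; have [m1 m2] := mf i 0; split=> //.
apply: (le_integrable_EFin _ _ isq) => //.
  by apply: measurable_funD; exact: measurable_funX.
move=> x _; rewrite ger0_norm ?addr_ge0 ?sqr_ge0//.
rewrite /sqn (bigD1 i)//= lerDl.
by apply: sumr_ge0 => j _; rewrite addr_ge0 ?sqr_ge0.
Qed.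

Lemma L2fun_mxnorm2 l f : L2fun l f ->
  mu.-integrable (Il l) (EFin \o (fun x => mxnorm (f x) ^+ 2)).
Proof.
move=> Lf; apply: (le_integrable_EFin _ _
  (integrableZl_EFin ((m * 2)%:R ^+ 2) _ (L2fun_sqn Lf))) => //.
  by apply: measurable_funX; apply: mxmeasurable_mxnorm; exact: L2fun_measurable.
by move=> x _; rewrite ger0_norm ?sqr_ge0// mxnorm_le_sqn.
Qed.

Lemma L2fun_integrable l f : L2fun l f -> mxintegrable (Il l) f.
Proof.
move=> Lf.
apply: (le_mxintegrable _ (L2fun_measurable Lf) (integrableD_EFin _
  (integrable_cst _ _ 1) (L2fun_mxnorm2 Lf))) => // x _.
by have := mxnorm_ge0 (f x); nra.
Qed.

Lemma L2normE l f : L2norm l f = Num.sqrt (\int[mu]_(x in Il l) sqn (f x)).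
Proof.
rewrite /L2norm /L2inner /cintegral /=; congr Num.sqrt; apply: eq_Rintegral => x _.
rewrite /sqn; elim/big_rec2: _ => //= i y z _ <-.
by case: (f x i 0) z => a b [c d] /=; congr (_ + _); ring.
Qed.

Lemma int_sqn_ge0 l f : 0 <= \int[mu]_(x in Il l) sqn (f x).
Proof. by apply: Rintegral_ge0 => x _; exact: sqn_ge0. Qed.

Lemma L2norm_sqr l f : L2norm l f ^+ 2 = \int[mu]_(x in Il l) sqn (f x).
Proof. by rewrite L2normE sqr_sqrtr// int_sqn_ge0. Qed.

Lemma L2norm_ge0 l f : 0 <= L2norm l f.
Proof. by rewrite L2normE sqrtr_ge0. Qed.

Lemma L2fun_bounded l f c : mxmeasurable (Il l) f ->
  (forall x, Il l x -> mxnorm (f x) <= c) -> L2fun l f.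
Proof.
move=> mf fc; apply: L2funP => //.
apply: (le_integrable_EFin _ _ (integrable_cst _ _ (c ^+ 2))) => //.
  apply: measurable_sum => i; have [? ?] := mf i 0.
  by apply: measurable_funD; exact: measurable_funX.
move=> x Dx; rewrite ger0_norm ?sqn_ge0// (le_trans (sqn_le_mxnorm _))//.
have c0 : 0 <= c by rewrite (le_trans (mxnorm_ge0 (f x)))// fc.
by rewrite ler_sqr ?nnegrE ?mxnorm_ge0// fc.
Qed.

Lemma L2norm_bounded l f c : 0 < l -> mxmeasurable (Il l) f ->
  (forall x, Il l x -> mxnorm (f x) <= c) -> L2norm l f ^+ 2 <= c ^+ 2 * l.
Proof.
move=> l0 mf fc; rewrite L2norm_sqr.
have Lf := L2fun_bounded mf fc.
have -> : c ^+ 2 * l = \int[mu]_(x in Il l) (c ^+ 2).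
  by rewrite Rintegral_cst_Il.
apply: le_Rintegral => //; [exact: L2fun_sqn|exact: integrable_cst|].
move=> x Dx; rewrite (le_trans (sqn_le_mxnorm _))//.
have c0 : 0 <= c by rewrite (le_trans (mxnorm_ge0 (f x)))// fc.
by rewrite ler_sqr ?nnegrE ?mxnorm_ge0// fc.
Qed.

Lemma L2fun_lin l (a : C) f g : L2fun l f -> L2fun l g ->
  L2fun l (fun x => a *: f x + g x).
Proof.
move=> Lf Lg; apply: L2funP.
  apply: mxmeasurableD; last exact: L2fun_measurable.
  move=> i j; under eq_fun do rewrite mxE.
  by apply: cmeasurableM; [exact: cmeasurable_cst|exact: (L2fun_measurable Lf)].
apply: (le_integrable_EFin _ _ (integrableD_EFin _
  (integrableZl_EFin (2 * (Re a ^+ 2 + Im a ^+ 2)) _ (L2fun_sqn Lf))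
  (integrableZl_EFin 2 _ (L2fun_sqn Lg)))) => //.
  apply: measurable_sum => i.
  have [f1 f2] := L2fun_measurable Lf i 0; have [g1 g2] := L2fun_measurable Lg i 0.
  have [h1 h2] := cmeasurableD (cmeasurableM (cmeasurable_cst _ a) (conj f1 f2)) (conj g1 g2).
  apply: measurable_funD; apply: measurable_funX.
    by apply: eq_measurable_fun h1 => x _; rewrite !mxE.
  by apply: eq_measurable_fun h2 => x _; rewrite !mxE.
move=> x _; rewrite ger0_norm ?sqn_ge0// (le_trans (sqnD _ _))// sqnZ.
by rewrite mulrA.
Qed.

Lemma L2funD l f g : L2fun l f -> L2fun l g -> L2fun l (fun x => f x + g x).
Proof.
move=> Lf Lg; have := L2fun_lin 1 Lf Lg.
by congr (L2fun l); apply/funext => x; rewrite scale1r.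
Qed.

Lemma L2funN l f : L2fun l f -> L2fun l (fun x => - f x).
Proof.
(* The function -f is obtained as (-2) f + f, so that linear combinations of f with itself
   suffice. *)
move=> Lf; have := L2fun_lin (-1 - 1) Lf Lf.
congr (L2fun l); apply/funext => x.
by rewrite scalerDl !scaleN1r addrNK.
Qed.

Lemma L2normD l f g : L2fun l f -> L2fun l g ->
  L2norm l (fun x => f x + g x) ^+ 2 <= 2 * L2norm l f ^+ 2 + 2 * L2norm l g ^+ 2.
Proof.
move=> Lf Lg; rewrite !L2norm_sqr.
have sf := L2fun_sqn Lf; have sg := L2fun_sqn Lg.
rewrite -!RintegralZl// -RintegralD//; try exact: integrableZl_EFin.
apply: le_Rintegral => //; [exact/L2fun_sqn/L2funD|
  by apply: integrableD_EFin => //; exact: integrableZl_EFin|].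
by move=> x _; exact: sqnD.
Qed.

Lemma L1_le_L2 l f : 0 < l -> L2fun l f ->
  (\int[mu]_(x in Il l) mxnorm (f x)) ^+ 2 <= l * (m * 2)%:R ^+ 2 * L2norm l f ^+ 2.
Proof.
move=> l0 Lf; rewrite L2norm_sqr.
have i1 := mxintegrable_mxnorm (measurable_Il l) (L2fun_integrable Lf).
have i2 := L2fun_mxnorm2 Lf.
set I := \int[mu]_(x in Il l) _.
set J := \int[mu]_(x in Il l) (mxnorm (f x) ^+ 2).
have IJ : I ^+ 2 <= l * J.
  (* Cauchy-Schwarz against the constant 1: [c] is the mean of the function, and its nonnegative
     quadratic deviation expands to J - I^2/l. *)
  pose c := I / l.
  have : 0 <= \int[mu]_(x in Il l) ((mxnorm (f x) - c) ^+ 2).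
    by apply: Rintegral_ge0 => x _; exact: sqr_ge0.
  have -> : \int[mu]_(x in Il l) ((mxnorm (f x) - c) ^+ 2) = J + (- (2 * c) * I + c ^+ 2 * l).
    have -> : c ^+ 2 * l = \int[mu]_(x in Il l) (c ^+ 2) by rewrite Rintegral_cst_Il.
    rewrite /I -RintegralZl// -RintegralD//; [|exact: integrableZl_EFin|exact: integrable_cst].
    rewrite /J -RintegralD//; last first.
      by apply: integrableD_EFin => //; [exact: integrableZl_EFin|exact: integrable_cst].
    by apply: eq_Rintegral => x _; ring.
  have -> : J + (- (2 * c) * I + c ^+ 2 * l) = J - I ^+ 2 / l.
    by rewrite /c; field; exact: lt0r_neq0.
  by rewrite subr_ge0 ler_pdivrMr// mulrC.
rewrite (le_trans IJ)// -mulrA ler_wpM2l ?(ltW l0)//.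
rewrite -RintegralZl//; last exact: L2fun_sqn.
apply: le_Rintegral => //; first exact/integrableZl_EFin/L2fun_sqn.
by move=> x _; exact: mxnorm_le_sqn.
Qed.

Lemma eq_L2norm l f g : L2fun l f -> L2fun l g -> L2eq l f g -> L2norm l f = L2norm l g.
Proof.
move=> Lf Lg fg; rewrite !L2normE; congr (Num.sqrt (fine _)).
apply: ae_eq_integral => //.
- by have /measurable_int := L2fun_sqn Lf.
- by have /measurable_int := L2fun_sqn Lg.
- by move/L2eqP : fg; apply: filterS => x fg Dx; rewrite /= fg.
Qed.

Lemma L2norm_eq0 l f : L2fun l f -> L2norm l f = 0 -> L2eq l f (fun=> 0).
Proof.
move=> Lf f0.
have I0 : \int[mu]_(x in Il l) mxnorm (f x) ^+ 2 = 0.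
  apply/eqP; rewrite eq_le Rintegral_ge0 ?andbT; last by move=> x _; exact: sqr_ge0.
  rewrite (@le_trans _ _ ((m * 2)%:R ^+ 2 * \int[mu]_(x in Il l) sqn (f x)))//.
    rewrite -RintegralZl//; last exact: L2fun_sqn.
    apply: le_Rintegral => //; [exact: L2fun_mxnorm2|exact/integrableZl_EFin/L2fun_sqn|].
    by move=> x _; exact: mxnorm_le_sqn.
  by rewrite -L2norm_sqr f0 expr0n mulr0.
have im := L2fun_mxnorm2 Lf.
have/(ae_eq_integral_abs mu (measurable_Il l)) :
    (\int[mu]_(x in Il l) `|(mxnorm (f x) ^+ 2)%:E| = 0)%E.
  rewrite -[RHS]/((0 : R)%:E) -I0 /Rintegral fineK; last exact: (integrable_fin_num _ im).
  by apply: eq_integral => x _; rewrite gee0_abs// lee_fin sqr_ge0.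
move=> H; have {}H := H (measurable_int _ im).
apply/L2eqP; move: H; apply: filterS => x H Dx; apply: mxnorm_eq0.
by have /eqP := H Dx; rewrite eqe sqrf_eq0 => /eqP.
Qed.

Lemma L2fun0 l : L2fun l (fun=> 0 : 'cV[C]_m).
Proof. by apply: (@L2fun_bounded _ _ 0) => [|x _]; [exact: mxmeasurable_cst|rewrite mxnorm0]. Qed.

Lemma bounded_operator_ae0 l T f : bounded_operator l T -> L2fun l f ->
  L2eq l f (fun=> 0) -> L2eq l (T f) (fun=> 0).
Proof.
move=> [TL _ [M TM]] Lf f0; apply: L2norm_eq0; first exact: TL.
apply/eqP; rewrite eq_le L2norm_ge0 andbT (le_trans (TM _ Lf))//.
rewrite (eq_L2norm Lf (L2fun0 l) f0) L2normE (@eq_Rintegral _ _ _ _ _ (fun=> 0)).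
  by rewrite Rintegral_cst// mul0r sqrtr0 mulr0.
by move=> x _; rewrite /sqn big1// => i _; rewrite mxE/= expr0n addr0.
Qed.

Lemma bounded_operator_sub l T f g : bounded_operator l T -> L2fun l f ->
  L2fun l g -> L2eq l (T (fun x => f x - g x)) (fun x => T f x - T g x).
Proof.
move=> [TL Tlin _] Lf Lg; have := Tlin (-1) g f Lg Lf.
rewrite (_ : (fun x => -1 *: g x + f x) = (fun x => f x - g x)).
  by move=> /L2eqP H; apply/L2eqP; move: H; apply: filterS => x Hx Dx; rewrite Hx// scaleN1r addrC.
by apply/funext => x; rewrite scaleN1r addrC.
Qed.

(** Operators act on representatives, so compatibility with almost everywhere equality is deduced
    from the norm bound applied to the difference. *)
Lemma bounded_operator_ae l T f g : bounded_operator l T -> L2fun l f ->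
  L2fun l g -> L2eq l f g -> L2eq l (T f) (T g).
Proof.
move=> bT Lf Lg fg.
have Lfg : L2fun l (fun x => f x - g x) by apply: L2funD => //; exact: L2funN.
have fg0 : L2eq l (fun x => f x - g x) (fun=> 0).
  apply/L2eqP; move/L2eqP : fg; apply: filterS => x fg Dx.
  by rewrite fg// subrr.
have /L2eqP := bounded_operator_ae0 bT Lfg fg0.
have /L2eqP := bounded_operator_sub bT Lf Lg.
move=> H1 H2; apply/L2eqP; move: H1 H2; apply: filterS2 => x H1 H2 Dx; apply/eqP; rewrite -subr_eq0.
by rewrite -(H1 Dx) (H2 Dx).
Qed.

End SquareIntegrable.

#[local] Hint Resolve measurable_Il mu_Il_fin : core.
(** * The integral equations defining the factor *)

Section SectionEquation.
Context {R : realType} {m : nat}.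
Local Notation C := R[i].
Local Notation mu := (@lebesgue_measure R).
Local Notation TR := (measurableTypeR R).
Variable s : R -> R -> 'M[C]_m.
Hypothesis s_herm : forall x t, (s t x) ^t* = s x t.
Hypothesis s_meas : mxmeasurable [set: TR * TR] (fun p => s p.1 p.2).
Hypothesis s_bounded : forall X, exists2 c, 0 <= c &
  forall x t, 0 <= x <= X -> 0 <= t <= X -> mxnorm (s x t) <= c.
Hypothesis s_equicont : forall X x0 eps, 0 < eps -> exists2 d, 0 < d &
  forall x t, 0 <= x <= X -> 0 <= x0 <= X -> 0 <= t <= X -> `|x - x0| < d ->
  mxnorm (s x t - s x0 t) <= eps.

Let mIl l : measurable (Il l : set TR) := measurable_Il l.
Let fIl l := @mu_Il_fin R l.

Lemma IlP (l : R) (x : TR) : Il l x <-> 0 < x < l.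
Proof. exact: itvooP. Qed.

Lemma Il_subset (a b : R) : a <= b -> Il a `<=` Il b.
Proof. by move=> ab x /IlP/andP[x0 xa]; apply/IlP; rewrite x0 (lt_le_trans xa). Qed.

Lemma section_measurable t (D : set TR) : measurable D -> mxmeasurable D (s t).
Proof.
move=> mD; apply: (mxmeasurable_comp (h := pair t) _ _ s_meas) => //.
by apply: measurable_funTS; exact: pair1_measurable.
Qed.

Lemma sectionr_measurable t (D : set TR) : measurable D -> mxmeasurable D (s^~ t).
Proof.
move=> mD; apply: (mxmeasurable_comp (h := pair^~ t) _ _ s_meas) => //.
by apply: measurable_funTS; exact: pair2_measurable.
Qed.

Lemma bker_s l : bker (Il l) s.
Proof.
split; first by apply: mxmeasurableS s_meas.
have [c c0 sc] := s_bounded l; exists c => // x t /IlP/andP[/ltW x0 /ltW xl].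
by move=> /IlP/andP[/ltW t0 /ltW tl]; apply: sc; rewrite ?x0 ?t0.
Qed.

Lemma s_integrand l t p (f : TR -> 'M[C]_(m, p)) : 0 <= t ->
  mxintegrable (Il l) f -> mxintegrable (Il l) (fun u => s t u *m f u).
Proof.
move=> t0 iF; have [c c0 sc] := s_bounded (Num.max t l).
apply: (le_mxintegrable _ _ (integrableZl_EFin c _ (mxintegrable_mxnorm _ iF))) => //.
  apply: mxmeasurableM; first exact: section_measurable.
  exact: mxintegrable_measurable.
move=> u /IlP/andP[/ltW u0 /ltW ul].
rewrite (le_trans (mxnormM _ _))// ler_wpM2r ?mxnorm_ge0// sc//.
  by rewrite t0 le_max lexx.
by rewrite u0 le_max ul orbT.
Qed.

Lemma s_apply_bound X c l t p (f : TR -> 'M[C]_(m, p)) :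
  (forall x t, 0 <= x <= X -> 0 <= t <= X -> mxnorm (s x t) <= c) ->
  l <= X -> 0 <= t <= X -> mxintegrable (Il l) f ->
  mxnorm (Op (Il l) s f t) <= c * \int[mu]_(u in Il l) mxnorm (f u).
Proof.
move=> sc lX /andP[t0 tX] iF; have im := mxintegrable_mxnorm (mIl l) iF.
rewrite -RintegralZl//; apply: le_mxnorm_mxintegral => //.
- exact/mxintegrable_measurable/s_integrand.
- exact: integrableZl_EFin.
- move=> u /IlP/andP[/ltW u0 /ltW ul].
  rewrite (le_trans (mxnormM _ _))// ler_wpM2r ?mxnorm_ge0// sc ?t0//.
  by rewrite u0 (le_trans ul).
Qed.

Lemma s_apply_sub l t p (f g : TR -> 'M[C]_(m, p)) : 0 <= t ->
  mxintegrable (Il l) f -> mxintegrable (Il l) g ->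
  Op (Il l) s (fun u => f u - g u) t = Op (Il l) s f t - Op (Il l) s g t.
Proof.
move=> t0 iF iG; rewrite -mxintegralN//; last exact: s_integrand.
rewrite -mxintegralD//; try exact: s_integrand.
  by apply: eq_mxintegral => u _; rewrite mulmxBr.
by apply: mxintegrableN => //; exact: s_integrand.
Qed.

(** These are the functions with finite sup norm over [0, X]. The bound includes the end points
    because the integral equations are read at every point of [0, X]. *)
Definition bfun X (f : R -> 'cV[C]_m) := mxmeasurable (Il X : set TR) f /\
  exists b, forall t, 0 <= t <= X -> mxnorm (f t) <= b.

Lemma bfun_measurable X l f : l <= X -> bfun X f -> mxmeasurable (Il l : set TR) f.
Proof. by move=> lX [mf _]; apply: mxmeasurableS mf => //; exact: Il_subset. Qed.

Lemma bfun_L2 X l f : l <= X -> bfun X f -> L2fun l f.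
Proof.
move=> lX bf; have [_ [b fb]] := bf.
apply: (@L2fun_bounded _ _ _ _ b); first exact: bfun_measurable bf.
by move=> x /IlP/andP[/ltW x0 /ltW xl]; apply: fb; rewrite x0 (le_trans xl).
Qed.

Lemma bfun_integrable X l f : l <= X -> bfun X f -> mxintegrable (Il l) f.
Proof. by move=> lX bf; apply/L2fun_integrable/bfun_L2/bf. Qed.

Lemma bfunB X f g : bfun X f -> bfun X g -> bfun X (fun t => f t - g t).
Proof.
move=> [mf [a fa]] [mg [b gb]]; split.
  by apply: mxmeasurableD => //; exact: mxmeasurableN.
exists (a + b) => t tX; rewrite (le_trans (mxnormB _ _))// lerD ?fa ?gb//.
Qed.

Lemma mxintegral_Il_sub p (F : TR -> 'M[C]_(m, p)) (K a b : R) :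
  mxintegrable (Il a) F -> (forall u, b <= u < a -> mxnorm (F u) <= K) -> 0 <= K ->
  b <= a -> mxnorm (mxintegral (Il a) F - mxintegral (Il b) F) <= K * (a - b).
Proof.
move=> iFa FK K0 ba.
have mE : measurable (Il a `\` Il b : set TR) by exact: measurableD.
have iFE : mxintegrable (Il a `\` Il b) F.
  by apply: mxintegrableS iFa => //; exact: subDsetl.
have -> : mxintegral (Il a) F - mxintegral (Il b) F = mxintegral (Il a `\` Il b) F.
  rewrite (mxintegral_mkcond (D := Il a) (E := Il b) F (b := fun u : R => u < b)).
  - rewrite (mxintegral_mkcond (D := Il a) (E := Il a `\` Il b) F (b := fun u : R => ~~ (u < b))).
    + apply/eqP; rewrite subr_eq; apply/eqP.
      rewrite -mxintegralD//.
      * by apply: eq_mxintegral => u _; case: (ltP (u : R) b) => _ /=; rewrite ?addr0 ?add0r.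
      * apply: (le_mxintegrable _ _ (mxintegrable_mxnorm (mIl a) iFa)) => //.
          apply: mxmeasurable_if => //; last exact: mxintegrable_measurable.
          by apply: measurable_neg; exact: measurable_fun_ltr.
        by move=> u _; case: ifP => // _; rewrite mxnorm0 mxnorm_ge0.
      * apply: (le_mxintegrable _ _ (mxintegrable_mxnorm (mIl a) iFa)) => //.
          apply: mxmeasurable_if => //; last exact: mxintegrable_measurable.
          exact: measurable_fun_ltr.
        by move=> u _; case: ifP => // _; rewrite mxnorm0 mxnorm_ge0.
    + exact: subDsetl.
    + move=> u ua; move/IlP : (ua) => /andP[u0 _]; split.
        by move=> ub; split => // /IlP; rewrite u0/= (negbTE ub).
      by move=> [_ nb]; apply/negP => ub; apply: nb; apply/IlP; rewrite u0.
  - exact: Il_subset.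
  - move=> u /IlP/andP[u0 _]; split; last by move=> /IlP/andP[].
    by move=> ub; apply/IlP; rewrite u0.
have muE : (mu (Il a `\` Il b : set TR) <= (a - b)%:E)%E.
  have sub : Il a `\` Il b `<=` `[b, a].
    move=> u [/IlP/andP[u0 ua] nb]; apply/itvccP; rewrite (ltW ua) andbT leNgt.
    by apply/negP => ub; apply: nb; apply/IlP; rewrite u0.
  apply: (@le_trans _ _ (mu `[b, a])).
    by apply: (le_measure mu _ _ sub); rewrite inE; [|exact: measurable_itv].
  by rewrite lebesgue_measure_itv/=; case: ifPn => _; rewrite ?lee_fin ?subr_ge0// -EFinD.
have fE : (mu (Il a `\` Il b : set TR) < +oo)%E by rewrite (le_lt_trans muE)// ltry.
rewrite (le_trans (@le_mxnorm_mxintegral _ _ _ _ _ (fun=> K) _ _ _ _))//.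
- exact: mxintegrable_measurable.
- exact: integrable_cst.
- move=> u [/IlP/andP[u0 ua] nb]; apply: FK; rewrite ua andbT leNgt.
  by apply/negP => ub; apply: nb; apply/IlP; rewrite u0.
- rewrite Rintegral_cst// ler_wpM2l//.
  by rewrite -lee_fin fineK// ge0_fin_numE.
Qed.

Lemma mxintegral_Il_diff p (F : TR -> 'M[C]_(m, p)) (X K a b : R) :
  mxintegrable (Il X) F -> (forall u, 0 <= u <= X -> mxnorm (F u) <= K) -> 0 <= K ->
  0 <= a <= X -> 0 <= b <= X ->
  mxnorm (mxintegral (Il a) F - mxintegral (Il b) F) <= K * `|a - b|.
Proof.
move=> iF FK K0.
wlog ba : a b / b <= a => [hw|] /andP[a0 aX] /andP[b0 bX].
  have [ba|/ltW ab] := leP b a; first by apply: hw; rewrite ?a0 ?b0.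
  by rewrite distrC -mxnormN opprB; apply: hw; rewrite ?a0 ?b0.
rewrite ger0_norm ?subr_ge0//; apply: mxintegral_Il_sub => //.
  by apply: mxintegrableS iF => //; exact: Il_subset.
move=> u /andP[bu ua]; apply: FK; rewrite (le_trans b0 bu).
by rewrite (le_trans (ltW ua)).
Qed.

(** This O(|a - b|) estimate in sup norm is the perturbation bound that compares [S_x] with
    [S_x0]. *)
Lemma Op_Il_diff (X K a b t : R) f c :
  (forall x t, 0 <= x <= X -> 0 <= t <= X -> mxnorm (s x t) <= c) -> 0 <= c ->
  bfun X f -> (forall u, 0 <= u <= X -> mxnorm (f u) <= K) ->
  0 <= t <= X -> 0 <= a <= X -> 0 <= b <= X ->
  mxnorm (Op (Il a) s f t - Op (Il b) s f t) <= c * K * `|a - b|.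
Proof.
move=> sc c0 bf fK /andP[t0 tX] aX bX.
have K0 : 0 <= K by rewrite (le_trans (mxnorm_ge0 (f t)))// fK// t0.
apply: (@mxintegral_Il_diff _ _ X) => //.
- by apply: s_integrand => //; exact: bfun_integrable bf.
- move=> u /andP[u0 uX].
  rewrite (le_trans (mxnormM _ _))// ler_pM ?mxnorm_ge0 ?sc ?fK//; rewrite ?u0 ?t0//.
- exact: mulr_ge0.
Qed.

Hypothesis S_inv : forall l, 0 < l ->
  boundedly_invertible l (fun (f : R -> 'cV[C]_m) x => f x - Op (Il l) s f x).

(** Let h = f - s f. Since f = h + s f and s maps L^1 into bounded functions, it is enough to bound
    f in L^1(0, x0), hence in L^2(0, x0), where the inverse does it. The same identity controls f on
    the part of [0, X] beyond x0. *)
Lemma inverse_sup_bound x0 X : 0 <= x0 <= X -> exists2 N, 0 <= N &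
  forall f b, bfun X f ->
    (forall t, 0 <= t <= X -> mxnorm (f t - Op (Il x0) s f t) <= b) ->
  forall t, 0 <= t <= X -> mxnorm (f t) <= N * b.
Proof.
move=> /andP[]; rewrite le_eqVlt => /predU1P[<- _|x00 x0X].
  exists 1 => // f b bf fb t tX; rewrite mul1r (le_trans _ (fb t tX))//.
  suff -> : Op (Il 0) s f t = 0 by rewrite subr0.
  rewrite /Op /Il set_itvoo0; apply/matrixP => i j; rewrite !mxE /cintegral.
  by rewrite !Rintegral_set0.
have [T [[TL Tlin [M TM]] ST TS]] := S_inv x00.
have [c c0 sc] := s_bounded X.
(* The factor x0 arises as two square roots, one from comparing L^1 with L^2 and one from comparing
   L^2 with the sup norm. The absolute value is taken because M may be negative. *)
exists (1 + c * (x0 * (m * 2)%:R * `|M|)).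
  by rewrite addr_ge0// mulr_ge0// !mulr_ge0// ltW.
move=> f b bf fb t tX.
have b0 : 0 <= b by rewrite (le_trans (mxnorm_ge0 _) (fb t tX)).
have Lf := bfun_L2 x0X bf; have iF := bfun_integrable x0X bf.
pose h x := f x - Op (Il x0) s f x.
have sub x : Il x0 x -> 0 <= x <= X.
  by move=> /IlP/andP[/ltW -> /ltW xx0]; rewrite (le_trans xx0).
have mh : mxmeasurable (Il x0 : set TR) h.
  apply: mxmeasurableD; first exact: L2fun_measurable.
  by apply: mxmeasurableN; apply: mxmeasurable_Op => //; exact: bker_s.
have hb x : Il x0 x -> mxnorm (h x) <= b by move=> /sub; exact: fb.
have Lh : L2fun x0 h by exact: L2fun_bounded hb.
have nf : L2norm x0 f <= `|M| * L2norm x0 h.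
  have fTh : L2eq x0 (T h) f by exact: TS.
  rewrite -(eq_L2norm (TL _ Lh) Lf fTh) (le_trans (TM _ Lh))//.
  by rewrite ler_wpM2r ?L2norm_ge0// ler_norm.
have n2 := L2norm_bounded x00 mh hb.
have I2 := L1_le_L2 x00 Lf.
set I := \int[mu]_(x in Il x0) mxnorm (f x) in I2.
have I0 : 0 <= I by apply: Rintegral_ge0 => x _; exact: mxnorm_ge0.
have Ib : I <= x0 * (m * 2)%:R * `|M| * b.
  rewrite -ler_sqr ?nnegrE//; last by rewrite !mulr_ge0// ltW.
  rewrite (le_trans I2)//.
  have nf2 : L2norm x0 f ^+ 2 <= `|M| ^+ 2 * (b ^+ 2 * x0).
    rewrite (@le_trans _ _ ((`|M| * L2norm x0 h) ^+ 2))//.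
      by rewrite ler_sqr ?nnegrE ?mulr_ge0 ?L2norm_ge0.
    by rewrite exprMn ler_wpM2l ?sqr_ge0.
  rewrite (le_trans (ler_wpM2l _ nf2)) ?mulr_ge0 ?sqr_ge0 ?(ltW x00)//.
  by rewrite le_eqVlt; apply/orP; left; apply/eqP; ring.
have -> : f t = h t + Op (Il x0) s f t by rewrite /h subrK.
rewrite (le_trans (mxnormD _ _))// mulrDl mul1r lerD//; first exact: fb.
rewrite (le_trans (s_apply_bound sc x0X tX iF))// -mulrA ler_wpM2l//.
Qed.

(** If B is the supremum of the norm of f, replacing x by x0 costs c B |x - x0|, and the bound at x0
    gives B <= N (b + c B |x - x0|). When N c |x - x0| <= 1/2 the last term is absorbed, which
    doubles the constant. Absorption requires B to be finite, hence [bfun]. *)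
Lemma inverse_locally_bounded x0 X : 0 <= x0 <= X -> exists N d,
  [/\ 0 <= N, 0 < d & forall x f b, 0 <= x <= X -> `|x - x0| < d -> bfun X f ->
    (forall t, 0 <= t <= X -> mxnorm (f t - Op (Il x) s f t) <= b) ->
  forall t, 0 <= t <= X -> mxnorm (f t) <= N * b].
Proof.
move=> x0X; have [N N0 HN] := inverse_sup_bound x0X.
have [c c0 sc] := s_bounded X.
have P0 : 0 < 2 * (N * c + 1) by rewrite mulr_gt0// ltr_wpDl ?mulr_ge0.
exists (2 * N), (2 * (N * c + 1))^-1; split; rewrite ?mulr_ge0 ?invr_gt0//.
move=> x f b xX xx0 bf fb.
have X0 : 0 <= X by case/andP : x0X => /le_trans; apply.
pose A := [set mxnorm (f t) | t in [set t | 0 <= t <= X]].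
have supA : has_sup A.
  split; first by exists (mxnorm (f 0)), 0 => //=; rewrite lexx.
  by have [_ [B fB]] := bf; exists B => _ [t tX <-]; exact: fB.
set B := sup A.
have fB t : 0 <= t <= X -> mxnorm (f t) <= B.
  by move=> tX; apply: (ub_le_sup supA.2); exists t.
have b0 : 0 <= b by rewrite (le_trans (mxnorm_ge0 _) (fb 0 _))// lexx.
have B0 : 0 <= B by rewrite (le_trans (mxnorm_ge0 (f 0)))// fB// lexx.
have key t : 0 <= t <= X -> mxnorm (f t) <= N * (b + c * B * `|x - x0|).
  apply: HN => // u uX.
  rewrite (_ : _ - _ = (f u - Op (Il x) s f u) + (Op (Il x) s f u - Op (Il x0) s f u)).
    rewrite (le_trans (mxnormD _ _))// lerD ?fb//.
    exact: (Op_Il_diff sc).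
  by rewrite addrA subrK.
have BB : B <= N * (b + c * B * `|x - x0|).
  by apply: ge_sup; [case: supA|move=> _ [t tX <-]; exact: key].
have small : N * c * `|x - x0| <= 2^-1.
  have : (2 * (N * c + 1)) * `|x - x0| <= 1.
    by rewrite mulrC -ler_pdivlMr// mul1r ltW.
  have := normr_ge0 (x - x0); lra.
have B2 : B <= 2 * N * b.
  have : N * c * `|x - x0| * B <= 2^-1 * B by rewrite ler_wpM2r.
  by lra.
by move=> t tX; rewrite (le_trans (fB t tX)).
Qed.

(** [S_x] acts on columns from the left while the equation for E multiplies s from the right. So the
    unknown is the conjugate transpose of E(x, .), solved for column by column with these right-hand
    sides. *)
Let h (k : 'I_m) x t := col k (s t x).

Lemma mxnorm_col p q (A : 'M[C]_(p, q)) k : mxnorm (col k A) <= mxnorm A.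
Proof.
rewrite /mxnorm; apply: ler_sum => i _; rewrite big_ord1 mxE.
by rewrite (bigD1 k)//= lerDl; apply: sumr_ge0 => j _; exact: cnorm1_ge0.
Qed.

(** The inverse provides a solution f only up to null sets and only on ]0, x[. Setting g = [h k x] +
    s f repairs both: g is defined for every t >= 0, and as g = f almost everywhere on ]0, x[, it
    satisfies the equation at each point. *)
Lemma section_equation_solvable (k : 'I_m) x : 0 <= x -> exists g : R -> 'cV[C]_m,
  (forall X, x <= X -> bfun X g) /\
  forall t, 0 <= t -> g t = h k x t + Op (Il x) s g t.
Proof.
have mh l : mxmeasurable (Il l : set TR) (h k x).
  move=> i j; rewrite /h; under eq_fun do rewrite mxE.
  exact: sectionr_measurable.
rewrite le_eqVlt => /predU1P[<-|x0].
  exists (h k 0); split.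
    move=> X X0; split.
      by move=> i j; rewrite /h; under eq_fun do rewrite mxE; exact: sectionr_measurable.
    have [c c0 sc] := s_bounded X; exists c => t tX.
    by rewrite (le_trans (mxnorm_col _ _))// sc// lexx.
  move=> t t0; suff -> : Op (Il 0) s (h k 0) t = 0 by rewrite addr0.
  rewrite /Op /Il set_itvoo0; apply/matrixP => i j; rewrite !mxE /cintegral.
  by rewrite !Rintegral_set0.
have [T [[TL Tlin _] ST _]] := S_inv x0.
have Lh : L2fun x (h k x).
  have [c c0 sc] := s_bounded x.
  apply: (@L2fun_bounded _ _ _ _ c) => // t /IlP/andP[/ltW t0 /ltW tx].
  by rewrite (le_trans (mxnorm_col _ _))// sc ?t0 ?(ltW x0)/=.
pose f := T (h k x); have Lf : L2fun x f by exact: TL.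
have iF := L2fun_integrable Lf.
pose g t := h k x t + Op (Il x) s f t.
have gf : {ae mu, forall t : TR, Il x t -> g t = f t}.
  have /L2eqP := ST _ Lh; apply: filterS => t Ht xt.
  by rewrite /g -[h k x t](Ht xt) /= subrK.
have bg X : x <= X -> bfun X g.
  move=> xX; have [c c0 sc] := s_bounded X; split.
    apply: mxmeasurableD; first exact: mh.
    apply: (mxmeasurable_mxintegral (m1 := mu) (F := fun t u => s t u *m f u)
      (mIl X) (mIl x) _ (integrable_cst (mIl X) (@fIl X) c)
      (mxintegrable_mxnorm (mIl x) iF)) => [|t u Xt xu].
      apply: mxmeasurableM; first by apply: mxmeasurableS s_meas.
      apply: (mxmeasurable_comp (h := snd) _ _ (mxintegrable_measurable iF)) => //.
        by move=> _ [[? ?] [/= ? ?] <-].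
      by apply: measurable_funTS; exact: measurable_snd.
    move: Xt xu => /IlP/andP[/ltW t0 /ltW tX] /IlP/andP[/ltW u0 /ltW ux].
    rewrite (le_trans (mxnormM _ _))// ler_wpM2r ?mxnorm_ge0// sc ?t0 ?u0//=.
    exact: le_trans xX.
  exists (c + c * \int[mu]_(u in Il x) mxnorm (f u)) => t tX.
  rewrite (le_trans (mxnormD _ _))// lerD//; last exact: (s_apply_bound sc xX tX iF).
  by rewrite (le_trans (mxnorm_col _ _))// sc// (ltW x0) xX.
exists g; split => // t t0; rewrite {1}/g; congr (_ + _).
apply: ae_eq_mxintegral => //.
- exact/mxintegrable_measurable/s_integrand.
- apply/mxintegrable_measurable/s_integrand => //.
  exact: (bfun_integrable (lexx x) (bg _ _)).
- by have := gf; apply: filterS => u Hu xu; rewrite Hu.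
Qed.

Lemma section_solution : exists g : 'I_m -> R -> R -> 'cV[C]_m,
  forall k x, 0 <= x -> (forall X, x <= X -> bfun X (g k x)) /\
  forall t, 0 <= t -> g k x t = h k x t + Op (Il x) s (g k x) t.
Proof.
have : forall kx : 'I_m * R, exists g : R -> 'cV[C]_m, 0 <= kx.2 ->
    (forall X, kx.2 <= X -> bfun X g) /\
    forall t, 0 <= t -> g t = h kx.1 kx.2 t + Op (Il kx.2) s g t.
  move=> [k x] /=; have [x0|_] := leP 0 x; last by exists (fun=> 0).
  by have [g Hg] := section_equation_solvable k x0; exists g.
by move=> /choice[G HG]; exists (fun k x => G (k, x)) => k x; exact: (HG (k, x)).
Qed.

(** The difference of the solutions for x and x0 solves the equation of [S_x]; its right-hand side
    is the change of [h] plus the effect of the new truncation on the fixed solution at x0. The sup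
    bound, uniform near x0, makes the difference small. Continuity in t is then required only of the
    single solution at x0. *)
Lemma section_solution_continuous (g : 'I_m -> R -> R -> 'cV[C]_m) :
  (forall k x, 0 <= x -> (forall X, x <= X -> bfun X (g k x)) /\
    forall t, 0 <= t -> g k x t = h k x t + Op (Il x) s (g k x) t) ->
  forall k x0 t0 eps, 0 <= x0 -> 0 <= t0 -> 0 < eps -> exists2 d, 0 < d &
  forall x t, 0 <= x -> 0 <= t -> `|x - x0| < d -> `|t - t0| < d ->
  mxnorm (g k x t - g k x0 t0) <= eps.
Proof.
move=> Hg k x0 t0 eps x00 t00 eps0.
(* The margin 1 keeps all nonnegative x and t within distance 1 of x0 and t0 inside [0, X]. *)
pose X := Num.max x0 t0 + 1.
have x0X : 0 <= x0 <= X by rewrite x00 /X (@le_trans _ _ (Num.max x0 t0)) ?lerDl// le_max lexx.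
have t0X : 0 <= t0 <= X by rewrite t00 /X (@le_trans _ _ (Num.max x0 t0)) ?lerDl// le_max lexx orbT.
have X0 : 0 <= X by case/andP : x0X => /le_trans; apply.
have [N [d1 [N0 d10 HN]]] := inverse_locally_bounded x0X.
have [c c0 sc] := s_bounded X.
have [gb geq] := Hg k x0 x00.
have bg0 := gb _ (proj2 (andP x0X)).
have [_ [B gB]] := bg0.
have B0 : 0 <= B by rewrite (le_trans (mxnorm_ge0 _) (gB x0 x0X)).
(* The choices give N (e1 + e1) <= eps/2 for the change of x and e2 (1 + B x0) <= eps/4 for the
   change of t; [d4] makes the truncation error c B |x - x0| at most e1. *)
pose e1 := eps / (4 * (N + 1)).
have e10 : 0 < e1 by rewrite divr_gt0// mulr_gt0// ltr_wpDl.
have [d2 d20 Hd2] := s_equicont X x0 e10.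
pose e2 := eps / (4 * (X * B + 1)).
have e20 : 0 < e2 by rewrite divr_gt0// mulr_gt0// ltr_wpDl// mulr_ge0.
have [d3 d30 Hd3] := s_equicont X t0 e20.
pose d4 := e1 / (c * B + 1).
have d40 : 0 < d4 by rewrite divr_gt0// ltr_wpDl// mulr_ge0.
exists (Num.min (Num.min d1 d2) (Num.min (Num.min d3 d4) 1)).
  by rewrite !lt_min d10 d20 d30 d40 ltr01.
move=> x t xge0 tge0; rewrite !lt_min => /andP[/andP[xd1 xd2] /andP[/andP[_ xd4] x1]].
move=> /andP[_ /andP[/andP[td3 _] t1]].
have xX : 0 <= x <= X.
  rewrite xge0/= /X; move: x1; rewrite ltr_distl => /andP[_ xx0].
  by rewrite (le_trans (ltW xx0))// lerD2r le_max lexx.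
have tX : 0 <= t <= X.
  rewrite tge0/= /X; move: t1; rewrite ltr_distl => /andP[_ tt0].
  by rewrite (le_trans (ltW tt0))// lerD2r le_max lexx orbT.
have hx y : 0 <= y <= X -> mxnorm (h k x y - h k x0 y) <= e1.
  move=> yX; rewrite /h -linearB/= (le_trans (mxnorm_col _ _))//.
  (* Here x is the second argument of s; Hermitian symmetry moves it to the first, where
     [s_equicont] applies. *)
  by rewrite -(s_herm y x) -(s_herm y x0) -adjmxN -adjmxD mxnorm_adj Hd2.
have ht : mxnorm (h k x0 t - h k x0 t0) <= e2.
  by rewrite /h -linearB/= (le_trans (mxnorm_col _ _))// Hd3.
have [gbx geqx] := Hg k x xge0.
have bgx := gbx _ (proj2 (andP xX)).
have step1 : mxnorm (g k x t - g k x0 t) <= N * (e1 + e1).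
  have bgd : bfun X (fun t => g k x t - g k x0 t) by exact: bfunB.
  apply: (HN x _ _ xX xd1 bgd) => // u uX.
  have u0 : 0 <= u by case/andP : uX.
  have xle := proj2 (andP xX).
  have -> : g k x u - g k x0 u - Op (Il x) s (fun t => g k x t - g k x0 t) u =
      (h k x u - h k x0 u) + (Op (Il x) s (g k x0) u - Op (Il x0) s (g k x0) u).
    rewrite (s_apply_sub u0 (bfun_integrable xle bgx) (bfun_integrable xle bg0)).
    rewrite (geqx u u0) (geq u u0) !opprD !opprK !addrA.
    by rewrite [LHS](ACl (1*3*6*4*(2*5)))/= subrr addr0.
  rewrite (le_trans (mxnormD _ _))// lerD ?hx//.
  rewrite (le_trans (Op_Il_diff sc c0 bg0 gB uX xX x0X))//.
  have cB : 0 <= c * B by exact: mulr_ge0.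
  have : (c * B + 1) * `|x - x0| <= e1.
    by rewrite mulrC -ler_pdivlMr ?ltr_wpDl// ltW.
  by have := normr_ge0 (x - x0); lra.
have step2 : mxnorm (g k x0 t - g k x0 t0) <= e2 + e2 * B * x0.
  have x0le := proj2 (andP x0X).
  have ig := bfun_integrable x0le bg0.
  have -> : g k x0 t - g k x0 t0 = (h k x0 t - h k x0 t0) +
      mxintegral (Il x0) (fun u => (s t u - s t0 u) *m g k x0 u).
    have -> : mxintegral (Il x0) (fun u => (s t u - s t0 u) *m g k x0 u) =
        Op (Il x0) s (g k x0) t - Op (Il x0) s (g k x0) t0.
      rewrite -mxintegralN//; last exact: s_integrand.
      rewrite -mxintegralD//; try exact: s_integrand.
        by apply: eq_mxintegral => u _; rewrite mulmxBl.
      by apply: mxintegrableN => //; exact: s_integrand.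
    rewrite (geq t tge0) (geq t0 t00) opprD !addrA.
    by rewrite [LHS](ACl (1*3*2*4)).
  rewrite (le_trans (mxnormD _ _))// lerD//.
  have fst' : mxintegrable (Il x0) (fun u => (s t u - s t0 u) *m g k x0 u).
    rewrite (_ : (fun _ => _) = fun u => s t u *m g k x0 u + - (s t0 u *m g k x0 u)).
      by apply: mxintegrableD => //; [|apply: mxintegrableN => //]; exact: s_integrand.
    by apply/funext => u; rewrite mulmxBl.
  rewrite (le_trans (@le_mxnorm_mxintegral _ _ _ _ _ (fun=> e2 * B) _ _ _ _))//.
  - exact: mxintegrable_measurable.
  - exact: integrable_cst.
  - move=> u /IlP/andP[/ltW u0 /ltW ux0].
    have uX : 0 <= u <= X by rewrite u0 (le_trans ux0).
    by rewrite (le_trans (mxnormM _ _))// ler_pM ?mxnorm_ge0 ?Hd3 ?gB.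
  - have [->|x0n] := eqVneq x0 0.
      by rewrite mulr0 /Il set_itvoo0 Rintegral_set0.
    by rewrite Rintegral_cst_Il// lt_neqAle eq_sym x0n.
have -> : g k x t - g k x0 t0 = (g k x t - g k x0 t) + (g k x0 t - g k x0 t0).
  by rewrite addrA subrK.
rewrite (le_trans (mxnormD _ _))//.
have e1E : e1 * (4 * (N + 1)) = eps.
  by rewrite divfK// mulf_neq0// lt0r_neq0// ltr_wpDl.
have e2E : e2 * (4 * (X * B + 1)) = eps.
  by rewrite divfK// mulf_neq0// lt0r_neq0// ltr_wpDl// mulr_ge0.
have : e2 * B * x0 <= e2 * B * X.
  by rewrite ler_wpM2l ?(proj2 (andP x0X))// mulr_ge0// ltW.
have XBe : 0 <= X * B * e2 := mulr_ge0 (mulr_ge0 X0 B0) (ltW e20).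
have Ne : 0 <= N * e1 := mulr_ge0 N0 (ltW e10).
by lra.
Qed.

Lemma factor_kernel : exists E : R -> R -> 'M[C]_m,
  [/\ forall x t, 0 <= x -> 0 <= t ->
        E x t = s x t + mxintegral (Il x) (fun u => E x u *m s u t),
      forall x, 0 <= x -> mxintegrable (Il x) (E x) &
      forall i j x0 t0 eps, 0 <= x0 -> 0 <= t0 -> 0 < eps -> exists2 d, 0 < d &
        forall x t, 0 <= x -> 0 <= t -> `|x - x0| < d -> `|t - t0| < d ->
        cnorm1 (E x t i j - E x0 t0 i j) <= eps].
Proof.
have [g Hg] := section_solution.
pose G x t : 'M[C]_m := \matrix_(i, k) g k x t i 0.
have iG x : 0 <= x -> mxintegrable (Il x) (G x).
  move=> x0 i k; have [gb _] := Hg k x x0.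
  have := bfun_integrable (lexx x) (gb _ (lexx x)) i 0.
  by congr cintegrable; apply/funext => u; rewrite mxE.
have Geq x t : 0 <= x -> 0 <= t -> G x t = s t x + Op (Il x) s (G x) t.
  move=> x0 t0; apply/matrixP => i k; rewrite mxE (proj2 (Hg k x x0) t t0).
  rewrite [LHS]mxE [RHS]mxE; congr (_ + _); first by rewrite mxE.
  rewrite [LHS]mxE [RHS]mxE; apply: eq_cintegral => u _.
  by rewrite !mxE; apply: eq_bigr => j _; rewrite mxE.
(* Conjugate transposition turns G = s + s G into E = s + E s, because s is Hermitian. *)
exists (fun x t => (G x t) ^t*); split.
- move=> x t x0 t0; rewrite {1}(Geq x t x0 t0) adjmxD s_herm; congr (_ + _).
  rewrite /Op -mxintegral_adj//; last by apply: s_integrand => //; exact: iG.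
  by apply: eq_mxintegral => u _; rewrite adjmxM s_herm.
- by move=> x x0; apply: mxintegrable_adj => //; exact: iG.
- move=> i j x0 t0 eps x00 t00 eps0.
  have [d d0 Hd] := section_solution_continuous Hg i x00 t00 eps0.
  exists d => // x t x_ge0 t_ge0 xd td.
  apply: le_trans (Hd x t x_ge0 t_ge0 xd td).
  have := cnorm1_le_mxnorm (g i x t - g i x0 t0) j 0.
  rewrite -cnorm1_conj; congr (cnorm1 _ <= _).
  by rewrite !mxE -rmorphB.
Qed.

End SectionEquation.

(** * Continuity of translations *)

Section RealShift.
Context {R : realType}.
Local Notation mu := (@lebesgue_measure R).
Local Notation TR := (measurableTypeR R).

Lemma measurable_subl (x : R) : measurable_fun [set: TR] (fun z : TR => (x - z : TR)).
Proof.
apply: continuous_measurable_fun => z.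
by apply: cvgB; [exact: cvg_cst|exact: cvg_id].
Qed.

Lemma preimage_subl (x a b : R) :
  (fun z : TR => (x - z : TR)) @^-1` `[a, b] = (`[x - b, x - a]%classic : set TR).
Proof.
apply/seteqP; split => z.
  move=> /itvccP/andP[h1 h2]; apply/itvccP.
  by rewrite lerBlDr addrC -lerBlDr h2 lerBrDr addrC -lerBrDr.
move=> /itvccP/andP[h1 h2]; apply/itvccP.
by rewrite lerBrDr addrC -lerBrDr h2 lerBlDr addrC -lerBlDr.
Qed.

Lemma preimage_subl_oc (x a b : R) :
  (fun z : TR => (x - z : TR)) @^-1` `]a, b] = (`[x - b, x - a[%classic : set TR).
Proof.
apply/seteqP; split => z; rewrite /= !in_itv/= => /andP[h1 h2].
  by rewrite lerBlDr addrC -lerBlDr h2 ltrBrDr addrC -ltrBrDr.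
by rewrite ltrBrDr addrC -ltrBrDr h2 lerBlDr addrC -lerBlDr.
Qed.

(** Lebesgue measure is determined by its values on half-open intervals. The reflection changes
    which end is closed but not the length. *)
Lemma lebesgue_measure_subl (x : R) (A : set TR) : measurable A ->
  pushforward mu (fun z : TR => (x - z : TR)) A = mu A.
Proof.
move=> mA; apply/esym.
have mf := measurable_subl x.
have := @lebesgue_measure_unique R (pushforward mu (fun z : TR => (x - z : TR))).
apply => // _ [[a b]] _ <-.
transitivity (mu (`[x - b, x - a[%classic : set TR)); last by rewrite -preimage_subl_oc.
rewrite !lebesgue_measure_itv/= !lte_fin ltrD2l ltrN2.
by case: ifP => // _; rewrite -!EFinD opprD opprK addrACA subrr add0r addrC.
Qed.

Lemma ge0_Rintegral_subl_le (phi : TR -> R) (x a b c d : R) :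
  measurable_fun [set: TR] phi -> (forall y, 0 <= phi y) ->
  mu.-integrable `[c, d] (EFin \o phi) -> c <= x - b -> x - a <= d ->
  mu.-integrable `[a, b] (EFin \o (fun z => phi (x - z))) /\
  \int[mu]_(z in `[a, b]) phi (x - z) <= \int[mu]_(y in `[c, d]) phi y.
Proof.
move=> mphi phi0 iphi cx xd.
have mf := measurable_subl x.
have E : (\int[mu]_(z in `[a, b]) (phi (x - z)%R)%:E =
          \int[mu]_(y in `[(x - b)%R, (x - a)%R]) (phi y)%:E)%E.
  have -> : (`[a, b]%classic : set TR) =
      (fun z : TR => (x - z : TR)) @^-1` `[x - b, x - a].
    by rewrite preimage_subl !subKr.
  rewrite -(ge0_integral_pushforward mf mu (f := EFin \o phi)) //.
  - by apply: eq_measure_integral => A mA _; exact: lebesgue_measure_subl.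
  - by apply/measurable_EFinP; exact: measurable_funTS.
  - by move=> y _; rewrite lee_fin.
have sub : (`[x - b, x - a]%classic : set TR) `<=` `[c, d]%classic.
  move=> y /itvccP/andP[h1 h2]; apply/itvccP.
  by rewrite (le_trans cx h1) (le_trans h2 xd).
have isub : mu.-integrable `[x - b, x - a] (EFin \o phi) by apply: integrableS iphi.
have iab : mu.-integrable `[a, b] (EFin \o (fun z => phi (x - z))).
  apply/integrableP; split.
    apply/measurable_EFinP; apply: measurable_funTS.
    exact: (measurableT_comp mphi mf).
  under eq_integral do rewrite gee0_abs ?lee_fin//.
  rewrite E; case/integrableP : isub => _; apply: le_lt_trans.
  by apply: ge0_le_integral => //= [y _|||y _]; rewrite ?lee_fin ?ler_norm//;
    apply/measurable_EFinP; [|apply: measurableT_comp => //]; exact: measurable_funTS.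
split => //.
rewrite /Rintegral E -/(Rintegral mu _ phi).
exact: le_Rintegral_subset.
Qed.

(* The L^1 modulus of continuity of translations, by approximation in L^1 by
   continuous functions. *)
Lemma translation_continuous (rho : TR -> R) (X x0 eps : R) :
  measurable_fun [set: TR] rho ->
  (forall Y, exists M, forall x, x <= Y -> `|rho x| <= M) -> 0 <= X -> 0 < eps ->
  exists2 d, 0 < d & forall x, `|x - x0| < d ->
    mu.-integrable `[0, X] (EFin \o (fun z => `|rho (x - z) - rho (x0 - z)|)) /\
    \int[mu]_(z in `[0, X]) `|rho (x - z) - rho (x0 - z)| <= eps.
Proof.
move=> mrho brho X0 eps0.
(* This window contains x - z whenever |x - x0| < 1 and 0 <= z <= X, so one approximation of [rho]
   on it serves all nearby translates. *)
pose c := x0 - 1 - X; pose d := x0 + 1.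
have fE a b : (mu (`[a, b]%classic : set TR) < +oo)%E.
  by rewrite lebesgue_measure_itv/=; case: ifP => _; exact: ltry.
have mI a b : measurable (`[a, b]%classic : set TR) by exact: measurable_itv.
have irho : mu.-integrable `[c, d] (EFin \o rho).
  have [M HM] := brho d.
  apply: (le_integrable_EFin _ _ (integrable_cst_fin M _ (fE c d))) => //.
    exact: measurable_funTS.
  by move=> y /itvccP/andP[_ yd]; exact: HM.
have [g_ [gc gi]] := approximation_continuous_integrable
  (mI c d) (fE c d) irho.
have e30 : 0 < eps / 3 by rewrite divr_gt0.
move=> /fine_cvgP[gfin] /cvgrPdist_lt/(_ _ e30) gcvg.
have [n [fin_n]] : exists n, (\int[mu]_(z in `[c, d]) `|(rho z - g_ n z)%:E| \is a fin_num)%E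
    /\ \int[mu]_(z in `[c, d]) `|rho z - g_ n z| < eps / 3.
  near \oo => n; exists n; split; first by near: n.
  have : `|0 - fine (\int[mu]_(z in `[c, d]) `|(rho z - g_ n z)%:E|)%E| < eps / 3 by near: n.
  by rewrite sub0r normrN; apply: le_lt_trans; exact: ler_norm.
set g := g_ n => Hg.
have cg : continuous g := gc n.
have mg : measurable_fun [set: TR] g by exact: continuous_measurable_fun.
pose phi y := `|rho y - g y|.
have mphi : measurable_fun [set: TR] phi.
  by apply: measurableT_comp => //; exact: measurable_funB.
have iphi : mu.-integrable `[c, d] (EFin \o phi).
  apply: (@integrable_norm _ _ _ _ _ (fun y => rho y - g y)).
  have := integrableB (mI c d) irho (gi n).
  by [].
have shift x : `|x - x0| < 1 ->
    mu.-integrable `[0, X] (EFin \o (fun z => phi (x - z))) /\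
    \int[mu]_(z in `[0, X]) phi (x - z) <= eps / 3.
  rewrite ltr_distl => /andP[x1 x2].
  have [||I1 I2] := @ge0_Rintegral_subl_le phi x 0 X c d mphi (fun=> normr_ge0 _) iphi.
  - by rewrite /c lerD2r ltW.
  - by rewrite subr0 ltW.
  by split => //; rewrite (le_trans I2)// ltW.
have [K HK] : exists K, forall y, y \in `[c, d] -> `|g y| <= K.
  have /compact_bounded[K [_ HK]] : compact (g @` `[c, d]).
    apply: continuous_compact; last exact: segment_compact.
    exact: continuous_subspaceT.
  exists (K + 1) => y ycd; apply: (HK (K + 1)); first by rewrite ltrDl.
  by exists y.
pose f x z := `|g (x - z) - g (x0 - z)|.
have mgx x : measurable_fun [set: TR] (fun z => g (x - z)).
  exact: (measurableT_comp mg (measurable_subl x)).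
have fK x z : `|x - x0| < 1 -> 0 <= z <= X -> f x z <= K + K.
  rewrite ltr_distl => /andP[x1 x2] /andP[z0 zX].
  have xz : x - z \in `[c, d] by rewrite in_itv/= /c /d; lra.
  have x0z : x0 - z \in `[c, d] by rewrite in_itv/= /c /d; lra.
  by rewrite (le_trans (ler_normB _ _))// lerD ?HK.
have iK : mu.-integrable `[0, X] (EFin \o (fun=> K + K)).
  exact: (integrable_cst_fin _ (mI 0 X) (fE 0 X)).
have if_ x : `|x - x0| < 1 -> mu.-integrable `[0, X] (EFin \o f x).
  move=> xx0; apply: (le_integrable_EFin _ _ iK) => //.
    apply: measurable_funTS; apply: measurableT_comp => //.
    exact: measurable_funB.
  by move=> z /itvccP zX; rewrite normr_id; exact: fK.
(* For the continuous g the difference of translates tends to 0 pointwise and is bounded by the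
   constant K + K, so dominated convergence handles the middle term. *)
have cont : {for x0, continuous (fun x => \int[mu]_(z in `[0, X]) f x z)}.
  have := @continuity_under_integral R _ _ mu f `[0, X]%classic _ (x0 - 1) (x0 + 1) _ _
    (fun=> K + K) iK _.
  apply => //.
  - by move=> x; rewrite /= in_itv/= -ltr_distl; exact: if_.
  - apply: aeW => z _ x _.
    apply: cvg_norm; apply: cvgB; last exact: cvg_cst.
    apply: (@continuous_comp _ _ _ (fun x : R => x - z) g); last exact: cg.
    by apply: cvgB; [exact: cvg_id|exact: cvg_cst].
  - move=> x; rewrite /= in_itv/= -ltr_distl => xx0; apply: aeW => z /itvccP zX.
    by rewrite normr_id; exact: fK.
  - by rewrite inE/= in_itv/=; apply/andP; split; lra.
have f0 : \int[mu]_(z in `[0, X]) f x0 z = 0.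
  rewrite (@eq_Rintegral _ _ _ _ _ (fun=> 0)) ?Rintegral_cst ?mul0r//.
  by move=> z _; rewrite /f subrr normr0.
move: cont => /cvgrPdist_lt/(_ _ e30); rewrite f0 => /nbhs_ballP[e /= e0 He].
exists (Num.min e 1); first by rewrite lt_min e0 ltr01.
move=> x; rewrite lt_min => /andP[xe x1].
have [i1 I1] := shift x x1.
have [i2 I2] : mu.-integrable `[0, X] (EFin \o (fun z => phi (x0 - z))) /\
    \int[mu]_(z in `[0, X]) phi (x0 - z) <= eps / 3.
  by apply: shift; rewrite subrr normr0.
have i3 := if_ x x1.
have I3 : \int[mu]_(z in `[0, X]) f x z <= eps / 3.
  have := He x; rewrite /ball/= distrC => /(_ xe).
  by rewrite sub0r normrN => /(le_lt_trans (ler_norm _))/ltW.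
have bound z : `|rho (x - z) - rho (x0 - z)| <= phi (x - z) + f x z + phi (x0 - z).
  rewrite /phi /f (distrC (rho (x0 - z))).
  rewrite (_ : rho (x - z) - rho (x0 - z) =
    (rho (x - z) - g (x - z)) + (g (x - z) - g (x0 - z)) + (g (x0 - z) - rho (x0 - z))).
    by rewrite (le_trans (ler_normD _ _))// lerD2r ler_normD.
  by rewrite !addrA !subrK.
have i13 := integrableD_EFin (mI 0 X) i1 i3.
have i132 := integrableD_EFin (mI 0 X) i13 i2.
have iD : mu.-integrable `[0, X] (EFin \o (fun z => `|rho (x - z) - rho (x0 - z)|)).
  apply: (le_integrable_EFin _ _ i132) => //.
    apply: measurable_funTS; apply: measurableT_comp => //.
    by apply: measurable_funB; exact: (measurableT_comp mrho (measurable_subl _)).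
  by move=> z _; rewrite normr_id.
split => //.
apply: le_trans (le_Rintegral _ iD i132 _) _ => //.
rewrite RintegralD// RintegralD//; lra.
Unshelve. all: by end_near. Qed.

End RealShift.

(** * The kernel of S *)

Section HalflineDerivative.
Context {R : realType}.
Local Notation mu := (@lebesgue_measure R).
Local Notation TR := (measurableTypeR R).
Implicit Types (g : R -> R) (x : R).

Lemma halfline_derivable_continuous g x eps : 0 <= x -> halfline_derivable g x ->
  0 < eps -> exists2 d, 0 < d & forall y, 0 <= y -> `|y - x| < d ->
  `|g y - g x| <= eps.
Proof.
move=> x0 /cvgrPdist_lt/(_ _ ltr01) H eps0.
set L := lim _ in H.
move: H; rewrite /halfline_incr near_withinE near_withinE => /nbhs_ballP[e /= e0 He].
have P0 : 0 < `|L| + 1 by rewrite ltr_wpDl.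
(* Within distance e the difference quotient is within 1 of L, which gives a Lipschitz bound at x
   with constant |L| + 1. *)
exists (Num.min e (eps / (`|L| + 1))); first by rewrite lt_min e0 divr_gt0.
move=> y y0; rewrite lt_min => /andP[ye yeps].
have [->|yx] := eqVneq y x; first by rewrite subrr normr0 ltW.
have h0 : y - x != 0 by rewrite subr_eq0.
have := He (y - x); rewrite /ball/= sub0r normrN => /(_ ye h0).
rewrite addrC subrK => /(_ y0) /ltW Hq.
have -> : g y - g x = (y - x) * ((y - x)^-1 * (g y - g x)) by rewrite mulVKf.
rewrite normrM (@le_trans _ _ (`|y - x| * (`|L| + 1)))//; last first.
  by rewrite -ler_pdivlMr// ltW.
rewrite ler_wpM2l// (le_trans _ (_ : `|L| + `|L - (y - x)^-1 * (g y - g x)| <= _)) ?lerD2l//.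
set q := _^-1 * _.
by rewrite -[X in `|X| <= _](subKr L) (le_trans (ler_normB _ _)).
Qed.

(** The increments 1/(n+1) are positive, hence admissible also at x = 0, where the derivative is
    one-sided. A sequential limit is what measurability of the derivative calls for. *)
Lemma halfline_derive_seq g x : 0 <= x -> halfline_derivable g x ->
  (fun n : nat => n.+1%:R * (g (x + n.+1%:R^-1) - g x)) @ \oo --> halfline_derive g x.
Proof.
move=> x0 dg; rewrite /halfline_derive.
have h_cvg : (fun n : nat => n.+1%:R^-1 : R) @ \oo --> halfline_incr x.
  move=> A; rewrite /halfline_incr /within /dnbhs /= => /nbhs_ballP[e /= e0 He].
  have [N _ HN] := near_infty_natSinv_lt (PosNum e0).
  exists N => // n /= Nn; apply: He => /=.
  - by rewrite /ball/= sub0r normrN ger0_norm ?invr_ge0//; exact: (HN n Nn).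
  - by rewrite invr_eq0 pnatr_eq0.
  - by rewrite addr_ge0// invr_ge0.
have := cvg_comp _ _ h_cvg dg.
apply: cvg_trans; apply: near_eq_cvg; near=> n.
by rewrite /= invrK.
Unshelve. all: by end_near. Qed.

(** Once g is frozen at g(0) for negative arguments, its difference quotients with increments
    1/(n+1) are continuous in x, and the derivative is their pointwise limit. *)
Lemma halfline_derive_measurable g : (forall x, 0 <= x -> halfline_derivable g x) ->
  measurable_fun [set: TR] (fun x : TR => if 0 <= (x : R) then halfline_derive g x else 0).
Proof.
move=> dg; pose g' y := g (Num.max y 0).
have cg' : continuous g'.
  move=> x; apply/cvgrPdist_le => eps eps0.
  have m0 y : 0 <= Num.max y 0 :> R by rewrite le_max lexx orbT.
  have [d d0 Hd] := halfline_derivable_continuous (m0 x) (dg _ (m0 x)) eps0.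
  apply/nbhs_ballP; exists d => //= y; rewrite /ball/= distrC => yx.
  rewrite distrC; apply: Hd => //; apply: le_lt_trans yx.
  have [x0|x0] := leP x 0; have [y0|y0] := leP y 0.
  - by rewrite subrr normr0.
  - by rewrite subr0 gtr0_norm// (le_trans _ (ler_norm _))// lerDl oppr_ge0.
  - by rewrite sub0r normrN gtr0_norm// distrC (le_trans _ (ler_norm _))// lerDl oppr_ge0.
  - by [].
have mg' : measurable_fun [set: TR] g' by exact: continuous_measurable_fun.
pose q n y := n.+1%:R * (g' (y + n.+1%:R^-1) - g' y).
apply: (@measurable_fun_cvg _ _ _ _ (fun n (x : TR) => if 0 <= (x : R) then q n x else 0)).
  move=> n; apply: measurable_fun_ifT => //; first exact: measurable_fun_ler.
  apply: measurable_funM => //; apply: measurable_funB => //.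
  apply: (measurableT_comp mg'); apply: continuous_measurable_fun => y.
  by apply: cvgD; [exact: cvg_id|exact: cvg_cst].
move=> x _; case: (leP 0 (x : R)) => [x0|_]; last exact: cvg_cst.
have := halfline_derive_seq x0 (dg x x0).
apply: cvg_trans; apply: near_eq_cvg; near=> n.
by rewrite /q /g' !max_l// addr_ge0// invr_ge0.
Unshelve. all: by end_near. Qed.

Section DerivativeKernel.
Context {m1 m2 : nat} (Phi : R -> 'M[R[i]]_(m2, m1)).
Hypothesis Phi_bd : forall l : R, 0 < l -> boundedly_differentiable Phi l.
Hypothesis Phi0 : Phi 0 = 0.

(** Extension by zero removes the variable upper limit: r(x - z) vanishes for z > x, so all values
    s(x, t) with x, t <= X are integrals over the same [0, X] and can be subtracted under the
    integral sign. Negative x and t are covered as well. *)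
Let r (x : R) : 'M[R[i]]_(m2, m1) := if 0 <= x then mxderive Phi x else 0.

Let r_meas : mxmeasurable [set: TR] r.
Proof.
have dPhi : forall x, 0 <= x -> mxderivable Phi x.
  move=> x x0; have x10 : 0 < x + 1 by rewrite ltr_wpDl.
  by apply: (Phi_bd x10).1; rewrite x0 lerDl ler01.
move=> i j; split.
  have dij x : 0 <= x -> halfline_derivable (fun y => complex.Re (Phi y i j)) x.
    by move=> /dPhi/(_ i j)[].
  have := halfline_derive_measurable dij.
  apply: eq_measurable_fun; by move=> x _; rewrite /r; case: ifP => _; rewrite mxE.
have dij x : 0 <= x -> halfline_derivable (fun y => complex.Im (Phi y i j)) x.
    by move=> /dPhi/(_ i j)[].
  have := halfline_derive_measurable dij.
apply: eq_measurable_fun; by move=> x _; rewrite /r; case: ifP => _; rewrite mxE.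
Qed.

Let r_bounded Y : exists2 M, 0 <= M & forall x, x <= Y -> mxnorm (r x) <= M.
Proof.
have Y0 : 0 < `|Y| + 1 by rewrite ltr_wpDl.
have [_ [M HM]] := Phi_bd Y0.
have cn (z : R[i]) : `|z| <= M%:C -> cnorm1 z <= M + M.
  rewrite normc_def lecR => zM; rewrite /cnorm1.
  have h (a b : R) : `|a| <= Num.sqrt (a ^+ 2 + b ^+ 2).
    by rewrite -sqrtr_sqr ler_wsqrtr// lerDl sqr_ge0.
  rewrite lerD// (le_trans _ zM)//.
  by rewrite addrC h.
have M0 : 0 <= `|M| by [].
exists (\sum_(i < m2) \sum_(j < m1) (`|M| + `|M|)).
  by apply: sumr_ge0 => i _; apply: sumr_ge0 => j _; rewrite addr_ge0.
move=> x xY; apply: ler_sum => i _; apply: ler_sum => j _; rewrite /r.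
case: ifP => x0; last by rewrite mxE cnorm1_0 addr_ge0.
rewrite (le_trans (cn _ (HM x _ i j)))//; last by rewrite lerD ?ler_norm.
by rewrite x0 (le_trans xY)// (le_trans (ler_norm _))// lerDl.
Qed.

Let J (X : R) : set TR := `[0, X]%classic.

Let mJ X : measurable (J X).
Proof. exact: measurable_itv. Qed.

Let fJ X : (mu (J X) < +oo)%E.
Proof. by rewrite /J lebesgue_measure_itv/=; case: ifP => _; exact: ltry. Qed.

Let r_sub_meas x (D : set TR) : measurable D -> mxmeasurable D (fun z : TR => r (x - z)).
Proof.
move=> mD; apply: (mxmeasurable_comp (h := fun z : TR => (x - z : TR)) _ _ r_meas) => //.
by apply: measurable_funTS; exact: measurable_subl.
Qed.

Let subl_le (y z X : R) : 0 <= z -> y <= X -> y - z <= X.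
Proof. by move=> z0 yX; rewrite lerBlDr (le_trans yX)// lerDl. Qed.

Lemma s_kernelE X x t : x <= X -> t <= X -> s_kernel Phi x t =
  mxintegral (J X) (fun z => r (x - z) *m (r (t - z)) ^t*).
Proof.
move=> xX tX; rewrite /s_kernel Phi0; set T := (if t < x then _ else _).
have -> : T = 0.
  rewrite /T; case: ifP => _; first by rewrite adjmx0 mulmx0.
  by case: ifP => _; rewrite ?mul0mx.
rewrite addr0 (mxintegral_mkcond (D := J X) _ (b := fun z : R => z <= Num.min x t)).
- apply: eq_mxintegral => z /itvccP/andP[z0 zX]; rewrite le_min /r !subr_ge0.
  by case: ifP => [/andP[-> ->]//|]; case: ifP => //= _; case: ifP => // _ _;
    rewrite ?adjmx0 ?mulmx0 ?mul0mx.
- move=> z /itvccP/andP[z0 zm]; apply/itvccP; rewrite z0 (le_trans zm)// ge_min xX//.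
- move=> z /itvccP/andP[z0 zX]; split; last by move=> /itvccP/andP[].
  by move=> zm; apply/itvccP; rewrite z0.
Qed.

Lemma s_kernel_integrable X x t : x <= X -> t <= X ->
  mxintegrable (J X) (fun z => r (x - z) *m (r (t - z)) ^t*).
Proof.
move=> xX tX; have [M M0 HM] := r_bounded X.
apply: (le_mxintegrable (mJ X) _ (integrable_cst (mJ X) (@fJ X) (M * M))).
  apply: mxmeasurableM; first exact: r_sub_meas.
  by apply: mxmeasurable_adj; exact: r_sub_meas.
move=> z /itvccP/andP[z0 zX]; rewrite (le_trans (mxnormM _ _))// mxnorm_adj.
by rewrite ler_pM ?mxnorm_ge0 ?HM ?subl_le.
Qed.

Lemma s_kernel_herm x t : (s_kernel Phi t x) ^t* = s_kernel Phi x t.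
Proof.
have xX : x <= Num.max x t by rewrite le_max lexx.
have tX : t <= Num.max x t by rewrite le_max lexx orbT.
rewrite (s_kernelE xX tX) (s_kernelE tX xX) -mxintegral_adj//.
  by apply: eq_mxintegral => z _; rewrite adjmxM trmxCK.
exact: s_kernel_integrable.
Qed.

Lemma s_kernel_bounded X : exists2 c, 0 <= c &
  forall x t, x <= X -> t <= X -> mxnorm (s_kernel Phi x t) <= c.
Proof.
have [M M0 HM] := r_bounded X.
exists (\int[mu]_(z in J X) (M * M)).
  by apply: Rintegral_ge0 => z _; exact: mulr_ge0.
move=> x t xX tX; rewrite (s_kernelE xX tX).
apply: le_mxnorm_mxintegral => //.
- exact/mxintegrable_measurable/s_kernel_integrable.
- exact: integrable_cst.
- move=> z /itvccP/andP[z0 zX]; rewrite (le_trans (mxnormM _ _))// mxnorm_adj.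
  by rewrite ler_pM ?mxnorm_ge0 ?HM ?subl_le.
Qed.

Let r_translation (X x0 eps : R) : 0 <= X -> 0 < eps -> exists2 d, 0 < d &
  forall x, `|x - x0| < d ->
  mu.-integrable (J X) (EFin \o (fun z => mxnorm (r (x - z) - r (x0 - z)))) /\
  \int[mu]_(z in J X) mxnorm (r (x - z) - r (x0 - z)) <= eps.
Proof.
move=> X0 eps0.
have tr (f : 'M[R[i]]_(m2, m1) -> R) e : (forall A B, f (A - B) = f A - f B) ->
    measurable_fun [set: TR] (f \o r) -> (forall A, `|f A| <= mxnorm A) -> 0 < e ->
    exists2 d, 0 < d & forall x, `|x - x0| < d ->
    mu.-integrable (J X) (EFin \o (fun z => `|f (r (x - z) - r (x0 - z))|)) /\
    \int[mu]_(z in J X) `|f (r (x - z) - r (x0 - z))| <= e.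
  move=> fB mf fn e0.
  have brho Y : exists M, forall x, x <= Y -> `|(f \o r) x| <= M.
    by have [M _ HM] := r_bounded Y; exists M => x xY; rewrite (le_trans (fn _))// HM.
  have [d d0 Hd] := translation_continuous x0 mf brho X0 e0.
  exists d => // x /Hd.
  have -> // : (fun z : TR => `|f (r (x - z) - r (x0 - z))|) =
    (fun z : TR => `|(f \o r) (x - z) - (f \o r) (x0 - z)|).
  by apply/funext => z; rewrite /= fB.
(* There are [m2 * m1] entries, each contributing at most ee + ee; the added 1 keeps the denominator
   positive. *)
pose ee := eps / ((m2 * m1)%:R * 2 + 1).
have ee0 : 0 < ee by rewrite divr_gt0// ltr_wpDl.
have entry i j : exists2 d, 0 < d & forall x, `|x - x0| < d ->
    mu.-integrable (J X) (EFin \o (fun z => cnorm1 ((r (x - z) - r (x0 - z)) i j))) /\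
    \int[mu]_(z in J X) cnorm1 ((r (x - z) - r (x0 - z)) i j) <= ee + ee.
  have [|||d1 d10 H1] := tr (fun A => complex.Re (A i j)) ee _ _ _ ee0.
  - by move=> A B; rewrite !mxE; case: (A i j) (B i j) => a b [].
  - exact: (r_meas i j).1.
  - by move=> A; rewrite (le_trans _ (cnorm1_le_mxnorm A i j))// lerDl.
  have [|||d2 d20 H2] := tr (fun A => complex.Im (A i j)) ee _ _ _ ee0.
  - by move=> A B; rewrite !mxE; case: (A i j) (B i j) => a b [].
  - exact: (r_meas i j).2.
  - by move=> A; rewrite (le_trans _ (cnorm1_le_mxnorm A i j))// lerDr.
  exists (Num.min d1 d2); first by rewrite lt_min d10.
  move=> x; rewrite lt_min => /andP[/H1[i1 I1] /H2[i2 I2]]; split.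
    exact: integrableD_EFin.
  by rewrite RintegralD// lerD.
have /choice[dd Hdd] : forall ij : 'I_m2 * 'I_m1, exists d, 0 < d /\
    forall x, `|x - x0| < d ->
    mu.-integrable (J X) (EFin \o (fun z => cnorm1 ((r (x - z) - r (x0 - z)) ij.1 ij.2))) /\
    \int[mu]_(z in J X) cnorm1 ((r (x - z) - r (x0 - z)) ij.1 ij.2) <= ee + ee.
  by move=> [i j]; have [d d0 Hd] := entry i j; exists d.
exists (\big[Num.min/1]_ij dd ij).
  by elim/big_ind: _ => // [a b a0 b0|ij _]; [rewrite lt_min a0|exact: (Hdd ij).1].
move=> x xd.
have Hx i j : mu.-integrable (J X) (EFin \o (fun z => cnorm1 ((r (x - z) - r (x0 - z)) i j))) /\
    \int[mu]_(z in J X) cnorm1 ((r (x - z) - r (x0 - z)) i j) <= ee + ee.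
  apply: (Hdd (i, j)).2; apply: lt_le_trans xd _.
  by rewrite (bigD1 (i, j))//= ge_min lexx.
split; rewrite /mxnorm.
  apply: (Rintegral_sum _ _ _).1 => // i; apply: (Rintegral_sum _ _ _).1 => // j.
  exact: (Hx i j).1.
rewrite (Rintegral_sum _ _ _).2//; last first.
  by move=> i; apply: (Rintegral_sum _ _ _).1 => // j; exact: (Hx i j).1.
rewrite (@le_trans _ _ (\sum_(i < m2) \sum_(j < m1) (ee + ee)))//.
  apply: ler_sum => i _; rewrite (Rintegral_sum _ _ _).2//; last first.
    by move=> j; exact: (Hx i j).1.
  by apply: ler_sum => j _; exact: (Hx i j).2.
rewrite !sumr_const !card_ord -mulrnA mulnC -mulr2n -mulrnA -mulr_natr natrM.
have : ee * ((m2 * m1)%:R * 2 + 1) = eps by rewrite divfK// lt0r_neq0// ltr_wpDl.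
by rewrite natrM; lra.
Qed.

(** The difference s(x, t) - s(x0, t) integrates r(x - z) - r(x0 - z) against a factor bounded by M.
    The L^1 modulus of continuity of the translates of r thus bounds it uniformly in t. *)
Lemma s_kernel_equicont (X x0 eps : R) : 0 < eps -> exists2 d, 0 < d &
  forall x t, x <= X -> x0 <= X -> t <= X -> `|x - x0| < d ->
  mxnorm (s_kernel Phi x t - s_kernel Phi x0 t) <= eps.
Proof.
move=> eps0.
have [X0|X0] := leP 0 X; last first.
  exists 1 => // x t xX x0X tX _.
  rewrite (s_kernelE xX tX) (s_kernelE x0X tX).
  have -> : J X = set0.
    apply/seteqP; split => // z /itvccP/andP[z0 zX].
    by have := lt_le_trans X0 (le_trans z0 zX); rewrite ltxx.
  suff E (F : TR -> 'M[R[i]]_m2) : mxintegral set0 F = 0 by rewrite !E subrr mxnorm0 ltW.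
  by apply/matrixP => i j; rewrite !mxE /cintegral !Rintegral_set0.
have [M M0 HM] := r_bounded X.
have e0 : 0 < eps / (M + 1) by rewrite divr_gt0// ltr_wpDl.
have [d d0 Hd] := r_translation x0 X0 e0.
exists d => // x t xX x0X tX /Hd[i1 I1].
rewrite (s_kernelE xX tX) (s_kernelE x0X tX).
rewrite -mxintegralN//; last exact: s_kernel_integrable.
rewrite -mxintegralD//; [|exact: s_kernel_integrable|
  by apply: mxintegrableN => //; exact: s_kernel_integrable].
rewrite (eq_mxintegral (G := fun z => (r (x - z) - r (x0 - z)) *m (r (t - z)) ^t*)); last first.
  by move=> z _; rewrite mulmxBl.
apply: (@le_trans _ _ (\int[mu]_(z in J X) (M * mxnorm (r (x - z) - r (x0 - z))))).
  apply: le_mxnorm_mxintegral => //.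
  - apply: mxmeasurableM; last by apply: mxmeasurable_adj; exact: r_sub_meas.
    by apply: mxmeasurableD; [|apply: mxmeasurableN]; exact: r_sub_meas.
  - exact: integrableZl_EFin.
  - move=> z /itvccP/andP[z0 zX]; rewrite (le_trans (mxnormM _ _))// mxnorm_adj mulrC.
    by rewrite ler_wpM2r ?mxnorm_ge0// HM// subl_le.
rewrite RintegralZl// (le_trans (ler_wpM2l M0 I1))//.
by rewrite mulrA ler_pdivrMr ?ltr_wpDl// mulrC ler_wpM2l ?(ltW eps0)// lerDl.
Qed.

End DerivativeKernel.

End HalflineDerivative.

(** * Volterra operators with continuous kernels *)

Section ContinuousKernels.
Context {R : realType}.
Local Notation C := R[i].
Local Notation mu := (@lebesgue_measure R).
Local Notation TR := (measurableTypeR R).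

(** Continuity is required on the whole plane; kernels that are continuous only on a triangle or a
    quadrant are first extended by clamping their arguments. *)
Definition kcontinuous m n (F : R -> R -> 'M[C]_(m, n)) := forall i j,
  continuous (fun p : R * R => complex.Re (F p.1 p.2 i j)) /\
  continuous (fun p : R * R => complex.Im (F p.1 p.2 i j)).

Lemma kcontinuous_eps m n (F : R -> R -> 'M[C]_(m, n)) :
  (forall i j x0 t0 eps, 0 < eps -> exists2 d, 0 < d & forall x t,
    `|x - x0| < d -> `|t - t0| < d -> cnorm1 (F x t i j - F x0 t0 i j) <= eps) ->
  kcontinuous F.
Proof.
move=> H i j; split => -[x0 t0]; apply/cvgrPdist_le => eps eps0.
  have [d d0 Hd] := H i j x0 t0 eps eps0.
  apply: (nbhs_ballP (x0, t0) _).2; exists d => //= -[x t] []; rewrite /ball/= => xd td.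
  rewrite distrC in xd; rewrite distrC in td; rewrite distrC.
  apply: le_trans (Hd x t xd td); rewrite /cnorm1.
  by case: (F x t i j) (F x0 t0 i j) => a b [a' b'] /=; rewrite lerDl.
have [d d0 Hd] := H i j x0 t0 eps eps0.
apply: (nbhs_ballP (x0, t0) _).2; exists d => //= -[x t] []; rewrite /ball/= => xd td.
rewrite distrC in xd; rewrite distrC in td; rewrite distrC.
apply: le_trans (Hd x t xd td); rewrite /cnorm1.
by case: (F x t i j) (F x0 t0 i j) => a b [a' b'] /=; rewrite lerDr.
Qed.

Lemma kcontinuous_measurable m n (F : R -> R -> 'M[C]_(m, n)) : kcontinuous F ->
  mxmeasurable [set: TR * TR] (fun p => F p.1 p.2).
Proof. by move=> cF i j; split; apply: continuous_measurable_fun2; have [] := cF i j. Qed.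

Lemma continuous_bounded_square (f : R * R -> R) (a b : R) : continuous f ->
  exists M, forall x t, a <= x <= b -> a <= t <= b -> `|f (x, t)| <= M.
Proof.
move=> cf.
have /compact_bounded[M [_ HM]] : compact (f @` (`[a, b] `*` `[a, b])).
  apply: continuous_compact; first exact: continuous_subspaceT.
  by apply: compact_setX; exact: segment_compact.
exists (M + 1) => x t xab tab; apply: (HM (M + 1)); first by rewrite ltrDl.
by exists (x, t).
Qed.

Lemma kcontinuous_bounded m n (F : R -> R -> 'M[C]_(m, n)) (a b : R) :
  kcontinuous F -> exists2 M, 0 <= M & forall x t, a <= x <= b -> a <= t <= b ->
  mxnorm (F x t) <= M.
Proof.
move=> cF.
have H (ij : 'I_m * 'I_n) : exists M, 0 <= M /\ forall x t, a <= x <= b -> a <= t <= b ->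
    cnorm1 (F x t ij.1 ij.2) <= M.
  have [c1 c2] := cF ij.1 ij.2.
  have [M1 H1] := continuous_bounded_square a b c1.
  have [M2 H2] := continuous_bounded_square a b c2.
  exists (`|M1| + `|M2|); split; first by rewrite addr_ge0.
  move=> x t xab tab; rewrite /cnorm1 lerD//.
    by rewrite (le_trans (H1 x t xab tab))// ler_norm.
  by rewrite (le_trans (H2 x t xab tab))// ler_norm.
have [M HM] := choice H.
exists (\sum_i \sum_j M (i, j)).
  by apply: sumr_ge0 => i _; apply: sumr_ge0 => j _; exact: (HM (i, j)).1.
move=> x t xab tab; apply: ler_sum => i _; apply: ler_sum => j _.
exact: (HM (i, j)).2.
Qed.

Lemma bker_lower l n (F : R -> R -> 'M[C]_n) : kcontinuous F ->
  bker (Il l) (fun x t => if (t : R) < x then F x t else 0).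
Proof.
move=> cF; split.
  apply: mxmeasurable_if.
  - by apply: measurableX; exact: measurable_Il.
  - apply: measurable_funTS.
    by apply: measurable_fun_ltr; [exact: measurable_snd|exact: measurable_fst].
  - by apply: mxmeasurableS (kcontinuous_measurable cF).
  - exact: mxmeasurable_cst.
have [M M0 HM] := kcontinuous_bounded 0 l cF.
exists M => // x t /IlP/andP[/ltW x0 /ltW xl] /IlP/andP[/ltW t0 /ltW tl].
case: ifP => _; last by rewrite mxnorm0.
by apply: HM; rewrite ?x0 ?t0.
Qed.

End ContinuousKernels.

(** * Identity plus integral operator on L^2: boundedness, adjoint, injectivity *)

Section BoundedOperators.
Context {R : realType} {m : nat} (l : R).
Local Notation C := R[i].
Local Notation mu := (@lebesgue_measure R).
Local Notation TR := (measurableTypeR R).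
Hypothesis l0 : 0 < l.
Implicit Types (f g : R -> 'cV[C]_m) (K : TR -> TR -> 'M[C]_m).

Let mIl : measurable (Il l : set TR) := measurable_Il l.
Let fIl := @mu_Il_fin R l.

Lemma eq_L2fun f g : (forall x, Il l x -> f x = g x) -> L2fun l f -> L2fun l g.
Proof.
move=> fg Lf; apply: L2funP.
  exact: eq_mxmeasurable fg (L2fun_measurable Lf).
apply: eq_integrable (L2fun_sqn Lf) => //.
by move=> x /set_mem Dx /=; rewrite fg.
Qed.

Lemma L2fun_Op K f : bker (Il l) K -> L2fun l f -> L2fun l (Op (Il l) K f).
Proof.
move=> bK Lf; have iF := L2fun_integrable Lf; have [_ [c c0 Kc]] := bK.
apply: (@L2fun_bounded _ _ _ _ (c * \int[mu]_(t in Il l) mxnorm (f t))).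
  exact: mxmeasurable_Op.
by move=> x Dx; exact: Op_bound.
Qed.

Lemma bounded_operator_IplusOp K T : bker (Il l) K ->
  (forall f x, Il l x -> T f x = f x + Op (Il l) K f x) -> bounded_operator l T.
Proof.
move=> bK TE; have [_ [c c0 Kc]] := bK.
have TL f : L2fun l f -> L2fun l (T f).
  move=> Lf; apply: (@eq_L2fun (fun x => f x + Op (Il l) K f x)).
    by move=> x Dx; rewrite TE.
  by apply: L2funD => //; exact: L2fun_Op.
split => //.
  move=> a f g Lf Lg; apply/L2eqP; apply: aeW => x Dx.
  have iF := L2fun_integrable Lf; have iG := L2fun_integrable Lg.
  have iaF : mxintegrable (Il l) (fun x => a *: f x).
    rewrite (_ : (fun _ => _) = fun x => a%:M *m f x); first exact: mxintegrableMl.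
    by apply/funext => y; rewrite mul_scalar_mx.
  rewrite !TE// (OpDr mIl bK iaF iG Dx).
  have -> : Op (Il l) K (fun x => a *: f x) x = a *: Op (Il l) K f x.
    rewrite -[RHS]mul_scalar_mx /Op -(mxintegralMl a%:M mIl (Op_integrand mIl bK iF Dx)).
    by apply: eq_mxintegral => t _; rewrite mul_scalar_mx scalemxAr.
  by rewrite scalerDr addrACA.
(* The outer factors 2 come from [L2normD]. The rest bounds the squared norm of [Op K f]: its sup is
   at most c times the L^1 norm of f, and [L1_le_L2] passes to L^2. *)
pose B := 2 + 2 * (c ^+ 2 * (l * (m * 2)%:R ^+ 2) * l).
have B0 : 0 <= B.
  by rewrite addr_ge0// mulr_ge0// mulr_ge0 ?(ltW l0)// mulr_ge0 ?sqr_ge0// mulr_ge0 ?sqr_ge0// ltW.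
exists (Num.sqrt B) => f Lf.
have LK := L2fun_Op bK Lf.
have E : L2norm l (T f) = L2norm l (fun x => f x + Op (Il l) K f x).
  apply: eq_L2norm; [exact: TL|exact: L2funD|].
  by apply/L2eqP; apply: aeW => x Dx; rewrite TE.
rewrite E.
suff key : L2norm l (fun x => f x + Op (Il l) K f x) ^+ 2 <= B * L2norm l f ^+ 2.
  rewrite -ler_sqr ?nnegrE ?L2norm_ge0//; last by rewrite mulr_ge0 ?sqrtr_ge0 ?L2norm_ge0.
  by rewrite [leRHS]exprMn (sqr_sqrtr B0).
apply: (le_trans (L2normD Lf LK)).
have n1 : L2norm l (Op (Il l) K f) ^+ 2 <= (c * \int[mu]_(t in Il l) mxnorm (f t)) ^+ 2 * l.
  apply: L2norm_bounded => //; first exact/mxmeasurable_Op/L2fun_integrable.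
  by move=> x Dx; apply: Op_bound => //; exact: L2fun_integrable.
have n2 := L1_le_L2 l0 Lf.
have cl0 : 0 <= c ^+ 2 * l by rewrite mulr_ge0 ?sqr_ge0// ltW.
have := ler_wpM2l cl0 n2; move: n1; rewrite /B.
move: (L2norm l (Op _ _ _)) (L2norm l f) (Rintegral _ _ _) => N A I n1 n3; lra.
Qed.

(** The integrand is a 1 by 1 matrix, so Fubini for matrix kernels applies directly to inner
    products. *)
Lemma L2innerE f g :
  L2inner l f g = (mxintegral (Il l) (fun x => (g x) ^t* *m f x)) 0 0.
Proof.
rewrite mxE; apply: eq_cintegral => x _; rewrite mxE; apply: eq_bigr => i _.
by rewrite !mxE mulrC.
Qed.

Lemma L2inner_integrable f g : L2fun l f -> L2fun l g ->
  mxintegrable (Il l) (fun x => (g x) ^t* *m f x).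
Proof.
move=> Lf Lg.
apply: (le_mxintegrable mIl _ (integrableD_EFin mIl (L2fun_mxnorm2 Lf) (L2fun_mxnorm2 Lg))).
  apply: mxmeasurableM; last exact: L2fun_measurable.
  by apply: mxmeasurable_adj; exact: L2fun_measurable.
move=> x _; rewrite (le_trans (mxnormM _ _))// mxnorm_adj.
have := sqr_ge0 (mxnorm (f x) - mxnorm (g x)).
have := sqr_ge0 (mxnorm (f x) + mxnorm (g x)).
rewrite !expr2; lra.
Qed.

Lemma IplusOp_adjoint K (K' : TR -> TR -> 'M[C]_m) T T' : bker (Il l) K ->
  K' = kadj K ->
  (forall f x, Il l x -> T f x = f x + Op (Il l) K f x) ->
  (forall f x, Il l x -> T' f x = f x + Op (Il l) K' f x) ->
  is_adjoint l T T'.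
Proof.
move=> bK K'E TE TE'; have bK' : bker (Il l) K' by rewrite K'E; exact: bker_adj.
split; first exact: (bounded_operator_IplusOp bK').
move=> f g Lf Lg; rewrite !L2innerE; congr (fun_of_matrix _ 0 0).
have iF := L2fun_integrable Lf; have iG := L2fun_integrable Lg.
have LKf := L2fun_Op bK Lf; have LKg := L2fun_Op bK' Lg.
rewrite (eq_mxintegral (G := fun x => (g x) ^t* *m f x + (g x) ^t* *m Op (Il l) K f x)); last first.
  by move=> x Dx; rewrite TE// mulmxDr.
rewrite [RHS](eq_mxintegral
  (G := fun x => (g x) ^t* *m f x + (Op (Il l) K' g x) ^t* *m f x)); last first.
  by move=> x Dx; rewrite TE'// adjmxD mulmxDl.
rewrite mxintegralD//; [|exact: L2inner_integrable|exact: L2inner_integrable].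
rewrite mxintegralD//; [|exact: L2inner_integrable|exact: L2inner_integrable].
congr (_ + _); rewrite K'E.
exact: Op_adjoint.
Qed.

(** Only the part of w on the support of K(x, .) enters; for a triangular kernel this is the
    inequality that Gronwall's lemma takes as input. *)
Lemma Op_bound_support (B : set TR) K p (w : TR -> 'M[C]_(m, p)) c x :
  measurable B -> B `<=` Il l ->
  bker (Il l) K -> (forall x t, Il l x -> Il l t -> mxnorm (K x t) <= c) ->
  mxintegrable (Il l) w -> Il l x -> (forall t, Il l t -> ~ B t -> K x t = 0) ->
  mxnorm (Op (Il l) K w x) <= c * \int[mu]_(t in B) mxnorm (w t).
Proof.
move=> mB BD bK Kc iw Dx K0.
have ib : mu.-integrable B (EFin \o (fun t => mxnorm (w t))).
  by apply: integrableS (mxintegrable_mxnorm mIl iw).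
have -> : Op (Il l) K w x = mxintegral B (fun t => K x t *m w t).
  rewrite (mxintegral_mkcond (D := Il l) _ (b := fun t => `[< B t >])) => //.
    apply: eq_mxintegral => t Dt; case: asboolP => // nB.
    by rewrite K0// mul0mx.
  by move=> t _; split => /asboolP.
rewrite -RintegralZl//; apply: le_mxnorm_mxintegral => //.
- by apply: mxmeasurableS (mxintegrable_measurable (Op_integrand mIl bK iw Dx)).
- exact: integrableZl_EFin.
- move=> t Bt; rewrite (le_trans (mxnormM _ _))// ler_wpM2r ?mxnorm_ge0//.
  by rewrite Kc//; exact: BD.
Qed.

Lemma lower_Op_injective K p (w : TR -> 'M[C]_(m, p)) : bker (Il l) K ->
  (forall x t : R, x <= t -> K x t = 0) -> mxintegrable (Il l) w ->
  (forall x, Il l x -> w x + Op (Il l) K w x = 0) ->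
  {ae mu, forall x : TR, Il l x -> w x = 0}.
Proof.
move=> bK Klow iw Hw; have [_ [c c0 Kc]] := bK.
apply: (Rintegral_mxnorm_eq0 mIl iw).
apply: (gronwall_forward c0 l0).
- exact: mxintegrable_mxnorm.
- by move=> x _; exact: mxnorm_ge0.
- apply: aeW => x Dx.
  have -> : w x = - Op (Il l) K w x by apply/eqP; rewrite -addr_eq0 Hw.
  rewrite mxnormN; have /IlP/andP[x0 xl] := Dx.
  apply: (Op_bound_support (B := Il x)) => //.
  + by apply: Il_subset; exact: ltW.
  + move=> t /IlP/andP[t0 _] nt; apply: Klow; rewrite leNgt; apply/negP => tx.
    by apply: nt; apply/IlP; rewrite t0.
Qed.

(** Since [K x] only looks at t > x, the equation is closed on ]a, l[ and Gronwall runs down from l.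
    It is given only almost everywhere because it will come from identities between operators on
    L^2. *)
Lemma upper_Op_injective K p (w : TR -> 'M[C]_(m, p)) a : 0 <= a < l -> bker (Il l) K ->
  (forall x t : R, t <= x -> K x t = 0) -> mxintegrable (Il l) w ->
  {ae mu, forall x : TR, `]a, l[%classic x -> w x + Op (Il l) K w x = 0} ->
  {ae mu, forall x : TR, `]a, l[%classic x -> w x = 0}.
Proof.
move=> /andP[a0 al] bK Kup iw Hw; have [_ [c c0 Kc]] := bK.
have sub : `]a, l[%classic `<=` (Il l : set TR).
  by move=> x /itvooP/andP[ax xl]; apply/IlP; rewrite xl (le_lt_trans a0).
have mal : measurable (`]a, l[%classic : set TR) by exact: measurable_itv.
have iw' : mxintegrable `]a, l[%classic w by apply: mxintegrableS iw.
apply: (Rintegral_mxnorm_eq0 mal iw').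
apply: (gronwall_backward c0 al).
- exact: mxintegrable_mxnorm.
- by move=> x _; exact: mxnorm_ge0.
- have := Hw; apply: filterS => x Hx Dx.
  have -> : w x = - Op (Il l) K w x by apply/eqP; rewrite -addr_eq0 Hx.
  rewrite mxnormN; have /itvooP/andP[ax xl] := Dx.
  apply: (Op_bound_support (B := `]x, l[%classic)) => //.
  + move=> t /itvooP/andP[xt tl]; apply/IlP; rewrite tl andbT.
    by rewrite (lt_trans _ xt)// (le_lt_trans a0).
  + exact: sub.
  + move=> t /IlP/andP[_ tl] nt; apply: Kup; rewrite leNgt; apply/negP => tx.
    by apply: nt; apply/itvooP; rewrite tx.
Qed.

End BoundedOperators.

(** * Existence of the factorization *)

Section Existence.
Context {R : realType} {m1 m2 : nat}.
Local Notation C := R[i].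
Local Notation mu := (@lebesgue_measure R).
Local Notation TR := (measurableTypeR R).

Definition lowerk n (E : R -> R -> 'M[C]_n) : TR -> TR -> 'M[C]_n :=
  fun x t => if (t : R) < x then E x t else 0.

(** Two kernels appear because [E] may be continuous on the triangle only, while [F] is meant to be
    its extension to the plane. The cut-off turns the variable upper limit into the fixed domain ]0,
    l[. *)
Lemma E_opE l (E F : R -> R -> 'M[C]_m2) f x :
  (forall x t, 0 < t -> t < x -> x < l -> E x t = F x t) -> Il l x ->
  E_op E f x = f x + Op (Il l) (lowerk F) f x.
Proof.
move=> EF Dx; rewrite /E_op; apply: (f_equal (fun z => f x + z)).
have /IlP/andP[x0 xl] := Dx.
rewrite (mxintegral_mkcond (D := Il l) _ (b := fun t : R => t < x)).
- apply: eq_mxintegral => t /IlP/andP[t0 _]; rewrite /lowerk.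
  by case: ifP => tx; [rewrite EF|rewrite mul0mx].
- by apply: Il_subset; exact: ltW.
- move=> t /IlP/andP[t0 _]; split; last by move=> /itvooP/andP[].
  by move=> tx; apply/itvooP; rewrite t0.
Qed.

(** First x is moved with t already displaced, which uses that the modulus is uniform in the other
    argument; then t is moved at x0, and Hermitian symmetry makes this a change of the first
    argument. *)
Lemma herm_kcontinuous n (k : R -> R -> 'M[C]_n) :
  (forall x t, (k t x) ^t* = k x t) ->
  (forall X x0 eps : R, 0 < eps -> exists2 d, 0 < d &
    forall x t, x <= X -> x0 <= X -> t <= X -> `|x - x0| < d ->
    mxnorm (k x t - k x0 t) <= eps) ->
  kcontinuous k.
Proof.
move=> kh kc; apply: kcontinuous_eps => i j x0 t0 eps eps0.
pose X := Num.max x0 t0 + 1.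
have e20 : 0 < eps / 2 by rewrite divr_gt0.
have [d1 d10 H1] := kc X x0 _ e20.
have [d2 d20 H2] := kc X t0 _ e20.
exists (Num.min (Num.min d1 d2) 1); first by rewrite !lt_min d10 d20 ltr01.
move=> x t; rewrite !lt_min => /andP[/andP[xd1 _] x1] /andP[/andP[_ td2] t1].
have xX : x <= X.
  move: x1; rewrite ltr_distl => /andP[_ xx0].
  by rewrite (le_trans (ltW xx0))// lerD2r le_max lexx.
have tX : t <= X.
  move: t1; rewrite ltr_distl => /andP[_ tt0].
  by rewrite (le_trans (ltW tt0))// lerD2r le_max lexx orbT.
have x0X : x0 <= X by rewrite /X (@le_trans _ _ (Num.max x0 t0)) ?lerDl// le_max lexx.
have t0X : t0 <= X by rewrite /X (@le_trans _ _ (Num.max x0 t0)) ?lerDl// le_max lexx orbT.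
have n1 := H1 x t xX x0X tX xd1.
have n2 := H2 t x0 tX t0X x0X td2.
have E : k x t - k x0 t0 = (k x t - k x0 t) + (k t x0 - k t0 x0) ^t*.
  by rewrite adjmxB !kh addrA subrK.
rewrite -mxB_entry (le_trans (cnorm1_le_mxnorm _ i j))// E (splitr eps).
by rewrite (le_trans (mxnormD _ _))// mxnorm_adj lerD.
Qed.

Variable Phi : R -> 'M[C]_(m2, m1).
Hypothesis Phi_bd : forall l : R, 0 < l -> boundedly_differentiable Phi l.
Hypothesis Phi0 : Phi 0 = 0.
Hypothesis S_bounded : forall l : R, 0 < l -> bounded_operator l (S_op Phi l).
Hypothesis S_inv : forall l : R, 0 < l -> boundedly_invertible l (S_op Phi l).

Local Notation s := (s_kernel Phi).

Lemma S_opE l : S_op Phi l = fun f x => f x - Op (Il l) s f x.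
Proof.
by apply/funext => f; apply/funext => x; rewrite /S_op Phi0 mul0mx subr0 mul1mx.
Qed.

Lemma s_kernel_kcontinuous : kcontinuous s.
Proof.
apply: herm_kcontinuous; first exact: s_kernel_herm.
exact: s_kernel_equicont.
Qed.

Lemma bker_s_kernel l : bker (Il l) s.
Proof.
split; first exact: mxmeasurableS (kcontinuous_measurable s_kernel_kcontinuous).
have [c c0 sc] := s_kernel_bounded Phi_bd Phi0 l; exists c => // x t.
by move=> /IlP/andP[_ /ltW xl] /IlP/andP[_ /ltW tl]; exact: sc.
Qed.

Lemma factorization_exists : exists E : R -> R -> 'M[C]_m2,
  mxkernel_continuous [set p : R * R | 0 <= p.2 <= p.1] E /\
  forall l : R, 0 < l -> factorizes_inverse l (S_op Phi l) E.
Proof.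
have [||||E0 [E0eq iE0 E0c]] := @factor_kernel R m2 s (s_kernel_herm Phi_bd Phi0).
- exact: kcontinuous_measurable s_kernel_kcontinuous.
- move=> X; have [c c0 sc] := s_kernel_bounded Phi_bd Phi0 X; exists c => // x t.
  by move=> /andP[_ xX] /andP[_ tX]; exact: sc.
- move=> X x0 eps eps0.
  have [d d0 Hd] := s_kernel_equicont Phi_bd Phi0 X x0 eps0; exists d => // x t.
  by move=> /andP[_ xX] /andP[_ x0X] /andP[_ tX]; exact: Hd.
- by move=> l l0; rewrite -S_opE; exact: S_inv.
have m0 y : 0 <= Num.max y 0 :> R by rewrite le_max lexx orbT.
(* Clamping extends the kernel from the quadrant to a continuous kernel on the plane. *)
pose E x t := E0 (Num.max x 0) (Num.max t 0).
have max_dist (x y : R) : `|Num.max x 0 - Num.max y 0| <= `|x - y|.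
  have [x0|x0] := leP x 0; have [y0|y0] := leP y 0.
  - by rewrite subrr normr0.
  - by rewrite sub0r normrN gtr0_norm// distrC (le_trans _ (ler_norm _))// lerDl oppr_ge0.
  - by rewrite subr0 gtr0_norm// (le_trans _ (ler_norm _))// lerDl oppr_ge0.
  - by [].
have cE : kcontinuous E.
  apply: kcontinuous_eps => i j x0 t0 eps eps0.
  have [d d0 Hd] := E0c i j _ _ _ (m0 x0) (m0 t0) eps0.
  exists d => // x t xd td; apply: Hd => //; exact: le_lt_trans (max_dist _ _) _.
exists E; split.
  by move=> i j; split; apply: continuous_subspaceT; have [] := cE i j.
move=> l l0; have mIl := measurable_Il l; have fIl := @mu_Il_fin R l.
pose e := lowerk E.
have be : bker (Il l) e by exact: bker_lower.
have bs := bker_s_kernel l.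
have bes := bker_adj mIl be.
have e_lower x t : x <= t -> e x t = 0 by move=> xt; rewrite /e /lowerk ltNge xt.
have e_eq (x t : R) : Il l x -> Il l t -> t < x -> e x t = s x t + kmul (Il l) e s x t.
  move=> Dx /IlP/andP[t0 tl] tx; have /IlP/andP[x0 xl] := Dx.
  rewrite {1}/e /lowerk tx {1}/E !max_l ?(ltW x0) ?(ltW t0)//.
  rewrite (E0eq x t (ltW x0) (ltW t0)); apply: (f_equal (fun z => s x t + z)).
  (* The cut-off in [e] stops the integral over ]0, l[ at x, so one kernel satisfies the equation
     for every l. *)
  rewrite (mxintegral_mkcond (D := Il l) _ (b := fun u : R => u < x)).
  - apply: eq_mxintegral => u /IlP/andP[u0 _]; rewrite /e /lowerk /E.
    by case: ifP => _; rewrite ?mul0mx// !max_l// ltW.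
  - by apply: Il_subset; exact: ltW.
  - move=> u /IlP/andP[u0 _]; split; last by move=> /IlP/andP[].
    by move=> ux; apply/IlP; rewrite u0.
have EE f x : Il l x -> E_op E f x = f x + Op (Il l) e f x by exact: E_opE.
have bE : bounded_operator l (E_op E) by exact: (bounded_operator_IplusOp l0 be EE).
split => //.
pose Es (g : R -> 'cV[C]_m2) x := g x + Op (Il l) (kadj e) g x.
have adjE : is_adjoint l (E_op E) Es.
  exact: (IplusOp_adjoint l0 be (erefl (kadj e)) EE (fun _ _ _ => erefl)).
have [T invT] := S_inv l0.
have [bT ST TS] := invT.
exists T, Es; split => // f Lf.
have [EL _ _] := bE; have [[EsL _ _] _] := adjE; have [SL _ _] := S_bounded l0.
pose u := E_op E f; have Lu : L2fun l u := EL _ Lf.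
pose p := Es u; have Lp : L2fun l p := EsL _ Lu.
have LSp : L2fun l (S_op Phi l p) := SL _ Lp.
(* For u = E f the identity E S E^* = 1 gives E (S p) = E f at every point of ]0, l[, and
   injectivity of E cancels it. *)
have Spf : L2eq l (S_op Phi l p) f.
  pose w x := S_op Phi l p x - f x.
  have Lw : L2fun l w by apply: L2funD => //; exact: L2funN.
  have iw := L2fun_integrable Lw.
  have : {ae mu, forall x : TR, Il l x -> w x = 0}.
    apply: (lower_Op_injective l0 be e_lower iw) => x Dx.
    have iSp := L2fun_integrable LSp; have iF := L2fun_integrable Lf.
    rewrite (OpDr mIl be iSp (mxintegrableN mIl iF) Dx) (OpNr mIl be iF Dx).
    have H := triangular_factorization mIl fIl bs be bes
      (fun x t _ _ => s_kernel_herm Phi_bd Phi0 x t) (fun x t _ _ => erefl)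
      e_lower e_eq (L2fun_integrable Lu) Dx.
    rewrite /w addrACA -opprD -(EE f x Dx).
    rewrite S_opE; apply/eqP; rewrite subr_eq0; apply/eqP; exact: H.
  move=> H; apply/L2eqP; move: H; apply: filterS => x Hx Dx.
  by apply/eqP; rewrite -subr_eq0; apply/eqP; exact: Hx.
(* Applying the given inverse T to S p = f yields p = T f, and p is E^* E f. *)
have /L2eqP H1 := bounded_operator_ae bT LSp Lf Spf.
have /L2eqP H2 := TS p Lp.
apply/L2eqP; move: H1 H2; apply: filterS2 => x H1 H2 Dx.
by rewrite -(H1 Dx); exact: H2.
Qed.

End Existence.

(** * Uniqueness of the factorization *)

Section Uniqueness.
Context {R : realType} {m2 : nat}.
Local Notation C := R[i].
Local Notation mu := (@lebesgue_measure R).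
Local Notation TR := (measurableTypeR R).

Lemma ae_itv_exists (a b : R) (P : TR -> Prop) : a < b ->
  {ae mu, forall x : TR, `]a, b[%classic x -> P x} -> exists x : R, a < x < b /\ P x.
Proof.
move=> ab [N [mN N0 NP]]; apply: contrapT => nP.
have sub : `]a, b[%classic `<=` N.
  move=> x /itvooP xab; apply: NP => /= H; apply: nP.
  by exists x; split => //; apply: H; apply/itvooP.
have : (mu (`]a, b[%classic : set TR) <= mu N)%E.
  by apply: (le_measure mu _ _ sub); rewrite inE //; exact: measurable_itv.
by rewrite N0 lebesgue_measure_itv/= lte_fin ab -EFinD lee_fin subr_le0 leNgt ab.
Qed.

(** If q(u) were nonzero, q would be nonzero near u, hence on an interval of positive length inside
    ]a, b[. The end points u = a and u = b are allowed. *)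
Lemma continuous_ae_eq0 (a b u : R) (q : R -> R) : continuous q -> a < b ->
  {ae mu, forall x : TR, `]a, b[%classic x -> q x = 0} -> a <= u <= b -> q u = 0.
Proof.
move=> cq ab q0 /andP[au ub]; apply: contrapT => /eqP qu.
have e0 : 0 < `|q u| by rewrite normr_gt0.
have /cvgrPdist_lt/(_ _ e0)/nbhs_ballP[d /= d0 Hd] := cq u.
pose a' := Num.max a (u - d); pose b' := Num.min b (u + d).
have ab' : a' < b'.
  by rewrite /a' /b' lt_min !gt_max ab/=; apply/andP; split; [lra|apply/andP; split; lra].
have [|x [/andP[]]] := ae_itv_exists (P := fun x => q x = 0) ab'.
  have := q0; apply: filterS => x Hx /itvooP/andP[]; rewrite /a' /b' gt_max lt_min.
  by move=> /andP[ax _] /andP[xb _]; apply: Hx; apply/itvooP; rewrite ax.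
rewrite /a' /b' gt_max lt_min => /andP[_ ux] /andP[_ xu] qx.
have := Hd x; rewrite /ball/= qx subr0 ltxx => H; have : false by apply: H; rewrite ltr_distlC ux.
by [].
Qed.

(** Compactness of [0, b] makes the continuity at the points (a, u) uniform in u. *)
Lemma kcontinuous_uniform m n (F : R -> R -> 'M[C]_(m, n)) (a b eps : R) :
  kcontinuous F -> 0 < eps -> exists2 d, 0 < d & forall x, `|x - a| < d ->
  forall u, 0 <= u <= b -> mxnorm (F x u - F a u) <= eps.
Proof.
move=> cF eps0.
have key (f : R * R -> R) e : continuous f -> 0 < e ->
    \forall x \near a, forall u, `[0, b]%classic u -> `|f (x, u) - f (a, u)| <= e.
  move=> cf e0.
  have /compact_near_coveringP/(_ _ (nbhs a) (fun x u => `|f (x, u) - f (a, u)| <= e)) :=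
    @segment_compact R 0 b.
  apply => u _.
  have e20 : 0 < e / 2 by rewrite divr_gt0.
  have /cvgrPdist_lt/(_ _ e20) := cf (a, u).
  move=> /(nbhs_ballP (a, u) _).1[d /= d0 Hd].
  exists (ball u d, ball a d); first by split; apply/nbhs_ballP; exists d.
  move=> [u' x] /= [u'd xd].
  rewrite (le_trans (ler_distD (f (a, u)) _ _))// (splitr e) lerD// ltW//.
    by rewrite distrC; apply: (Hd (x, u')).
  by apply: (Hd (a, u')); split => //; exact: ballxx.
pose e := eps / ((m * n)%:R * 2 + 1).
have e0 : 0 < e by rewrite divr_gt0// ltr_wpDl.
have : \forall x \near a, forall ij : 'I_m * 'I_n, forall u, `[0, b]%classic u ->
    cnorm1 (F x u ij.1 ij.2 - F a u ij.1 ij.2) <= e + e.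
  have := @filter_forall _ _ (fun (ij : 'I_m * 'I_n) (x : R) => forall u,
    `[0, b]%classic u -> cnorm1 (F x u ij.1 ij.2 - F a u ij.1 ij.2) <= e + e)
    (nbhs a) _.
  apply => -[i j] /=.
  have [c1 c2] := cF i j.
  have := key _ _ c2 e0; have := key _ _ c1 e0.
  apply: filterS2 => x H1 H2 u ub.
  have := H1 u ub; have := H2 u ub; rewrite /cnorm1 /=.
  by case: (F x u i j) (F a u i j) => c d [c' d'] /= h2 h1; rewrite lerD.
move=> /nbhs_ballP[d /= d0 Hd]; exists d => // x xd u ub.
have Hx := Hd x; rewrite /ball/= distrC in Hx.
rewrite (@le_trans _ _ (\sum_(i < m) \sum_(j < n) (e + e)))//.
  apply: ler_sum => i _; apply: ler_sum => j _; rewrite mxB_entry.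
  by apply: (Hx xd (i, j) u); rewrite /= in_itv.
rewrite !sumr_const !card_ord -mulrnA mulnC -mulr2n -mulrnA -mulr_natr natrM.
have : e * ((m * n)%:R * 2 + 1) = eps by rewrite divfK// lt0r_neq0// ltr_wpDl.
by rewrite natrM; lra.
Qed.

(** The map sending (x, t) to (cl x, min (cl t) (cl x)) retracts the plane onto the closed triangle;
    composing with it extends E continuously. *)
Lemma clamp_kernel l n (E : R -> R -> 'M[C]_n) : 0 < l ->
  mxkernel_continuous [set p : R * R | 0 <= p.2 <= p.1 /\ p.1 <= l] E ->
  exists2 F, kcontinuous F & forall x t, 0 <= t <= x -> x <= l -> E x t = F x t.
Proof.
move=> l0 cE; set T := [set _ | _] in cE.
pose cl (y : R) := Num.min (Num.max y 0) l.
pose h (p : R * R) := (cl p.1, Num.min (cl p.2) (cl p.1)).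
have ccl (f : R * R -> R) : continuous f -> continuous (cl \o f).
  move=> cf p; rewrite /cl /comp.
  apply: (@continuous_min _ _ (fun p => Num.max (f p) 0) (fun=> l)); last exact: cvg_cst.
  by apply: (@continuous_max _ _ f (fun=> 0)); [exact: cf|exact: cvg_cst].
have ch : continuous h.
  move=> p.
  have c1 : continuous (cl \o fst : R * R -> R) by apply: ccl => ?; exact: cvg_fst.
  have c2 : continuous (cl \o snd : R * R -> R) by apply: ccl => ?; exact: cvg_snd.
  have c3 : {for p, continuous (fun q : R * R => Num.min (cl q.2) (cl q.1))}.
    by apply: (@continuous_min _ _ (cl \o snd) (cl \o fst)); [exact: c2|exact: c1].
  exact: (cvg_pair (c1 p) c3).
have cl0 y : 0 <= cl y by rewrite /cl le_min le_max lexx orbT ltW.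
have cll y : cl y <= l by rewrite /cl ge_min lexx orbT.
have hT p : T (h p).
  by split => //=; rewrite le_min !cl0/= ge_min lexx orbT.
have comp (f : R * R -> R) : {within T, continuous f} -> continuous (f \o h).
  move=> /subspace_continuousP cf p.
  have hw : h @ p --> within T (nbhs (h p)).
    move=> U HU; apply: (@filterS _ (nbhs p) _ _ _ _ (ch p _ HU)) => q Hq.
    exact: Hq (hT q).
  exact: (cvg_comp _ _ hw (cf _ (hT p))).
exists (fun x t => E (h (x, t)).1 (h (x, t)).2).
  by move=> i j; have [c1 c2] := cE i j; split; [exact: (comp _ c1)|exact: (comp _ c2)].
move=> x t /andP[t0 tx] xl.
have clx : cl x = x by rewrite /cl max_l ?min_l// (le_trans t0).
have clt : cl t = t by rewrite /cl max_l ?min_l// (le_trans tx).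
by rewrite /h /= clx clt min_l.
Qed.

(** Both adjoints give <h, A g> = <T h, g> = <h, B g>, and h = A g - B g then has norm 0. The
    adjoint occurring in a factorization is abstract; this identifies it with the explicit integral
    operator. *)
Lemma adjoint_unique l (T A B : (R -> 'cV[C]_m2) -> R -> 'cV[C]_m2) g :
  0 < l -> is_adjoint l T A -> is_adjoint l T B -> L2fun l g ->
  L2eq l (A g) (B g).
Proof.
move=> l0 [[AL _ _] HA] [[BL _ _] HB] Lg.
have LA := AL _ Lg; have LB := BL _ Lg.
pose h x := A g x - B g x.
have Lh : L2fun l h by apply: L2funD => //; exact: L2funN.
have inn : L2inner l h h = 0.
  have e : L2inner l h (A g) = L2inner l h (B g) by rewrite -HA// HB.
  move: e; rewrite !L2innerE => e.
  rewrite (eq_mxintegral (G := fun x => (A g x) ^t* *m h x - (B g x) ^t* *m h x)); last first.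
    by move=> x _; rewrite {1}/h adjmxB mulmxBl.
  have mIl := measurable_Il l.
  have iA := L2inner_integrable Lh LA; have iB := L2inner_integrable Lh LB.
  rewrite (mxintegralB mIl iA iB) mxB_entry; apply/eqP; rewrite subr_eq0; apply/eqP.
  exact: e.
have h0 : L2eq l h (fun=> 0).
  by apply: L2norm_eq0 => //; rewrite /L2norm inn /= sqrtr0.
apply/L2eqP; move/L2eqP : h0; apply: filterS => x Hx Dx.
by apply/eqP; rewrite -subr_eq0; apply/eqP; exact: Hx.
Qed.

(* Since S^{-1} = E^* E, the function w = E S f satisfies E^* w = f, and E^* only
   looks to the right; so w vanishes wherever f vanishes up to l. *)
Lemma factor_vanish l (S : (R -> 'cV[C]_m2) -> R -> 'cV[C]_m2) (E F : R -> R -> 'M[C]_m2) a f :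
  0 <= a < l -> bounded_operator l S -> kcontinuous F ->
  (forall x t, 0 <= t <= x -> x <= l -> E x t = F x t) ->
  factorizes_inverse l S E -> L2fun l f ->
  (forall x, a < x < l -> f x = 0) ->
  {ae mu, forall x : TR, `]a, l[%classic x ->
     S f x + Op (Il l) (lowerk F) (S f) x = 0}.
Proof.
move=> /andP[a0 al] [SL _ _] cF EF [bE [Sinv [Estar [[bSinv SSinv SinvS] adjE fac]]]] Lf f0.
have l0 : 0 < l := le_lt_trans a0 al.
have mIl := measurable_Il l.
pose e := lowerk F.
have be : bker (Il l) e by exact: bker_lower.
have bes := bker_adj mIl be.
have EE g x : Il l x -> E_op E g x = g x + Op (Il l) e g x.
  apply: E_opE => y t t0 ty yl; apply: EF; last exact: ltW.
  by rewrite (ltW t0) ltW.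
pose Es (g : R -> 'cV[C]_m2) x := g x + Op (Il l) (kadj e) g x.
have adjE' : is_adjoint l (E_op E) Es.
  exact: (IplusOp_adjoint l0 be (erefl (kadj e)) EE (fun _ _ _ => erefl)).
have [EL _ _] := bE.
have LSf : L2fun l (S f) by exact: SL.
pose w := E_op E (S f); have Lw : L2fun l w by exact: EL.
have /L2eqP H1 := SinvS f Lf.
have /L2eqP H2 := fac _ LSf.
have /L2eqP H3 := adjoint_unique l0 adjE adjE' Lw.
have sub : `]a, l[%classic `<=` (Il l : set TR).
  by move=> x /itvooP/andP[ax xl]; apply/IlP; rewrite xl (le_lt_trans a0).
have Hw : {ae mu, forall x : TR, `]a, l[%classic x -> w x + Op (Il l) (kadj e) w x = 0}.
  move: H1 H2 H3; apply: filterS3 => x H1 H2 H3 Dx.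
  have Dl := sub _ Dx.
  rewrite -[LHS](H3 Dl) -[Estar w x](H2 Dl) -(f0 x); last by move/itvooP : Dx.
  exact: H1 Dl.
have al' : 0 <= a < l by rewrite a0.
have es_upper (x t : R) : t <= x -> kadj e x t = 0.
  by move=> tx; rewrite /kadj /e /lowerk ltNge tx adjmx0.
have := upper_Op_injective al' bes es_upper (L2fun_integrable Lw) Hw.
by apply: filterS => x Hx Dx; rewrite -(EE _ _ (sub _ Dx)); exact: Hx.
Qed.

End Uniqueness.

(** * Comparison of two factors *)

Section UniqueFactorization.
Context {R : realType} {m1 m2 : nat}.
Local Notation C := R[i].
Local Notation mu := (@lebesgue_measure R).
Local Notation TR := (measurableTypeR R).
Variable Phi : R -> 'M[C]_(m2, m1).
Hypothesis Phi_bd : forall l : R, 0 < l -> boundedly_differentiable Phi l.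
Hypothesis Phi0 : Phi 0 = 0.
Hypothesis S_bounded : forall l : R, 0 < l -> bounded_operator l (S_op Phi l).
Hypothesis S_inv : forall l : R, 0 < l -> boundedly_invertible l (S_op Phi l).

Lemma mxnorm_row p q (A : 'M[C]_(p, q)) k : mxnorm (row k A) <= mxnorm A.
Proof.
rewrite /mxnorm big_ord1 [leRHS](bigD1 k)//= (eq_bigr (fun j => cnorm1 (A k j))).
  rewrite lerDl; apply: sumr_ge0 => i _; apply: sumr_ge0 => j _.
  exact: cnorm1_ge0.
by move=> j _; rewrite mxE.
Qed.

Lemma L2fun_extend0 a l (f : R -> 'cV[C]_m2) : a <= l -> L2fun a f ->
  L2fun l (fun u => if u < a then f u else 0).
Proof.
move=> al Lf i.
have mIa := measurable_Il a; have mIl := measurable_Il l.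
have Ial : Il l `&` Il a = Il a by apply: setIidr; exact: Il_subset.
have patchIl (g : 'cV[C]_m2 -> R) : g 0 = 0 -> forall u : TR, u \in Il l ->
    ((fun u => g (f u)) \_ (Il a)) u = g (if (u : R) < a then f u else 0).
  move=> g0 u /set_mem/IlP/andP[u0 ul]; rewrite patchE.
  case: ifPn => [/set_mem/IlP/andP[_ ->]//|nu]; case: ifPn => // ua.
  by move: nu; rewrite mem_set//; apply/IlP; rewrite u0.
have [f1 f2 f3] := Lf i; split.
- apply: (eq_measurable_fun _ (patchIl (fun v => complex.Re (v i 0)) _)); first by rewrite mxE.
  by apply/measurable_restrict; rewrite ?Ial.
- apply: (eq_measurable_fun _ (patchIl (fun v => complex.Im (v i 0)) _)); first by rewrite mxE.
  by apply/measurable_restrict; rewrite ?Ial.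
- pose g (v : 'cV[C]_m2) := complex.Re (v i 0) ^+ 2 + complex.Im (v i 0) ^+ 2.
  have g0 : g 0 = 0 by rewrite /g mxE /= expr0n addr0.
  apply: (eq_integrable mIl ((fun u => (g (f u))%:E) \_ (Il a))).
    move=> u ul; rewrite -[RHS]/((g (if (u : R) < a then f u else 0))%:E).
    by rewrite -(patchIl g g0 u ul) !patchE; case: ifP.
  by apply/(integrable_restrict _ mIa mIl); rewrite Ial.
Qed.

(** Beyond a, f = 0 gives S f = - s f, which is bounded by K, although on ]0, a[ the function S f is
    only known to be integrable. For almost every x > a the integral of G(x, u) (S f)(u) over ]0, x[
    vanishes; its part beyond a is at most M K (x - a), and on the rest G(x, .) is uniformly close
    to G(a, .). *)
Lemma kernel_row_vanishes l (G : R -> R -> 'M[C]_m2) a f : 0 < a < l ->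
  kcontinuous G -> L2fun l f -> (forall x, a <= x < l -> f x = 0) ->
  {ae mu, forall x : TR, `]a, l[%classic x -> Op (Il l) (lowerk G) (S_op Phi l f) x = 0} ->
  mxintegral (Il a) (fun u => G a u *m S_op Phi l f u) = 0.
Proof.
move=> /andP[a0 al] cG Lf f0 HG.
have l0 : 0 < l := lt_trans a0 al.
have mIl := measurable_Il l; have mIa := measurable_Il a.
have bs := bker_s_kernel Phi_bd Phi0 l.
have [SL _ _] := S_bounded l0.
pose phi := S_op Phi l f; have Lphi : L2fun l phi := SL _ Lf.
have iphi := L2fun_integrable Lphi.
have iphia : mxintegrable (Il a) phi.
  by apply: mxintegrableS iphi => //; apply: Il_subset; exact: ltW.
have [c c0 sc] := s_kernel_bounded Phi_bd Phi0 l.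
have [M M0 HM] := kcontinuous_bounded 0 l cG.
pose K := c * \int[mu]_(t in Il l) mxnorm (f t).
have K0 : 0 <= K by rewrite mulr_ge0// Rintegral_ge0// => x _; exact: mxnorm_ge0.
have phiK u : a <= u < l -> mxnorm (phi u) <= K.
  move=> /andP[au ul]; rewrite /phi (S_opE Phi0) f0 ?au// sub0r mxnormN.
  apply: (Op_bound mIl bs) => //; last by apply/IlP; rewrite ul (lt_le_trans a0).
    by move=> x t /IlP/andP[_ /ltW xl] /IlP/andP[_ /ltW tl]; exact: sc.
  exact: L2fun_integrable.
pose J := \int[mu]_(u in Il a) mxnorm (phi u).
have J0 : 0 <= J by apply: Rintegral_ge0 => x _; exact: mxnorm_ge0.
have iG x : 0 <= x <= l -> mxintegrable (Il l) (fun u => G x u *m phi u).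
  move=> xl; apply: (le_mxintegrable mIl _
    (integrableZl_EFin M mIl (mxintegrable_mxnorm mIl iphi))).
    apply: mxmeasurableM; last exact: mxintegrable_measurable.
    apply: (mxmeasurable_comp (h := pair x) _ _ (kcontinuous_measurable cG)) => //.
    by apply: measurable_funTS; exact: pair1_measurable.
  move=> u /IlP/andP[/ltW u0 /ltW ul].
  by rewrite (le_trans (mxnormM _ _))// ler_wpM2r ?mxnorm_ge0// HM// u0.
have iGa x : 0 <= x <= l -> mxintegrable (Il a) (fun u => G x u *m phi u).
  by move=> xl; apply: mxintegrableS (iG x xl) => //; apply: Il_subset; exact: ltW.
have small e : 0 < e -> mxnorm (mxintegral (Il a) (fun u => G a u *m phi u)) <= e * (J + M * K).
  move=> e0; have [d d0 Hd] := kcontinuous_uniform a a cG e0.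
  pose b := Num.min l (a + Num.min d e).
  have ab : a < b by rewrite /b lt_min al ltrDl lt_min d0.
  have [|x [/andP[ax xb]]] := ae_itv_exists
    (P := fun x => Op (Il l) (lowerk G) phi x = 0) ab.
    have := HG; apply: filterS => x Hx /itvooP/andP[ax xb]; apply: Hx; apply/itvooP.
    by rewrite ax (lt_le_trans xb)// /b ge_min lexx.
  move: xb; rewrite /b lt_min => /andP[xl]; rewrite -ltrBlDl lt_min => /andP[xd xe] Hx.
  have x0 : 0 < x := lt_trans a0 ax.
  have xl' : 0 <= x <= l by rewrite (ltW x0) ltW.
  have al' : 0 <= a <= l by rewrite (ltW a0) ltW.
  have Ix : mxintegral (Il x) (fun u => G x u *m phi u) = 0.
    rewrite -[RHS]Hx (mxintegral_mkcond (D := Il l) _ (b := fun u : R => u < x)).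
    - by apply: eq_mxintegral => u _; rewrite /lowerk; case: ifP => // _; rewrite mul0mx.
    - by apply: Il_subset; exact: ltW.
    - move=> u /IlP/andP[u0 _]; split; last by move=> /IlP/andP[].
      by move=> ux; apply/IlP; rewrite u0.
  pose X1 := mxintegral (Il a) (fun u => G x u *m phi u).
  have n1 : mxnorm (mxintegral (Il a) (fun u => G a u *m phi u) - X1) <= e * J.
    rewrite -mxnormN opprB /X1 -(mxintegralB mIa (iGa _ xl') (iGa _ al')).
    have ij := mxintegrable_mxnorm mIa iphia.
    rewrite /J -RintegralZl//; apply: le_mxnorm_mxintegral => //.
    - apply: mxmeasurableD; first exact/mxintegrable_measurable/iGa.
      by apply: mxmeasurableN; exact/mxintegrable_measurable/iGa.
    - exact: integrableZl_EFin.
    - move=> u /IlP/andP[/ltW u0 /ltW ua]; rewrite -mulmxBl (le_trans (mxnormM _ _))//.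
      rewrite ler_wpM2r ?mxnorm_ge0// Hd ?u0//.
      by rewrite gtr0_norm ?subr_gt0.
  have n2 : mxnorm X1 <= M * K * e.
    have -> : X1 = - (mxintegral (Il x) (fun u => G x u *m phi u) - X1).
      by rewrite Ix sub0r opprK.
    rewrite mxnormN (@le_trans _ _ (M * K * (x - a)))//; last first.
      by apply: ler_wpM2l; [exact: mulr_ge0|exact: ltW].
    apply: (mxintegral_Il_sub _ _ (mulr_ge0 M0 K0) (ltW ax)).
      by apply: mxintegrableS (iG x xl') => //; apply: Il_subset; exact: ltW.
    move=> u /andP[au ux]; have ul : u < l := lt_trans ux xl.
    rewrite (le_trans (mxnormM _ _))// ler_pM ?mxnorm_ge0 ?phiK ?au//.
    by rewrite HM// (le_trans (ltW a0) au) ltW.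
  move: n1; set X0 := mxintegral (Il a) (fun u => G a u *m phi u) => n1.
  have -> : X0 = (X0 - X1) + X1 by rewrite subrK.
  rewrite (le_trans (mxnormD _ _))//.
  by rewrite mulrDr lerD// mulrC.
apply: mxnorm_eq0; apply/eqP; rewrite eq_le mxnorm_ge0 andbT.
apply/ler_addgt0Pr => e e0; rewrite add0r.
have P0 : 0 < J + M * K + 1 by rewrite ltr_wpDl// addr_ge0// mulr_ge0.
rewrite (le_trans (small (e / (J + M * K + 1)) _)) ?divr_gt0//.
rewrite -mulrA ger_pMr// mulrC ler_pdivrMr// mul1r lerDl//.
Qed.

(** The strict inequality a < l leaves room to approach a from the right. *)
Lemma factor_kernels_agree l (E1 E2 F1 F2 : R -> R -> 'M[C]_m2) a :
  0 < a < l -> kcontinuous F1 -> kcontinuous F2 ->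
  (forall x t, 0 <= t <= x -> x <= l -> E1 x t = F1 x t) ->
  (forall x t, 0 <= t <= x -> x <= l -> E2 x t = F2 x t) ->
  factorizes_inverse l (S_op Phi l) E1 -> factorizes_inverse l (S_op Phi l) E2 ->
  forall t, 0 <= t <= a -> F1 a t = F2 a t.
Proof.
move=> /andP[a0 al] cF1 cF2 EF1 EF2 fac1 fac2.
have l0 : 0 < l := lt_trans a0 al.
have mIl := measurable_Il l; have mIa := measurable_Il a.
pose G x t := F1 x t - F2 x t.
have cG : kcontinuous G.
  move=> i j; have [c1 c2] := cF1 i j; have [c3 c4] := cF2 i j.
  split.
    rewrite (_ : (fun _ => _) = fun p : R * R =>
      complex.Re (F1 p.1 p.2 i j) - complex.Re (F2 p.1 p.2 i j)).
      by move=> p; exact: (cvgB (c1 p) (c3 p)).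
    apply/funext => p; rewrite /G mxB_entry.
    by case: (F1 _ _ i j) (F2 _ _ i j) => ? ? [].
  rewrite (_ : (fun _ => _) = fun p : R * R =>
    complex.Im (F1 p.1 p.2 i j) - complex.Im (F2 p.1 p.2 i j)).
    by move=> p; exact: (cvgB (c2 p) (c4 p)).
  apply/funext => p; rewrite /G mxB_entry.
  by case: (F1 _ _ i j) (F2 _ _ i j) => ? ? [].
have mG : mxmeasurable (Il a : set TR) (G a).
  apply: (mxmeasurable_comp (h := pair a) _ _ (kcontinuous_measurable cG)) => //.
  by apply: measurable_funTS; exact: pair1_measurable.
have bl1 := bker_lower l cF1; have bl2 := bker_lower l cF2.
have al' : 0 <= a < l by rewrite (ltW a0).
(* The k-th row of G a is reached by S_a; extending its preimage by 0 gives a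
   function whose image under both factors vanishes beyond a. *)
have row0 (k : 'I_m2) : {ae mu, forall u : TR, Il a u -> (row k (G a u)) ^t* = 0}.
  pose v u := (row k (G a u)) ^t*.
  have mv : mxmeasurable (Il a : set TR) v.
    apply: mxmeasurable_adj => i j; have := mG k j.
    by congr cmeasurable; apply/funext => u; rewrite [RHS]mxE.
  have [M M0 HM] := kcontinuous_bounded 0 l cG.
  have vM u : Il a u -> mxnorm (v u) <= M.
    move=> /IlP/andP[u0 ua]; rewrite /v mxnorm_adj (le_trans (mxnorm_row _ _))//.
    by apply: HM; [rewrite (ltW a0) ltW|rewrite (ltW u0) ltW// (lt_trans ua)].
  have Lv : L2fun a v := L2fun_bounded mv vM.
  have [T [[TL _ _] ST _]] := S_inv a0.
  have Lf0 := TL _ Lv.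
  pose f u : 'cV[C]_m2 := if (u : R) < a then T v u else 0.
  have Lf : L2fun l f := L2fun_extend0 (ltW al) Lf0.
  have f0 x : a <= x < l -> f x = 0 by move=> /andP[ax _]; rewrite /f ltNge ax.
  (* As f vanishes beyond a, the operators for l and for a give the same values on ]0, a[. *)
  have Sf u : Il a u -> S_op Phi l f u = S_op Phi a (T v) u.
    move=> /IlP/andP[u0 ua]; rewrite !(S_opE Phi0) {1}/f ua.
    apply: (f_equal (fun z => T v u - z)); apply/esym.
    rewrite [LHS](mxintegral_mkcond (D := Il l) _ (b := fun t : R => t < a)).
    - by apply: eq_mxintegral => t _; rewrite /f; case: ifP => // _; rewrite mulmx0.
    - by apply: Il_subset; exact: ltW.
    - move=> t /IlP/andP[t0 _]; split; last by move=> /IlP/andP[].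
      by move=> ta; apply/IlP; rewrite t0.
  have int0 : mxintegral (Il a) (fun u => G a u *m S_op Phi l f u) = 0.
    apply: kernel_row_vanishes => //; first by rewrite a0.
    have f0' x : a < x < l -> f x = 0 by move=> /andP[/ltW ax xl]; rewrite f0// ax.
    have H1 := factor_vanish al' (S_bounded l0) cF1 EF1 fac1 Lf f0'.
    have H2 := factor_vanish al' (S_bounded l0) cF2 EF2 fac2 Lf f0'.
    have [SL _ _] := S_bounded l0.
    have iphi := L2fun_integrable (SL _ Lf).
    move: H1 H2; apply: filterS2 => x H1 H2 Dx.
    have Dlx : Il l x.
      by move/itvooP : Dx => /andP[ax xl]; apply/IlP; rewrite xl (lt_trans a0).
    rewrite /Op (eq_mxintegral (G := fun t => lowerk F1 x t *m S_op Phi l f t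
      - lowerk F2 x t *m S_op Phi l f t)); last first.
      move=> t _; rewrite -mulmxBl /lowerk; case: ifP => // _.
      by rewrite subr0.
    rewrite (mxintegralB mIl (Op_integrand mIl bl1 iphi Dlx) (Op_integrand mIl bl2 iphi Dlx)).
    apply/eqP; rewrite subr_eq0; apply/eqP; apply: (addrI (S_op Phi l f x)).
    exact: etrans (H1 Dx) (esym (H2 Dx)).
  have Gv0 : mxintegral (Il a) (fun u => G a u *m v u) = 0.
    rewrite -int0; apply: ae_eq_mxintegral => //.
    - exact: mxmeasurableM.
    - apply: mxmeasurableM => //.
      have [SL _ _] := S_bounded l0.
      apply: mxmeasurableS (L2fun_measurable (SL _ Lf)); first exact: mIl.
      by apply: Il_subset; exact: ltW.
    - have /L2eqP := ST _ Lv; apply: filterS => u Hu Du.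
      by rewrite (Sf u Du); apply: (f_equal (fun z => G a u *m z)); exact: esym (Hu Du).
  (* Since v is the adjoint of the k-th row of G(a, .), the k-th entry of the integral of G v is the
     squared L^2 norm of v. *)
  have inn : L2inner a v v = 0.
    transitivity ((mxintegral (Il a) (fun u => G a u *m v u)) k 0); last by rewrite Gv0 mxE.
    rewrite [RHS]mxE; apply: eq_cintegral => u _; rewrite [RHS]mxE.
    apply: eq_bigr => j _; rewrite /v !mxE mulrC; congr (_ * _).
    exact: conjCK.
  by apply: (L2norm_eq0 Lv); rewrite /L2norm inn /= sqrtr0.
move=> t ta; apply/eqP; rewrite -subr_eq0; apply/eqP.
apply/matrixP => k j; rewrite [RHS]mxE.
have G0 : {ae mu, forall u : TR, `]0, a[%classic u -> G a u k j = 0}.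
  have := row0 k; apply: filterS => u Hu Du.
  have {}Hu : row k (G a u) = 0 by rewrite -[LHS]trmxCK (Hu Du) adjmx0.
  by have := congr1 (fun A : 'rV[C]_m2 => A 0 j) Hu; rewrite !mxE.
have cpair : continuous (fun u : R => (a, u)).
  move=> u; have ca : (fun=> a) @ u --> a by exact: cvg_cst.
  exact: (cvg_pair ca (cvg_id : id @ u --> u)).
have [c1 c2] := cG k j.
(* Continuity in t upgrades the almost everywhere identity to all of [0, a], end points included. *)
have q1 : complex.Re (G a t k j) = 0.
  apply: (@continuous_ae_eq0 _ 0 a t (fun u => complex.Re (G a u k j)) _ a0 _ ta).
    by move=> u; apply: (@continuous_comp _ _ _ (fun u : R => (a, u)) _ u (cpair u) (c1 _)).
  by have := G0; apply: filterS => u Hu Du; rewrite Hu.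
have q2 : complex.Im (G a t k j) = 0.
  apply: (@continuous_ae_eq0 _ 0 a t (fun u => complex.Im (G a u k j)) _ a0 _ ta).
    by move=> u; apply: (@continuous_comp _ _ _ (fun u : R => (a, u)) _ u (cpair u) (c2 _)).
  by have := G0; apply: filterS => u Hu Du; rewrite Hu.
by rewrite -[LHS]/(G a t k j); move: q1 q2; case: (G a t k j) => ? ? /= -> ->.
Qed.

Lemma factorization_unique l (E1 E2 : R -> R -> 'M[C]_m2) : 0 < l ->
  mxkernel_continuous [set p : R * R | 0 <= p.2 <= p.1 /\ p.1 <= l] E1 ->
  mxkernel_continuous [set p : R * R | 0 <= p.2 <= p.1 /\ p.1 <= l] E2 ->
  factorizes_inverse l (S_op Phi l) E1 -> factorizes_inverse l (S_op Phi l) E2 ->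
  forall x t : R, 0 <= t <= x -> x <= l -> E1 x t = E2 x t.
Proof.
move=> l0 cE1 cE2 fac1 fac2 x t tx xl.
have [F1 cF1 EF1] := clamp_kernel l0 cE1; have [F2 cF2 EF2] := clamp_kernel l0 cE2.
rewrite EF1// EF2//.
have agree := factor_kernels_agree _ cF1 cF2 EF1 EF2 fac1 fac2.
(* Points of the triangle with first coordinate 0 or l are limits of points of
   the segment towards (l/2, l/2). *)
pose p (y z : R) : R := (1 - y) * z + y * (l / 2).
have cp z : continuous (p ^~ z).
  move=> y; apply: cvgD; apply: cvgM; try exact: cvg_cst; last exact: cvg_id.
  by apply: cvgB; [exact: cvg_cst|exact: cvg_id].
have cpp : continuous (fun y : R => (p y x, p y t)).
  by move=> y; exact: (cvg_pair (cp x y) (cp t y)).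
have p0 z : p 0 z = z by rewrite /p subr0 mul1r mul0r addr0.
have /andP[t0 tx'] := tx.
have eqp y : 0 < y < 1 -> F1 (p y x) (p y t) = F2 (p y x) (p y t).
  move=> /andP[y0 y1]; have y1' : 0 < 1 - y by rewrite subr_gt0.
  have h1 := mulr_ge0 (ltW y1') t0.
  have h2 : (1 - y) * t <= (1 - y) * x by rewrite ler_wpM2l// ltW.
  have h3 : (1 - y) * x <= (1 - y) * l by rewrite ler_wpM2l// ltW.
  have h4 := mulr_gt0 y0 l0.
  apply: agree; rewrite /p; apply/andP; split; lra.
have l01 : (0 <= 0 :> R) && (0 <= 1 :> R) by rewrite lexx ler01.
apply/matrixP => i j; have [c1 c2] := cF1 i j; have [c3 c4] := cF2 i j.
have ext (f1 f2 : R * R -> R) : continuous f1 -> continuous f2 ->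
    (forall y, 0 < y < 1 -> f1 (p y x, p y t) = f2 (p y x, p y t)) ->
    f1 (x, t) = f2 (x, t).
  move=> cf1 cf2 f12.
  have := @continuous_ae_eq0 R 0 1 0 (fun y => f1 (p y x, p y t) - f2 (p y x, p y t)).
  rewrite !p0 => H; apply/eqP; rewrite -subr_eq0; apply/eqP; apply: H => //.
    move=> y; apply: cvgB.
      exact: (@continuous_comp _ _ _ (fun y : R => (p y x, p y t)) _ y (cpp y) (cf1 _)).
    exact: (@continuous_comp _ _ _ (fun y : R => (p y x, p y t)) _ y (cpp y) (cf2 _)).
  by apply: aeW => y /itvooP yb; rewrite f12// subrr.
have q1 := ext _ _ c1 c3 (fun y yb => congr1 (fun A : 'M[C]_m2 => complex.Re (A i j)) (eqp y yb)).
have q2 := ext _ _ c2 c4 (fun y yb => congr1 (fun A : 'M[C]_m2 => complex.Im (A i j)) (eqp y yb)).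
by move: q1 q2 => /=; case: (F1 x t i j) (F2 x t i j) => ? ? [? ?] /= -> ->.
Qed.

End UniqueFactorization.

Theorem theorem4p2 (R : realType) (m1 m2 : nat)
    (m1_gt0 : (0 < m1)%N) (m2_gt0 : (0 < m2)%N)
    (Phi1 : R -> 'M[R[i]]_(m2, m1))
    (Phi1_bdiff : forall l : R, 0 < l -> boundedly_differentiable Phi1 l)
    (Phi1_0 : Phi1 0 = 0)
    (S_bounded : forall l : R, 0 < l -> bounded_operator l (S_op Phi1 l))
    (S_inv : forall l : R, 0 < l -> boundedly_invertible l (S_op Phi1 l)) :
  (exists E : R -> R -> 'M[R[i]]_m2,
     mxkernel_continuous [set p : R * R | 0 <= p.2 <= p.1] E /\
     forall l : R, 0 < l -> factorizes_inverse l (S_op Phi1 l) E) /\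
  (forall (l : R) (E1 E2 : R -> R -> 'M[R[i]]_m2), 0 < l ->
     mxkernel_continuous [set p : R * R | 0 <= p.2 <= p.1 /\ p.1 <= l] E1 ->
     mxkernel_continuous [set p : R * R | 0 <= p.2 <= p.1 /\ p.1 <= l] E2 ->
     factorizes_inverse l (S_op Phi1 l) E1 ->
     factorizes_inverse l (S_op Phi1 l) E2 ->
     forall x t : R, 0 <= t <= x -> x <= l -> E1 x t = E2 x t).
Proof.
split; first exact: factorization_exists.
move=> l E1 E2 l0 cE1 cE2 fac1 fac2.
exact: (factorization_unique Phi1_bdiff Phi1_0 S_bounded S_inv l0 cE1 cE2 fac1 fac2).
Qed.
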